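(* Let $f$ be a GSP over $T\in\{\mathbb Z,\mathbb R\}$ with spectral measure $\rho$ such that $m_0=\rho(T^* )=1$ and $m_\delta<\infty$ for some $\delta>0$. Assume that $\sigma_N^2\ge bN^{-\gamma}$ holds on a subsequence of $N\in\mathbb N$, where $b,\gamma>0$ are some constants. Then there exist $C,N_0>0$ such that along this subsequence, for $N>N_0$, $$\log P_f(N)\ge\begin{cases}-CN^{\gamma}\log N, & \gamma<1,\\ -CN, & \gamma=1,\\ -CN\log N, & \gamma>1\text{ and }T=\mathbb Z.\end{cases}$$ Here $N_0$ and $C$ depend only on $b,\gamma,\delta,m_\delta$.
   Context: Let $T\in\{\mathbb Z,\mathbb R\}$; put $T^*=\mathbb R$ if $T=\mathbb R$ and $T^*=[-\pi,\pi]$ if $T=\mathbb Z$. A GSP (Gaussian stationary process) over $T$ is a random function $f:T\to\mathbb R$ whose finite-dimensional marginals are centered multivariate Gaussian and whose distribution is invariant under translations by elements of $T$; throughout, $f$ is assumed almost surely continuous with continuous covariance kernel $r(t)=\mathbb E[f(0)f(t)]$. Its spectral measure is the finite, symmetric, non-negative measure $\rho$ on $T^*$ such that $r(t)=\int_{T^*}e^{-i\lambda t}\,d\rho(\lambda)$ for $t\in T$. The persistence probability is $P_f(N)=\mathbb P\big(f(t)>0\ \ \forall t\in(0,N]\cap T\big)$. For $\delta\in\mathbb R$ put $m_\delta=m_\delta(\rho)=\int_{T^*}|\lambda|^\delta\,d\rho(\lambda)$, and for $N>0$ put $\sigma_N^2=\rho([0,\tfrac1N])$. *)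

(* Defs.v *)
From HB Require Import structures.
From mathcomp Require Import all_boot all_order all_algebra.
From mathcomp Require Import all_classical all_reals all_analysis.
Set Implicit Arguments.
Unset Strict Implicit.
Unset Printing Implicit Defensive.
Import Order.TTheory GRing.Theory Num.Theory.
Import numFieldNormedType.Exports.
Local Open Scope classical_set_scope.
Local Open Scope ring_scope.

Inductive time := IntegerTime | RealTime.

(* The time set T is a subset of R.  A process over T is a family f indexed by
   all of R, of which only the members f t with t in T are ever constrained
   or used (apart from measurability, which is part of the type of f). *)
Definition time_set (R : realType) (T : time) : set R :=
  match T with
  | IntegerTime => range (fun k : int => k%:~R)
  | RealTime => setT
  end.
Arguments time_set {R} T.

(* T^* *)
Definition dual_set (R : realType) (T : time) : set R :=
  match T with
  | IntegerTime => `[- pi, pi]%classic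
  | RealTime => setT
  end.
Arguments dual_set {R} T.

(* The law N(0, s^2).  The library's normal_prob 0 0 is not the degenerate
   Gaussian, so the case s = 0 is the Dirac mass at 0. *)
Definition centered_normal (R : realType) (s : R) : set R -> \bar R :=
  if s == 0 then @dirac _ (measurableTypeR R) 0 R else normal_prob 0 s.

Section process.
Local Open Scope ereal_scope.
Context (R : realType) (T : time) (d : measure_display)
  (Omega : measurableType d) (P : probability Omega R).
Implicit Type f : R -> {RV P >-> R}.

Definition centered_gaussian (X : Omega -> R) :=
  exists2 s : R, (0 <= s)%R &
    forall B : set R, measurable B -> P (X @^-1` B) = centered_normal s B.

(* Multivariate normality: every linear combination of finitely many values
   is a (possibly degenerate) centered Gaussian. *)
Definition gaussian_marginals f :=
  forall (n : nat) (t : 'I_n -> R) (a : 'I_n -> R),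
    (forall i, time_set T (t i)) ->
    centered_gaussian (fun w => \sum_(i < n) a i * f (t i) w)%R.

(* Generators of the product sigma-algebra on functions over T. *)
Definition cylinders : set (set (R -> R)) :=
  [set E | exists t : R, exists2 B : set R,
     time_set T t /\ measurable B & E = [set x | B (x t)]].

Definition stationary f :=
  forall (s : R) (E : set (R -> R)), time_set T s -> <<s cylinders >> E ->
    P [set w | E (fun t => f (t + s)%R w)] = P [set w | E (fun t => f t w)].

Definition cov_kernel f (t : R) : \bar R :=
  'E_P[fun w => (f 0%R w * f t w)%R].

Definition gsp f :=
  [/\ gaussian_marginals f,
      stationary f,
      {ae P, forall w, {within time_set T, continuous (fun t => f t w)}} &
      {within time_set T, continuous (fun t => fine (cov_kernel f t))}].

(* rho is a measure on R carried by T^*.  The identity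
   r(t) = \int e^(-i lambda t) drho(lambda), r being real-valued, is written
   as its real part and its imaginary part. *)
Definition spectral_measure f
    (rho : {finite_measure set (measurableTypeR R) -> \bar R}) :=
  [/\ rho (~` dual_set T) = 0,
      forall A : set R, measurable A -> rho [set - x | x in A]%R = rho A &
      forall t, time_set T t ->
        cov_kernel f t = \int[rho]_(l in dual_set T) (cos (l * t))%:E /\
        0 = \int[rho]_(l in dual_set T) (- sin (l * t))%:E].

Definition persistence_event f (N : R) : set Omega :=
  [set w | forall t, time_set T t -> (0 < t <= N)%R -> (0 < f t w)%R].

(* In continuous time, with paths continuous only almost surely, the
   persistence event is measurable for the completion of P but not
   necessarily for the sigma-algebra of Omega. *)
Definition persistence f (N : R) : \bar R :=
  @completed_measure_extension _ _ _ P (persistence_event f N).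

End process.

(* For delta < 0 this is not the moment m_delta when rho has an atom at 0,
   since 0 `^ delta = 0 here. *)
Definition moment (R : realType) (T : time)
    (rho : {finite_measure set (measurableTypeR R) -> \bar R})
    (delta : R) : \bar R :=
  (\int[rho]_(l in dual_set T) (`|l| `^ delta)%:E)%E.

Definition sigma2 (R : realType)
    (rho : {finite_measure set (measurableTypeR R) -> \bar R})
    (N : R) : \bar R :=
  rho `[0, N^-1]%classic.

(* Main.v *)
(** The real span of the [f t] is a Gaussian space.  Its elements are compared
    through their spectral densities: a cosine polynomial [w] with frequencies
    in the time set is the density of some [Y] in the span, with
    [E[f t * Y] = \int cos (t x) w x d(rho x)].  Choosing [w] close to the
    indicator of [[-1/N, 1/N]] gives a [Y] of variance about [sigma_N^2] whose
    covariance with every [f t], [0 <= t <= N], is bounded below by a multiple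
    of its variance.  Write [f t = g t + c t * Y] with [g] independent of [Y]:
    on the event that [|g| < L] on a dyadic grid of [[0, N + 1]] and that [Y] is
    large, [f] is at least [L] on that grid; the bound being uniform in the mesh,
    [f] is positive everywhere by continuity.
    Forcing [Y] to be large costs a factor [exp (- O(L^2 / sigma_N^2))].

    The event [|g| < L] is bounded below by pigeonhole: discretize [g] into cells,
    let two independent copies [X], [X'] fall in the same cell, and use that
    [(X - X') / sqrt 2] has the law of [X].  With the moment condition this is
    done along a dyadic chaining and gives [exp (- O(N exp (- kappa L^2)))]; over
    the integers it gives [(c L^2)^(N+1)].  The three regimes correspond to [L]
    of order [sqrt (log N)], [1] and [N^(- gamma / 2)].

    Equality of laws is never needed on general sets: two random vectors whose
    linear forms have the same cosine transforms are compared on boxes through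
    cosine polynomials approximating indicators. *)
Require Import Defs.
From mathcomp Require Import all_boot all_order all_algebra.
From mathcomp Require Import all_classical all_reals all_analysis.
From mathcomp Require Import measurable_realfun zify ring lra.
Set Implicit Arguments.
Unset Strict Implicit.
Unset Printing Implicit Defensive.
Import Order.TTheory GRing.Theory Num.Theory.
Import numFieldNormedType.Exports.
Local Open Scope classical_set_scope.
Local Open Scope ring_scope.

(** * Gaussian integrals *)

(** The constants may depend only on [b], [gamma], [delta], [m], and no bound may deteriorate as the
    grid is refined. Finiteness of [m_delta] enters through the increments: over a dyadic step
    [2^-m] their standard deviation is at most [sigma th^(2m)] with [th < 1]. Cells of width
    proportional to [th^m] have total width at most [L], while the chance of leaving the central one
    is doubly exponentially small in [m] and beats the [2^m] points of the level. The pigeonhole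
    argument stands in for a correlation inequality: it only asks for expected cell indices, which
    add up whatever the dependence. As [sigma_N^2 >= b N^-gamma], the total cost is the ball cost
    plus a multiple of [L^2 N^gamma / b]. For [gamma < 1] the ball cost is made bounded, at the
    price of a factor [log N] in [L^2]; for [gamma = 1] both costs are linear in [N]; for
    [gamma > 1] the shift cost is made bounded and [L] tends to 0. Chaining requires [L] bounded
    below, so this last choice is confined to the integers, where the grid is the time set and is
    never refined. *)

Section density.
Local Open Scope ereal_scope.
Import HBNNSimple.
Context d (T : measurableType d) (R : realType)
  (mu nu : {measure set T -> \bar R}) (p : T -> R).
Hypothesis mp : measurable_fun setT p.
Hypothesis p0 : forall x, (0 <= p x)%R.
Hypothesis nuE : forall A, measurable A -> nu A = \int[mu]_(x in A) (p x)%:E.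

Let density_indic E : measurable E ->
  \int[nu]_x (\1_E x)%:E = \int[mu]_x ((\1_E x)%:E * (p x)%:E).
Proof.
move=> mE; rewrite integral_indic// setIT nuE// integral_mkcond.
apply: eq_integral => x _; rewrite patchE indicE.
by case: ifPn => [_|_] /=; rewrite ?mul1e ?mul0e.
Qed.

Let density_nnsfun (f : {nnsfun T >-> R}) :
  \int[nu]_x (f x)%:E = \int[mu]_x ((f x)%:E * (p x)%:E).
Proof.
under [LHS]eq_integral do rewrite fimfunE -fsumEFin//.
rewrite [LHS]ge0_integral_fsum//; last 2 first.
  - by move=> r; exact/measurable_EFinP/measurableT_comp.
  - by move=> n x _; rewrite EFinM nnfun_muleindic_ge0.
under [RHS]eq_integral.
  move=> x xD; rewrite fimfunE -fsumEFin// ge0_mule_fsuml; last first.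
    by move=> r; rewrite EFinM nnfun_muleindic_ge0.
  over.
rewrite [RHS]ge0_integral_fsum//; last 2 first.
  - move=> r; apply: emeasurable_funM; last exact/measurable_EFinP.
    by apply/measurable_EFinP/measurableT_comp.
  - move=> n x _; rewrite EFinM mule_ge0//; last by rewrite lee_fin.
    by rewrite nnfun_muleindic_ge0.
apply: eq_fsbigr => r _.
have [r0|r0] := ltP r 0%R.
  rewrite [LHS]integral0_eq; last first.
    by move=> x _; rewrite preimage_nnfun0// indicE in_set0 mulr0.
  by rewrite [RHS]integral0_eq// => x _; rewrite preimage_nnfun0// indicE in_set0 mulr0 mul0e.
under eq_integral do rewrite EFinM.
under [RHS]eq_integral do rewrite EFinM -muleA.
rewrite !ge0_integralZl//.
- by rewrite density_indic.
- by apply: emeasurable_funM; exact/measurable_EFinP.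
- by move=> x _; rewrite mule_ge0// lee_fin.
- exact/measurable_EFinP.
Qed.

Lemma ge0_integral_density (f : T -> \bar R) : measurable_fun setT f ->
  (forall x, 0 <= f x) -> \int[nu]_x f x = \int[mu]_x (f x * (p x)%:E).
Proof.
move=> mf f0.
pose f_ := nnsfun_approx measurableT mf.
transitivity (lim (\int[nu]_x (f_ n x)%:E @[n --> \oo])).
  rewrite -monotone_convergence//=.
  - apply: eq_integral => ? /[!inE] xD; apply/esym/cvg_lim => //=.
    exact: cvg_nnsfun_approx.
  - by move=> n; exact/measurable_EFinP/measurable_funTS.
  - by move=> n ? _; rewrite lee_fin.
  - by move=> ? _ ? ? mn; rewrite lee_fin; exact/lefP/nd_nnsfun_approx.
rewrite [RHS](_ : _ = lim (\int[mu]_x ((f_ n x)%:E * (p x)%:E) @[n --> \oo])).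
  by apply: congr_lim; apply/funext => n /=; exact: density_nnsfun.
rewrite -monotone_convergence//=.
- apply: eq_integral => x _; apply/esym/cvg_lim => //.
  by apply: cvgeZr => //; exact: cvg_nnsfun_approx.
- move=> n; apply: emeasurable_funM; last exact/measurable_EFinP.
  exact/measurable_EFinP.
- by move=> n x _; rewrite mule_ge0// lee_fin.
- move=> x _ m n mn; apply: lee_wpmul2r; first by rewrite lee_fin.
  by rewrite lee_fin; exact/lefP/nd_nnsfun_approx.
Qed.

End density.

(** Integration by parts on the line with vanishing boundary terms. It yields the second moment
    (from [x * p x]) and the cosine transform (from [sin (a * x + t) * p x]). Limits along the
    integers suffice, since the intervals [[- n.+1, n.+1]] exhaust the line. *)
Lemma integral_derive_line (R : realType) (F G : R -> R) :
  (forall x : R, is_derive x 1 F (G x)) -> continuous G ->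
  (@lebesgue_measure R).-integrable setT (EFin \o G) ->
  F n%:R @[n --> \oo] --> (0 : R) -> F (- n%:R) @[n --> \oo] --> (0 : R) ->
  (\int[@lebesgue_measure R]_x (G x)%:E = 0)%E.
Proof.
move=> dF cG iG F0 FN0.
set mu := @lebesgue_measure R.
have mG : measurable_fun setT G by exact: continuous_measurable_fun.
pose I (n : nat) : set R := `[- n.+1%:R, n.+1%:R]%classic.
have step n : (\int[mu]_(x in I n) (G x)%:E = (F n.+1%:R - F (- n.+1%:R))%:E)%E.
  have n0 : (0 : R) < n.+1%:R by [].
  have cF x : {for x, continuous F}.
    by apply/differentiable_continuous/derivable1_diffP; have [] := dF x.
  rewrite (@continuous_FTC2 R G F) ?EFinB//.
  - by rewrite -subr_gt0 opprK addr_gt0.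
  - exact/continuous_subspaceT.
  - split.
    + by move=> x _; have [] := dF x.
    + exact/cvg_at_right_filter/cF.
    + exact/cvg_at_left_filter/cF.
  - by move=> x _; rewrite derive1E; have [_ ->] := dF x.
have mI n : measurable_fun setT (fun x => (G x * \1_(I n) x)%:E).
  by apply/measurable_EFinP/measurable_funM => //; apply: measurable_indic; exact: measurable_itv.
have cI : {ae mu, forall x, setT x ->
    (G x * \1_(I n) x)%:E @[n --> \oo] --> (EFin \o G) x}.
  apply: aeW => x _; apply: cvg_EFin; first exact: nearW.
  apply: cvg_near_cst; exists (Num.truncn `|x|) => // n /= xn.
  rewrite indicE mem_set ?mulr1// /I /= in_itv /= -ler_norml.
  rewrite (le_trans (ltW (truncnS_gt _)))// ler_nat.
  by rewrite ltnS.
have bI : {ae mu, forall x n, setT x ->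
    (`|(G x * \1_(I n) x)%:E| <= `|(EFin \o G) x|)%E}.
  apply: aeW => x n _ /=; rewrite lee_fin normrM ler_piMr//.
  by rewrite indicE; case: (_ \in _); rewrite ?normr1 ?normr0.
have mG' : measurable_fun setT (EFin \o G) by exact/measurable_EFinP.
have [_ _ cvgI] := @dominated_convergence _ _ _ mu _ measurableT _ _ _ mI mG' cI (integrable_abse iG) bI.
have /cvg_lim <- // := cvgI.
apply/cvg_lim => //=.
rewrite (_ : (fun n => _) = (fun n => (F n.+1%:R - F (- n.+1%:R))%:E)); last first.
  apply/funext => n; rewrite -step [RHS]integral_mkcond; apply: eq_integral => x _.
  by rewrite patchE indicE; case: ifPn => _ /=; rewrite ?mulr1 ?mulr0.
apply: cvg_EFin; first exact: nearW.
rewrite -[X in _ --> X](subr0 0); apply: cvgB.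
  by rewrite (cvg_shiftS (fun n => F n%:R)).
by rewrite (cvg_shiftS (fun n => F (- n%:R))).
Qed.

Section normal.
Variable (R : realType) (s : R).
Hypothesis s0 : 0 < s.
Local Notation mu := (@lebesgue_measure R).
Local Notation p := (normal_pdf 0 s).

Lemma normal_pdf_centered x : p x = normal_peak s * expR (- x ^+ 2 / (s ^+ 2 *+ 2)).
Proof. by rewrite normal_pdfE ?gt_eqF// /normal_fun subr0. Qed.

Let cp : continuous p. Proof. by apply: continuous_normal_pdf; rewrite gt_eqF. Qed.
Let mp : measurable_fun setT p. Proof. exact: measurable_normal_pdf. Qed.
Let p0 x : 0 <= p x. Proof. exact: normal_pdf_ge0. Qed.
Let ip : mu.-integrable setT (EFin \o p). Proof. exact: integrable_normal_pdf. Qed.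

Lemma is_derive_normal_pdf (x : R) : is_derive x 1 p (- (x / s ^+ 2) * p x).
Proof.
have -> : p = (fun x : R => normal_peak s * expR (- x ^+ 2 / (s ^+ 2 *+ 2))).
  by apply/funext => y; exact: normal_pdf_centered.
apply: is_derive_eq.
rewrite /GRing.scale /=.
have sn0 : s != 0 by rewrite gt_eqF.
by field.
Qed.

(** With the constant 4 the exponents add up to [- x^2 / (4 s^2)], so the integrand is [sqrt 2]
    times the density of variance [2 s^2]. *)
Lemma integral_expR_sqr_normal :
  (\int[mu]_x (expR (x ^+ 2 / (4 * s ^+ 2)) * p x)%:E = (Num.sqrt 2)%:E)%E.
Proof.
pose s' := Num.sqrt 2 * s.
have r2 : 0 < Num.sqrt 2 :> R by rewrite sqrtr_gt0.
have s'0 : 0 < s' by rewrite mulr_gt0.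
have s'E : s' ^+ 2 = 2 * s ^+ 2 by rewrite exprMn sqr_sqrtr.
transitivity (\int[mu]_x ((Num.sqrt 2)%:E * (normal_pdf 0 s' x)%:E))%E.
  apply: eq_integral => x _; rewrite normal_pdf_centered.
  rewrite normal_pdfE ?gt_eqF// /normal_fun subr0 -EFinM; congr EFin.
  rewrite mulrCA -expRD [RHS]mulrA; congr (_ * _); last first.
    congr expR; rewrite s'E; field; by rewrite gt_eqF.
  rewrite /normal_peak s'E.
  have -> : 2 * s ^+ 2 * pi *+ 2 = 2 * (s ^+ 2 * pi *+ 2) :> R by rewrite -mulrA mulrnAr.
  by rewrite [in RHS]sqrtrM// invfM mulrA divff ?mul1r// gt_eqF.
rewrite integralZl//; last exact: integrable_normal_pdf.
by rewrite integral_normal_pdf mule1.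
Qed.

Let iexp : mu.-integrable setT (fun x : R => (expR (x ^+ 2 / (4 * s ^+ 2)) * p x)%:E).
Proof.
have me : measurable_fun setT (fun x : R => (expR (x ^+ 2 / (4 * s ^+ 2)) * p x)%:E).
  apply/measurable_EFinP/measurable_funM => //.
  apply: measurableT_comp => //; apply: measurable_funM => //.
apply/integrableP; split => //.
apply/abse_integralP => //.
by rewrite integral_expR_sqr_normal ltry.
Qed.

(** The exponential integrated above dominates: with [y = x^2 / (4 s^2)],
    [1 + x^2 <= (1 + 4 s^2) exp y]. *)
Lemma integrable_poly2_normal (g : R -> R) (C : R) : measurable_fun setT g ->
  (forall x, `|g x| <= C * (1 + x ^+ 2)) ->
  mu.-integrable setT (fun x : R => (g x * p x)%:E).
Proof.
move=> mg gC.
have C0 : 0 <= C.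
  by have := le_trans (normr_ge0 _) (gC 0); rewrite expr0n/= addr0 mulr1.
apply: (le_integrable measurableT _ _ (integrableZl measurableT (C * (1 + 4 * s ^+ 2)) iexp)).
  by apply/measurable_EFinP/measurable_funM.
move=> x _ /=; rewrite lee_fin !normrM !(ger0_norm (p0 _)) mulrA ler_wpM2r//.
rewrite (le_trans (gC x))//.
rewrite (ger0_norm C0) -mulrA ler_wpM2l// ger0_norm; last first.
  by rewrite addr_ge0// mulr_ge0// sqr_ge0.
rewrite ger0_norm ?expR_ge0//.
have := expR_ge1Dx (x ^+ 2 / (4 * s ^+ 2)).
have s20 : 0 < 4 * s ^+ 2 by rewrite mulr_gt0// exprn_gt0.
set e := expR _; set y := x ^+ 2 / _ => ye.
have -> : x ^+ 2 = 4 * s ^+ 2 * y by rewrite /y mulrCA divff ?mulr1// gt_eqF.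
have y0 : 0 <= y by rewrite divr_ge0 ?sqr_ge0// ltW.
move: s20 ye y0; move: (4 * _) => t; nra.
Qed.

(** The sequence [u] serves for both ends of the line. Since [exp (- y) <= 1 / y] for
    [y = m^2 / (2 s^2)], the linear growth of [g] leaves a multiple of [1 / m]. *)
Lemma normal_pdf_decay (g : R -> R) (C : R) (u : nat -> R) :
  (forall x, `|g x| <= C * (1 + `|x|)) -> (forall n, `|u n| = n%:R) ->
  (g (u n) * p (u n)) @[n --> \oo] --> (0 : R).
Proof.
move=> gC uE.
apply: norm_cvg0; rewrite -cvg_shiftS /=.
apply: (@squeeze_cvgr _ _ _ _ (cst 0)
  (fun n => 4 * C * normal_peak s * s ^+ 2 * n.+1%:R^-1)).
- apply: nearW => n; rewrite /= normr_ge0 /= normrM normal_pdf_centered.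
  rewrite [`|normal_peak s * _|]ger0_norm; last by rewrite mulr_ge0 ?normal_peak_ge0 ?expR_ge0.
  have C0 : 0 <= C.
    by have := le_trans (normr_ge0 _) (gC 0); rewrite normr0 addr0 mulr1.
  have {}gC : `|g (u n.+1)| <= C * (2 * n.+1%:R).
    rewrite (le_trans (gC _))// ler_wpM2l// uE mulr2n mulrDl mul1r lerD2r.
    by rewrite ler1n.
  have -> : u n.+1 ^+ 2 = n.+1%:R ^+ 2 by rewrite -real_normK ?num_real// uE.
  set m : R := n.+1%:R.
  have m0 : 0 < m by rewrite /m.
  have eb : expR (- m ^+ 2 / (s ^+ 2 *+ 2)) <= 2 * s ^+ 2 / m ^+ 2.
    have s2E : s ^+ 2 *+ 2 = 2 * s ^+ 2 by rewrite mulr_natl.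
    rewrite s2E mulNr expRN.
    rewrite -[leRHS]invrK lef_pV2 ?posrE ?expR_gt0//; last first.
      by rewrite invr_gt0 divr_gt0 ?mulr_gt0 ?exprn_gt0.
    by rewrite (le_trans _ (expR_ge1Dx _))// invf_div lerDr.
  apply: (@le_trans _ _ (C * (2 * m) * (normal_peak s * (2 * s ^+ 2 / m ^+ 2)))).
    rewrite ler_pM// ?mulr_ge0 ?normal_peak_ge0 ?expR_ge0//.
    by rewrite ler_wpM2l ?normal_peak_ge0.
  by rewrite le_eqVlt; apply/orP; left; apply/eqP; field; rewrite gt_eqF.
- exact: cvg_cst.
- rewrite -(mulr0 (4 * C * normal_peak s * s ^+ 2)).
  apply: cvgMr.
  exact: cvg_harmonic.
Qed.

Lemma integral_sqr_normal : (\int[mu]_x (x ^+ 2 * p x)%:E = (s ^+ 2)%:E)%E.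
Proof.
have i2 : mu.-integrable setT (fun x : R => (x ^+ 2 * p x)%:E).
  apply: (integrable_poly2_normal (C := 1)); first exact: measurable_funX.
  by move=> x; rewrite mul1r ger0_norm ?sqr_ge0// lerDr.
have := @integral_derive_line R (fun x : R => x * p x)
  (fun x : R => p x - (s ^+ 2)^-1 * (x ^+ 2 * p x)).
have iG : mu.-integrable setT (EFin \o (fun x : R => p x - (s ^+ 2)^-1 * (x ^+ 2 * p x))).
  rewrite (_ : _ \o _ = (EFin \o p) \- (fun x : R => (s ^+ 2)^-1%:E * (x ^+ 2 * p x)%:E))%E; last first.
    by apply/funext => x /=; rewrite EFinB EFinM.
  by apply: integrableB => //; exact: integrableZl.
move=> /(_ _ _ iG); rewrite /= => H.
have : (\int[mu]_x (p x - (s ^+ 2)^-1 * (x ^+ 2 * p x))%:E = 0)%E.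
  apply: H.
  - move=> x; apply: is_derive_eq; first exact: is_deriveM (is_derive_id _ _) (is_derive_normal_pdf _).
    by rewrite /GRing.scale /=; have sn0 := lt0r_neq0 s0; field.
  - move=> x; apply: cvgB; first exact: cp.
    apply: cvgM; first exact: cvg_cst.
    apply: cvgM; last exact: cp.
    exact: exprn_continuous.
  - apply: (@normal_pdf_decay id 1) => [x|n]; first by rewrite mul1r lerDr.
    by rewrite normr_nat.
  - apply: (@normal_pdf_decay id 1 (fun n => - n%:R)) => [x|n]; first by rewrite mul1r lerDr.
    by rewrite normrN normr_nat.
under eq_integral do rewrite EFinB EFinM.
rewrite integralB//; last exact: integrableZl.
rewrite integral_normal_pdf integralZl//.
have := integrable_fin_num measurableT i2.
case: integral => // r _ [] /eqP; rewrite subr_eq0 => /eqP r1.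
by congr EFin; rewrite -[RHS]mulr1 r1 mulrA mulfV ?mul1r// gt_eqF// exprn_gt0.
Qed.

End normal.

Lemma measurable_cosR (R : realType) : measurable_fun setT (@cos R).
Proof. apply: continuous_measurable_fun; exact: continuous_cos. Qed.

Lemma measurable_sinR (R : realType) : measurable_fun setT (@sin R).
Proof. apply: continuous_measurable_fun; exact: continuous_sin. Qed.

Section normal_transform.
Variable (R : realType) (s : R).
Hypothesis s0 : 0 < s.
Local Notation mu := (@lebesgue_measure R).
Local Notation p := (normal_pdf 0 s).

Let sn0 : s != 0. Proof. by rewrite gt_eqF. Qed.
Let cp : continuous p. Proof. exact: continuous_normal_pdf. Qed.
Let p0 x : 0 <= p x. Proof. exact: normal_pdf_ge0. Qed.

Let trig_bound (g : R -> R) (C : R) : measurable_fun setT g ->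
  (forall x, `|g x| <= C) -> mu.-integrable setT (fun x : R => (x * (g x * p x))%:E).
Proof.
move=> mg gC.
have C0 : 0 <= C := le_trans (normr_ge0 _) (gC 0).
under eq_fun do rewrite mulrA.
apply: (integrable_poly2_normal s0 (C := C)); first exact: measurable_funM.
move=> x; rewrite normrM mulrC ler_pM//.
by rewrite -[x ^+ 2]real_normK ?num_real//; nra.
Qed.

Let bounded_int (g : R -> R) (C : R) : measurable_fun setT g ->
  (forall x, `|g x| <= C) -> mu.-integrable setT (fun x : R => (g x * p x)%:E).
Proof.
move=> mg gC.
have C0 : 0 <= C := le_trans (normr_ge0 _) (gC 0).
apply: (integrable_poly2_normal s0 (C := C)) => // x.
by rewrite (le_trans (gC x))// ler_peMr// lerDl sqr_ge0.
Qed.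

Let cosb (x : R) : `|cos x| <= 1. Proof. by rewrite ler_norml cos_geN1 cos_le1. Qed.
Let sinb (x : R) : `|sin x| <= 1. Proof. by rewrite ler_norml sin_geN1 sin_le1. Qed.

Let mcos a t : measurable_fun setT (fun x : R => cos (a * x + t)).
Proof.
apply: (measurableT_comp (f := @cos R)); first exact: measurable_cosR.
by apply: measurable_funD => //; exact: measurable_funM.
Qed.

Let msin a t : measurable_fun setT (fun x : R => sin (a * x + t)).
Proof.
apply: (measurableT_comp (f := @sin R)); first exact: measurable_sinR.
by apply: measurable_funD => //; exact: measurable_funM.
Qed.

(** In the variable [a] this transform solves [psi' = - s^2 a psi]: differentiate under the
    integral, then integrate by parts. Hence [psi t a * exp (a^2 s^2 / 2)] is constant. The phase
    [t] covers cosine and sine at once and lets the formula be iterated under Fubini. *)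
Let psi t a := \int[mu]_x (cos (a * x + t) * p x).

Let parts t a : \int[mu]_x (x * (sin (a * x + t) * p x)) = s ^+ 2 * a * psi t a.
Proof.
have i1 := bounded_int (mcos a t) (fun x => cosb _).
have i2 := trig_bound (msin a t) (fun x => sinb _).
have iG : mu.-integrable setT (EFin \o (fun x : R =>
    a * (cos (a * x + t) * p x) - (s ^+ 2)^-1 * (x * (sin (a * x + t) * p x)))).
  rewrite (_ : _ \o _ = (fun x : R => a%:E * (cos (a * x + t) * p x)%:E) \-
     (fun x : R => (s ^+ 2)^-1%:E * (x * (sin (a * x + t) * p x))%:E))%E; last first.
    by apply/funext => x /=; rewrite EFinB !EFinM.
  by apply: integrableB => //; exact: integrableZl.
have H : (\int[mu]_x (a * (cos (a * x + t) * p x) - (s ^+ 2)^-1 * (x * (sin (a * x + t) * p x)))%:E = 0)%E.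
  apply: (@integral_derive_line R (fun x => sin (a * x + t) * p x) _ _ _ iG).
  - move=> x.
    apply: is_derive_eq.
      apply: is_deriveM; last exact: is_derive_normal_pdf.
    by rewrite /GRing.scale /= ; field.
  - move=> x; apply: cvgB; (apply: cvgM; [exact: cvg_cst|]).
      apply: cvgM; last exact: cp.
      apply: continuous_comp; last exact: continuous_cos.
      by apply: cvgD; [apply: cvgM => //|]; exact: cvg_cst.
    apply: cvgM => //; apply: cvgM; last exact: cp.
    apply: continuous_comp; last exact: continuous_sin.
    by apply: cvgD; [apply: cvgM => //|]; exact: cvg_cst.
  - apply: (@normal_pdf_decay _ _ s0 (fun x => sin (a * x + t)) 1 (fun n => n%:R)) => [x|n]; last by rewrite normr_nat.
    by rewrite mul1r (le_trans (sinb _))// lerDl.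
  - apply: (@normal_pdf_decay _ _ s0 (fun x => sin (a * x + t)) 1 (fun n => - n%:R)) => [x|n]; last by rewrite normrN normr_nat.
    by rewrite mul1r (le_trans (sinb _))// lerDl.
have {}H : \int[mu]_x (a * (cos (a * x + t) * p x) - (s ^+ 2)^-1 * (x * (sin (a * x + t) * p x))) = 0.
  by rewrite /Rintegral H.
move: H; rewrite RintegralB//; last 2 first.
- exact: (integrableZl measurableT a i1).
- exact: (integrableZl measurableT _ i2).
rewrite !RintegralZl// => /eqP; rewrite subr_eq0 => /eqP H.
by rewrite -mulrA H mulrA mulfV ?mul1r// sqrf_eq0.
Qed.

Let dpsi (t a : R) : is_derive a 1 (psi t) (- (s ^+ 2 * a) * psi t a).
Proof.
have d1E (x y : R) : is_derive x 1 (fun a => cos (a * y + t) * p y)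
    (- (y * (sin (x * y + t) * p y))).
  apply: is_derive_eq; rewrite /GRing.scale /=.
  by ring.
have d1 x y : partial1of2 (fun a x => cos (a * x + t) * p x) x y =
    - (y * (sin (x * y + t) * p y)).
  by rewrite partial1of2E; have [_ ->] := d1E x y.
have Ia : `](a - 1), (a + 1)[%classic a by rewrite /= in_itv /=; lra.
pose G (y : R) := `|y| * p y.
have iG : mu.-integrable setT (EFin \o G).
  apply: (integrable_poly2_normal s0 (g := fun y => `|y|) (C := 1)); first exact: normr_measurable.
  move=> x; rewrite normr_id mul1r.
  by rewrite -[x ^+ 2]real_normK ?num_real//; nra.
have intf x : `](a - 1), (a + 1)[%classic x ->
    mu.-integrable setT (EFin \o (fun y => cos (x * y + t) * p y)).
  by move=> _; exact: bounded_int (mcos x t) (fun x => cosb _).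
have derf x y : `](a - 1), (a + 1)[%classic x -> setT y ->
   derivable ((fun a x => cos (a * x + t) * p x)^~ y) x 1.
  by move=> _ _; have [] := d1E x y.
have G0 y : 0 <= G y by rewrite mulr_ge0.
have Gub x y : `](a - 1), (a + 1)[%classic x -> setT y ->
  `|partial1of2 (fun a x => cos (a * x + t) * p x) x y| <= G y.
  move=> _ _; rewrite d1 normrN normrM ler_wpM2l// normrM (ger0_norm (p0 _)).
  by rewrite ler_piMl.
have dpsi_ex : derivable (psi t) a 1.
  exact: (@derivable_under_integral _ _ _ _ _ _ measurableT _ _ _ Ia intf derf _ G0 iG Gub).
apply: DeriveDef => //.
rewrite -derive1E (differentiation_under_integral measurableT Ia intf derf G0 iG Gub).
under eq_Rintegral do rewrite /= d1 -mulN1r.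
rewrite RintegralZl// ?parts//; last exact: trig_bound (msin a t) (fun x => sinb _).
by rewrite mulN1r mulNr.
Qed.

Lemma integral_cos_normal t a :
  \int[mu]_x (cos (a * x + t) * p x) = cos t * expR (- (a ^+ 2 * s ^+ 2 / 2)).
Proof.
pose F b := psi t b * expR (b ^+ 2 * s ^+ 2 / 2).
have dF (b : R) : is_derive b 1 F 0.
  apply: is_derive_eq.
    by apply: is_deriveM; exact: dpsi.
  by rewrite /GRing.scale /=; field.
have : F a = F 0 by exact: is_derive_0_is_cst.
rewrite /F /psi.
under [in X in _ = X -> _]eq_Rintegral do rewrite mul0r add0r.
rewrite expr0n/= !mul0r expR0 mulr1 RintegralZl//; last exact: integrable_normal_pdf.
rewrite {2}/Rintegral integral_normal_pdf /= mulr1 => <-.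
by rewrite -[RHS]mulrA -expRD subrr expR0 mulr1.
Qed.

End normal_transform.

(** * Laws of centered Gaussian variables *)

Section gaussian_variable.
Context (R : realType) (d : measure_display) (Omega : measurableType d)
  (P : probability Omega R).
Local Notation mu := (@lebesgue_measure R).

Lemma bounded_integrable (X : Omega -> R) (C : R) : measurable_fun setT X ->
  (forall w, `|X w| <= C) -> P.-integrable setT (EFin \o X).
Proof.
move=> mX XC; apply: (@le_integrable _ _ _ P setT measurableT _ (EFin \o cst C)).
- exact/measurable_EFinP.
- by move=> w _ /=; rewrite lee_fin (le_trans (XC w)) ?ler_norm.
- exact: finite_measure_integrable_cst.
Qed.

Lemma Rintegral_prob_cst (c : R) : \int[P]_w c = c.
Proof.
rewrite Rintegral_cst//; set t := fine _; suff -> : t = 1 by rewrite mulr1.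
by rewrite /t; have /= -> := probability_setT P.
Qed.

Let mexp (c : R) : measurable_fun setT (fun x : R => expR (x ^+ 2 / c)).
Proof. by apply: measurableT_comp => //; exact: measurable_funM. Qed.

Let cosb (x : R) : `|cos x| <= 1. Proof. by rewrite ler_norml cos_geN1 cos_le1. Qed.

Let mcos a t : measurable_fun setT (fun x : R => cos (a * x + t)).
Proof.
apply: (measurableT_comp (f := @cos R)); first exact: measurable_cosR.
by apply: measurable_funD => //; exact: measurable_funM.
Qed.

Let ge0_integral_law (X : Omega -> R) (s : R) (g : R -> R) : measurable_fun setT X ->
  (forall B : set R, measurable B -> P (X @^-1` B) = centered_normal s B) ->
  measurable_fun setT g -> (forall x, 0 <= g x) ->
  (\int[P]_w (g (X w))%:E = if (s == 0)%R then (g 0%R)%:E else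
     \int[mu]_x (g x * normal_pdf 0 s x)%:E)%E.
Proof.
move=> mX hX mg g0.
have mg' : measurable_fun setT (EFin \o g) by exact/measurable_EFinP.
have g0' : {in setT, forall y, 0 <= (EFin \o g) y}%E by move=> y _; rewrite /= lee_fin.
have := @ge0_integral_pushforward _ _ Omega (measurableTypeR R) R X mX P setT _ measurableT mg' g0'.
rewrite preimage_setT => <-.
have [s0|s0] := eqVneq s 0.
  transitivity (\int[@dirac _ (measurableTypeR R) (0%R : R) R]_x (g x)%:E)%E.
    apply: eq_measure_integral => A mA _.
    by rewrite [LHS]hX// /centered_normal s0 eqxx.
  by rewrite integral_dirac// diracT mul1e.
transitivity (\int[normal_prob 0 s]_x (g x)%:E)%E.
  apply: eq_measure_integral => A mA _.
  by rewrite [LHS]hX// /centered_normal (negbTE s0).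
rewrite (@ge0_integral_density _ _ _ mu (normal_prob 0 s) (normal_pdf 0 s))//.
- exact: measurable_normal_pdf.
- by move=> x; exact: normal_pdf_ge0.
Qed.

Let bounded_law (X : Omega -> R) (s : R) (g : R -> R) : measurable_fun setT X ->
  (forall B : set R, measurable B -> P (X @^-1` B) = centered_normal s B) ->
  measurable_fun setT g -> (forall x, `|g x| <= 1) ->
  \int[P]_w g (X w) = if s == 0 then g 0 else \int[mu]_x (g x * normal_pdf 0 s x).
Proof.
move=> mX hX mg g1.
have g1' x : 0 <= 1 + g x by rewrite -lerBlDl sub0r; have := g1 x; rewrite ler_norml => /andP[].
have ig : P.-integrable setT (EFin \o (g \o X)).
  by apply: (@bounded_integrable _ 1) => [|w]; [exact: (measurableT_comp mg mX)|exact: g1].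
have i1 : P.-integrable setT (EFin \o cst 1) by exact: finite_measure_integrable_cst.
have H := ge0_integral_law mX hX (measurable_funD (measurable_cst _) mg) g1'.
(* Adding 1 makes the integrand nonnegative, the case already settled. *)
have -> : \int[P]_w g (X w) = \int[P]_w (1 + g (X w)) - 1.
  rewrite (@RintegralD _ _ _ P setT (cst 1) (g \o X))// Rintegral_prob_cst.
  by rewrite addrC addKr.
rewrite {1}/Rintegral H; case: ifPn => s0; first by rewrite /= addrC addKr.
have ip : mu.-integrable setT (EFin \o normal_pdf 0 s) by exact: integrable_normal_pdf.
have igp : mu.-integrable setT (EFin \o (fun x => g x * normal_pdf 0 s x)).
  apply: (le_integrable measurableT _ _ ip).
    by apply/measurable_EFinP/measurable_funM => //; exact: measurable_normal_pdf.
  by move=> x _ /=; rewrite lee_fin normrM ler_piMl.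
rewrite -[fine _]/(\int[mu]_x ((1 + g x) * normal_pdf 0 s x)).
under eq_Rintegral do rewrite mulrDl mul1r.
rewrite RintegralD// {1}/Rintegral integral_normal_pdf /=.
by rewrite addrC addKr.
Qed.

(** All that is used of a single Gaussian variable from here on; densities do not reappear.
    [gstd_exp] accepts any upper bound [S] of the deviation, because later only bounds on variances
    are known. The window of [gstd_tail] starts at the variance, in view of the shift along one
    direction. *)
Record gaussian_std (X : Omega -> R) (s : R) : Prop := GaussianStd {
  gstd_ge0 : 0 <= s ;
  gstd_sqr : (\int[P]_w (X w ^+ 2)%:E = (s ^+ 2)%:E)%E ;
  gstd_cos : forall t a, \int[P]_w cos (a * X w + t) =
    cos t * expR (- (a ^+ 2 * s ^+ 2 / 2)) ;
  gstd_exp : forall S, 0 < S -> s <= S ->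
    (\int[P]_w (expR (X w ^+ 2 / (4 * S ^+ 2)))%:E <= 2%:E)%E ;
  gstd_tail : 0 < s ->
    ((expR (- (s ^+ 2) - 3))%:E <= P [set w | s ^+ 2 < X w < s ^+ 2 + s]%R)%E
}.

Lemma centered_gaussian_std (X : Omega -> R) : measurable_fun setT X ->
  centered_gaussian P X -> exists s, gaussian_std X s.
Proof.
move=> mX [s s0 hX]; exists s.
have law := ge0_integral_law mX hX.
move: s0; rewrite le_eqVlt eq_sym => /orP[/eqP s0|s0].
  rewrite s0 in hX law *.
  rewrite eqxx in law.
  have b_law := bounded_law mX hX.
  split => //.
  - by rewrite (law (fun x => x ^+ 2)) ?expr0n//= => x; exact: sqr_ge0.
  - move=> t a; rewrite expr0n/= mulr0 mul0r oppr0 expR0 mulr1.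
    by rewrite (b_law (fun x => cos (a * x + t))) ?mulr0 ?add0r ?eqxx.
  - move=> S S0 _; rewrite (law (fun x => expR (x ^+ 2 / (4 * S ^+ 2))))//.
    by rewrite expr0n/= mul0r expR0 lee_fin ler1n.
  - by move=> h; rewrite ltxx in h.
have sn0 : s != 0 by rewrite gt_eqF.
have b_law := bounded_law mX hX.
rewrite (negbTE sn0) in law b_law.
split.
- exact: ltW.
- by rewrite (law (fun x => x ^+ 2)) ?integral_sqr_normal// => x; exact: sqr_ge0.
- by move=> t a; rewrite (b_law (fun x => cos (a * x + t)))// integral_cos_normal.
- move=> S S0 sS.
  apply: (@le_trans _ _ (\int[P]_w (expR (X w ^+ 2 / (4 * s ^+ 2)))%:E)%E).
    apply: ge0_le_integral => //.
    + by apply/measurable_EFinP; exact: (measurableT_comp (mexp _) mX).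
    + apply/measurable_EFinP; exact: (measurableT_comp (mexp _) mX).
    + move=> x _; rewrite lee_fin ler_expR ler_wpM2l ?sqr_ge0//.
      rewrite lef_pV2 ?posrE ?mulr_gt0 ?exprn_gt0// ler_pM2l//.
      by rewrite ler_pXn2r// nnegrE ltW.
  rewrite (law (fun x => expR (x ^+ 2 / (4 * s ^+ 2)))) ?integral_expR_sqr_normal//.
  rewrite lee_fin; have := sqr_sqrtr (ler0n R 2); have := sqrtr_ge0 (2 : R).
  by move: (Num.sqrt _) => r; nra.
- move=> _.
  rewrite -[X in P X]/(X @^-1` [set x | s ^+ 2 < x < s ^+ 2 + s]).
  pose I : set R := `]s ^+ 2, (s ^+ 2 + s)[%classic.
  have -> : [set x | s ^+ 2 < x < s ^+ 2 + s] = I.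
    by apply/seteqP; split => x; rewrite /I /= in_itv.
  rewrite hX; last exact: measurable_itv.
  rewrite /centered_normal (negbTE sn0) /normal_prob.
  (* A lower bound of the density on [I], where [x <= s (s + 1)]. The resulting mass [c s] is
     [exp (- (s + 1)^2 / 2) / sqrt (2 pi)], with [(s + 1)^2 / 2 <= s^2 + 1] and
     [sqrt (2 pi) <= 3 <= exp 2]. *)
  pose c := normal_peak s * expR (- ((s + 1) ^+ 2 / 2)).
  apply: (@le_trans _ _ (\int[mu]_(x in I) c%:E)%E).
    rewrite integral_cst; last exact: measurable_itv.
    have muI : mu I = s%:E.
      rewrite /I lebesgue_measure_itv/= lte_fin ltrDl s0.
      by rewrite -EFinD addrAC subrr add0r.
    rewrite [leRHS](_ : _ = (c * s)%:E); last by rewrite [RHS]EFinM; congr (_ * _)%E; exact: muI.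
    rewrite lee_fin /c mulrC mulrA.
    have -> : - s ^+ 2 - 3 = - (s ^+ 2 + 1) - 2 by ring.
    rewrite expRD [leLHS]mulrC ler_pM ?expR_ge0//.
      have pi2 : 0 < pi *+ 2 :> R by rewrite pmulrn_lgt0 ?pi_gt0.
      rewrite expRN /normal_peak -mulrnAr sqrtrM ?sqr_ge0// sqrtr_sqr gtr0_norm//.
      rewrite invfM mulrA mulfV// mul1r lef_pV2 ?posrE ?expR_gt0 ?sqrtr_gt0 ?pi2//.
      rewrite (le_trans _ (expR_ge1Dx _))//.
      have : Num.sqrt (pi *+ 2) <= Num.sqrt (3 ^+ 2) :> R.
        by rewrite ler_sqrt//; have := @pihalf_lt2 R; lra.
      by rewrite sqrtr_sqr ger0_norm//; lra.
    by rewrite ler_expR lerN2; have := sqr_ge0 (s - 1); lra.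
  apply: ge0_le_integral => //.
  + exact: measurable_itv.
  + by move=> x _; rewrite lee_fin mulr_ge0 ?normal_peak_ge0 ?expR_ge0.
  + apply/measurable_EFinP/measurable_funTS; exact: measurable_normal_pdf.
  + move=> x; rewrite /I /= in_itv /= => /andP[x1 x2].
    rewrite lee_fin normal_pdf_centered// ler_wpM2l ?normal_peak_ge0// ler_expR.
    rewrite mulNr lerN2 -mulr_natl ler_pdivrMr ?mulr_gt0 ?exprn_gt0//.
    rewrite (_ : (s + 1) ^+ 2 / 2 * (2 * s ^+ 2) = (s ^+ 2 + s) ^+ 2); last by field.
    rewrite ler_pXn2r// ?nnegrE ?(ltW x2)//.
      by rewrite (le_trans _ (ltW x1))// sqr_ge0.
    by rewrite addr_ge0 ?sqr_ge0 ?ltW.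
Qed.

End gaussian_variable.

(** * Cosine polynomials *)

Section cos_span.
Context (R : realType) (X : Type).
Implicit Types (Th : set (X -> R)) (F G : X -> R).

(** Inductive, so that integrals over the span are treated term by term. Closure of [Th] under sums
    and differences makes the span an algebra, by [2 cos a cos b = cos (a + b) + cos (a - b)]. It is
    used with affine forms, for laws of vectors, and with the phases [l * s], for the spectral
    measure. *)
Inductive cos_span Th : (X -> R) -> Prop :=
| cos_span0 : cos_span Th (fun=> 0)
| cos_spanS c th F : Th th -> cos_span Th F ->
    cos_span Th (fun x => c * cos (th x) + F x).

Variable Th : set (X -> R).
Hypothesis Th0 : Th (fun=> 0).
Hypothesis ThD : forall s t, Th s -> Th t -> Th (fun x => s x + t x).
Hypothesis ThB : forall s t, Th s -> Th t -> Th (fun x => s x - t x).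

Let ext F G : F =1 G -> cos_span Th F -> cos_span Th G.
Proof. by move=> /funext ->. Qed.

Lemma cos_spanD F G : cos_span Th F -> cos_span Th G ->
  cos_span Th (fun x => F x + G x).
Proof.
move=> sF sG; elim: sF => [|c th {}F Tth sF IH].
  by apply: ext sG => x; rewrite add0r.
by apply: ext (cos_spanS c Tth IH) => x; rewrite addrA.
Qed.

Lemma cos_spanZ c F : cos_span Th F -> cos_span Th (fun x => c * F x).
Proof.
elim => [|a th {}F Tth sF IH].
  by apply: ext (cos_span0 _) => x; rewrite mulr0.
by apply: ext (cos_spanS (c * a) Tth IH) => x; rewrite mulrDr mulrA.
Qed.

Lemma cos_span_cos th : Th th -> cos_span Th (fun x => cos (th x)).
Proof.
move=> Tth; apply: ext (cos_spanS 1 Tth (cos_span0 _)) => x.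
by rewrite addr0 mul1r.
Qed.

Lemma cos_span_cst c : cos_span Th (fun=> c).
Proof.
by apply: ext (cos_spanZ c (cos_span_cos Th0)) => x; rewrite cos0 mulr1.
Qed.

Lemma cos_spanM F G : cos_span Th F -> cos_span Th G ->
  cos_span Th (fun x => F x * G x).
Proof.
move=> sF sG; elim: sF => [|c th {}F Tth sF IH].
  by apply: ext (cos_span0 _) => x; rewrite mul0r.
suff H : cos_span Th (fun x => c * (cos (th x) * G x)).
  by apply: ext (cos_spanD H IH) => x; rewrite mulrDl mulrA.
apply: cos_spanZ; elim: sG => [|a t {}G Tt sG {}IH].
  by apply: ext (cos_span0 _) => x; rewrite mulr0.
apply: ext (cos_spanS (a / 2) (ThD Tth Tt) (cos_spanS (a / 2) (ThB Tth Tt) IH)) => x.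
by rewrite cosD cosB; field.
Qed.

Lemma cos_spanX F n : cos_span Th F -> cos_span Th (fun x => F x ^+ n).
Proof.
move=> sF; elim: n => [|n IH]; first exact: cos_span_cst.
by apply: ext (cos_spanM sF IH) => x; rewrite exprS.
Qed.

Lemma cos_span_prod (I : Type) (r : seq I) (F : I -> X -> R) :
  (forall i, cos_span Th (F i)) -> cos_span Th (fun x => \prod_(i <- r) F i x).
Proof.
move=> sF; elim: r => [|i r IH].
  by apply: ext (cos_span_cst 1) => x; rewrite big_nil.
by apply: ext (cos_spanM (sF i) IH) => x; rewrite big_cons.
Qed.

End cos_span.

Section soft_step.
Variable R : realType.

(** Up to complement, the polynomial [(1 - u^n)^m] of the Brosowski-Deutsch proof of the
    Stone-Weierstrass theorem. Being a polynomial, it maps cosine polynomials to cosine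
    polynomials. *)
Definition soft_step (n m : nat) (u : R) := 1 - (1 - u ^+ n) ^+ m.

Lemma cos_span_soft_step (X : Type) (Th : set (X -> R)) (F : X -> R) n m :
  Th (fun=> 0) ->
  (forall s t, Th s -> Th t -> Th (fun x => s x + t x)) ->
  (forall s t, Th s -> Th t -> Th (fun x => s x - t x)) ->
  cos_span Th F -> cos_span Th (fun x => soft_step n m (F x)).
Proof.
move=> Th0 ThD ThB sF; rewrite /soft_step.
have one : cos_span Th (fun=> 1) by exact: cos_span_cst.
have subs G : cos_span Th G -> cos_span Th (fun x => 1 - G x).
  move=> sG; have := cos_spanD one (cos_spanZ (-1) sG).
  by under eq_fun do rewrite mulN1r.
by apply: (subs); apply: cos_spanX => //; apply: (subs); exact: cos_spanX.
Qed.

Lemma soft_step_itv n m (u : R) : 0 <= u <= 1 -> 0 <= soft_step n m u <= 1.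
Proof.
move=> /andP[u0 u1].
have un : 0 <= 1 - u ^+ n <= 1.
  by rewrite subr_ge0 exprn_ile1//= gerBl exprn_ge0.
case/andP: un => un0 un1.
by rewrite /soft_step subr_ge0 exprn_ile1//= gerBl exprn_ge0.
Qed.

(** Bernoulli's inequality [1 - m v <= (1 - v)^m] at [v = u^n]. *)
Lemma soft_step_le n m (u : R) : 0 <= u <= 1 -> soft_step n m u <= m%:R * u ^+ n.
Proof.
move=> /andP[u0 u1]; rewrite /soft_step lerBlDr -lerBlDl.
have v0 : 0 <= u ^+ n by exact: exprn_ge0.
have v1 : u ^+ n <= 1 by exact: exprn_ile1.
elim: m => [|m IH]; first by rewrite mul0r subr0 expr0.
rewrite exprS -natr1; set v := u ^+ n in v0 v1 IH *; set z := (1 - v) ^+ m in IH *.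
have m0 : 0 <= m%:R :> R by [].
have : (1 - v) * (1 - m%:R * v) <= (1 - v) * z by rewrite ler_wpM2l// subr_ge0.
move: m0; move: (m%:R) => t; nra.
Qed.

Lemma soft_step_ge n m (u : R) : 0 <= u <= 1 ->
  1 - soft_step n m u <= expR (- (m%:R * u ^+ n)).
Proof.
move=> /andP[u0 u1]; rewrite /soft_step subKr mulrC -mulNr expRM_natr lerXn2r ?nnegrE//.
- by rewrite subr_ge0 exprn_ile1.
- exact: expR_ge1Dx.
Qed.

(* [soft_step n m] with [m] of the order of [kappa ^+ n] switches from 0 to 1
   around [u = kappa^-1]. *)
Lemma soft_step_switch (lo hi eps : R) : 0 <= lo -> lo < hi -> hi <= 1 -> 0 < eps ->
  exists n m, forall u, 0 <= u <= 1 ->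
    (hi <= u -> 1 - eps <= soft_step n m u) /\ (u <= lo -> soft_step n m u <= eps).
Proof.
move=> lo0 lohi hi1 e0.
(* [k^-1] is the midpoint of [lo] and [hi], so [(k lo)^n] and [(k hi)^-n] both tend to 0. Since
   [hi <= 1], [k >= 1], and rounding [k^n] up costs at most a factor 2. *)
pose k := 2 / (lo + hi).
have lh0 : 0 < lo + hi by lra.
have k1 : 1 <= k by rewrite ler_pdivlMr//; lra.
have k0 : 0 < k by lra.
have klo : `|k * lo| < 1.
  have kl0 : 0 <= k * lo by rewrite mulr_ge0// ltW.
  by rewrite ger0_norm// /k mulrAC ltr_pdivrMr//; lra.
have khi : `|(k * hi)^-1| < 1.
  have kh : 1 < k * hi by rewrite /k mulrAC ltr_pdivlMr//; lra.
  by rewrite gtr0_norm ?invr_gt0 ?invf_lt1//; lra.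
have e20 : 0 < eps / 2 by lra.
have /cvgr0Pnorm_le /(_ _ e20) [n1 _ H1] := cvg_expr klo.
have /cvgr0Pnorm_le /(_ _ e0) [n2 _ H2] := cvg_expr khi.
pose n := maxn n1 n2.
have := H1 n; rewrite /= leq_maxl => /(_ isT) {}H1.
have := H2 n; rewrite /= leq_maxr => /(_ isT) {}H2.
pose m := (Num.truncn (k ^+ n)).+1.
have kn1 : 1 <= k ^+ n by exact: exprn_ege1.
have mk : k ^+ n <= m%:R by exact: ltW (truncnS_gt _).
have m2 : m%:R <= 2 * k ^+ n.
  rewrite /m -natr1; have : (Num.truncn (k ^+ n))%:R <= k ^+ n.
    by rewrite truncn_le ?exprn_ge0 ?ltW.
  lra.
exists n, m => u u01; have /andP[u0 u1] := u01; split=> hu.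
- have := soft_step_ge n m u01; suff : expR (- (m%:R * u ^+ n)) <= eps by lra.
  apply: le_trans (ler_norm _) (le_trans _ H2).
  rewrite ger0_norm ?expR_ge0// ger0_norm; last by rewrite exprn_ge0// invr_ge0 mulr_ge0//; lra.
  have kh0 : 0 < k * hi by rewrite mulr_gt0//; lra.
  rewrite exprVn expRN lef_pV2 ?posrE ?expR_gt0 ?exprn_gt0//.
  apply: (@le_trans _ _ (m%:R * u ^+ n)); last by have := expR_ge1Dx (m%:R * u ^+ n); lra.
  have hi0 : 0 <= hi by lra.
  rewrite exprMn ler_pM// ?exprn_ge0//; first exact: ltW.
  by rewrite lerXn2r ?nnegrE.
- apply: le_trans (soft_step_le n m u01) _.
  apply: (@le_trans _ _ (2 * (k * lo) ^+ n)).
    rewrite exprMn mulrA ler_pM ?exprn_ge0//.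
    by rewrite lerXn2r ?nnegrE.
  by have := le_trans (ler_norm _) H1; lra.
Qed.

End soft_step.

Lemma measurable_predT d (T : measurableType d) (b : T -> bool) :
  measurable_fun setT b -> measurable [set x | b x].
Proof.
move=> mb; have := mb measurableT [set true] I.
by rewrite setTI (_ : b @^-1` [set true] = [set x | b x]).
Qed.

Lemma measurable_forall d (T : measurableType d) (I : finType) (A : I -> set T) :
  (forall i, measurable (A i)) -> measurable [set w | forall i, A i w].
Proof.
move=> mA; rewrite (_ : [set w | _] = \bigcap_(i in setT) A i).
  by apply: fin_bigcap_measurable => //; exact: finite_finset.
by apply/seteqP; split => w /= h i; [move=> _|]; exact: h.
Qed.

Lemma measurable_dist_le d (T : measurableType d) (R : realType) (X : T -> R) c r :
  measurable_fun setT X -> measurable [set w | `|X w - c| <= r].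
Proof.
move=> mX; apply: measurable_predT; apply: measurable_fun_ler => //.
by apply: measurableT_comp => //; exact: measurable_funB.
Qed.

Lemma measurable_dist_lt d (T : measurableType d) (R : realType) (X : T -> R) c r :
  measurable_fun setT X -> measurable [set w | `|X w - c| < r].
Proof.
move=> mX; apply: measurable_predT; apply: measurable_fun_ltr => //.
by apply: measurableT_comp => //; exact: measurable_funB.
Qed.

(** Stated for all larger thresholds, so that the threshold can later be enlarged to meet other
    constraints. *)
Lemma finite_measure_tail d (T : measurableType d) (R : realType)
    (mu : {finite_measure set T -> \bar R}) (Z : T -> R) (eps : R) :
  measurable_fun setT Z -> 0 < eps ->
  exists M : R, forall M', M <= M' -> (mu [set w | (M' < Z w)%R] <= eps%:E)%E.
Proof.
move=> mZ e0.
pose F (n : nat) : set T := [set w | n%:R < Z w].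
have mF n : measurable (F n).
  by apply: measurable_predT; apply: measurable_fun_ltr.
have F0 : \bigcap_n F n = set0.
  apply/seteqP; split => // w /= h.
  have /= := h (Num.truncn `|Z w|).+1 I.
  apply/negP; rewrite -leNgt (le_trans (ler_norm _))//.
  exact: ltW (truncnS_gt _).
have dF : nonincreasing_seq F.
  move=> m n mn; apply/subsetPset => w /=; apply: le_lt_trans.
  by rewrite ler_nat.
have : mu \o F @ \oo --> mu (\bigcap_n F n).
  apply: nonincreasing_cvg_mu => //; last by rewrite F0.
  by rewrite ltey_eq fin_num_measure.
rewrite F0 measure0 => /fine_cvgP[_ /cvgr0Pnorm_le /(_ _ e0)[n _ H]].
exists n%:R => M' nM.
have mM : measurable [set w | M' < Z w].
  by apply: measurable_predT; apply: measurable_fun_ltr.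
apply: (@le_trans _ _ (mu (F n))).
  apply: le_measure; [by rewrite inE|by rewrite inE; exact: mF|].
  by move=> w /=; apply: le_lt_trans.
rewrite -[leLHS]fineK ?fin_num_measure// lee_fin.
by apply: le_trans (ler_norm _) (H n _) => /=.
Qed.

(** * Comparison of laws on boxes *)

Section affine.
Context (R : realType) (I : finType).

Definition affine : set ((I -> R) -> R) :=
  [set th | exists u : I -> R, exists t : R, th = fun x => \sum_i u i * x i + t].

Lemma affine0 : affine (fun=> 0).
Proof.
exists (fun=> 0), 0; apply/funext => x.
by rewrite addr0 big1// => i _; rewrite mul0r.
Qed.

Lemma affineD s t : affine s -> affine t -> affine (fun x => s x + t x).
Proof.
move=> [u [a ->]] [v [b ->]]; exists (fun i => u i + v i), (a + b).
apply/funext => x; under [in RHS]eq_bigr do rewrite mulrDl.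
by rewrite big_split /= addrACA.
Qed.

Lemma affineB s t : affine s -> affine t -> affine (fun x => s x - t x).
Proof.
move=> [u [a ->]] [v [b ->]]; exists (fun i => u i - v i), (a - b).
apply/funext => x; under [in RHS]eq_bigr do rewrite mulrBl.
by rewrite sumrB opprD addrACA.
Qed.

Lemma affine_coord i a b : affine (fun x => a * x i + b).
Proof.
exists (fun j => if j == i then a else 0), b; apply/funext => x.
rewrite (bigD1 i)//= eqxx big1 ?addr0// => j /negbTE ->.
by rewrite mul0r.
Qed.

End affine.

Section cosine_transform.
Context (R : realType) (I : finType)
  (d1 d2 : measure_display) (T1 : measurableType d1) (T2 : measurableType d2)
  (P1 : probability T1 R) (P2 : probability T2 R)
  (X1 : I -> T1 -> R) (X2 : I -> T2 -> R).
Hypothesis mX1 : forall i, measurable_fun setT (X1 i).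
Hypothesis mX2 : forall i, measurable_fun setT (X2 i).
Hypothesis same_cos : forall (u : I -> R) (t : R),
  \int[P1]_w cos (\sum_i u i * X1 i w + t) = \int[P2]_w cos (\sum_i u i * X2 i w + t).

Let measurable_affine d (T : measurableType d) (X : I -> T -> R) th :
  (forall i, measurable_fun setT (X i)) -> affine th ->
  measurable_fun setT (fun w => cos (th (X^~ w))).
Proof.
move=> mX [u [t ->]]; apply: (measurableT_comp (f := @cos R)); first exact: measurable_cosR.
apply: measurable_funD => //; apply: measurable_sum => i.
exact: measurable_funM.
Qed.

Lemma cos_span_bounded d (T : measurableType d) (X : I -> T -> R) (F : (I -> R) -> R) :
  (forall i, measurable_fun setT (X i)) -> cos_span (@affine R I) F ->
  measurable_fun setT (fun w => F (X^~ w)) /\ exists C, forall w, `|F (X^~ w)| <= C.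
Proof.
move=> mX; elim => [|c th {}F ath _ [mF [C FC]]].
  by split; [exact: measurable_cst|exists 0 => w; rewrite normr0].
split.
  by apply: measurable_funD => //; apply: measurable_funM => //; exact: measurable_affine.
exists (`|c| + C) => w; rewrite (le_trans (ler_normD _ _))// lerD// normrM.
by rewrite ler_piMr// ler_norml cos_geN1 cos_le1.
Qed.

Let integrable_span d (T : measurableType d) (P : probability T R) (X : I -> T -> R) F :
  (forall i, measurable_fun setT (X i)) -> cos_span (@affine R I) F ->
  P.-integrable setT (EFin \o (fun w => F (X^~ w))).
Proof.
move=> mX sF; have [mF [C FC]] := cos_span_bounded mX sF.
exact: bounded_integrable FC.
Qed.

Lemma cos_span_same_integral (F : (I -> R) -> R) : cos_span (@affine R I) F ->
  \int[P1]_w F (X1^~ w) = \int[P2]_w F (X2^~ w).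
Proof.
elim => [|c th {}F ath sF IH]; first by rewrite !Rintegral_prob_cst.
have cb d (T : measurableType d) (P : probability T R) (X : I -> T -> R) :
    (forall i, measurable_fun setT (X i)) ->
    P.-integrable setT (EFin \o (fun w => cos (th (X^~ w)))).
  move=> mX; apply: (@bounded_integrable _ _ _ _ _ 1).
    exact: measurable_affine.
  by move=> w; rewrite ler_norml cos_geN1 cos_le1.
have step d (T : measurableType d) (P : probability T R) (X : I -> T -> R) :
    (forall i, measurable_fun setT (X i)) ->
    \int[P]_w (c * cos (th (X^~ w)) + F (X^~ w)) =
    c * \int[P]_w cos (th (X^~ w)) + \int[P]_w F (X^~ w).
  move=> mX; rewrite RintegralD//.
  - by rewrite RintegralZl//; exact: cb.
  - exact: (integrableZl measurableT c (cb _ _ P _ mX)).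
  - exact: integrable_span.
rewrite !step// IH; congr (c * _ + _).
by have [u [t ->]] := ath; exact: same_cos.
Qed.

End cosine_transform.

Lemma Rintegral_prob_indic (R : realType) d (T : measurableType d) (P : probability T R)
  (A : set T) : measurable A -> \int[P]_w (\1_A w) = fine (P A).
Proof. by move=> mA; rewrite /Rintegral integral_indic// setIT. Qed.

Lemma integrable_indic_prob (R : realType) d (T : measurableType d) (P : probability T R)
  (A : set T) : measurable A -> P.-integrable setT (EFin \o \1_A).
Proof.
move=> mA; apply: (@bounded_integrable _ _ _ _ _ 1); first exact: measurable_indic.
by move=> w; rewrite indicE; case: (_ \in _); rewrite ?normr1 ?normr0.
Qed.

Lemma prod_ge_union_bound (R : realType) (I : Type) (s : seq I) (p : I -> R) :
  (forall i, 0 <= p i <= 1) -> 1 - \sum_(i <- s) (1 - p i) <= \prod_(i <- s) p i.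
Proof.
move=> p01.
suff : 0 <= \prod_(i <- s) p i <= 1 /\ 1 - \sum_(i <- s) (1 - p i) <= \prod_(i <- s) p i.
  by case.
elim: s => [|i s [/andP[q0 q1] IH]]; first by rewrite !big_nil; split; rewrite ?ler01 ?lexx ?subr0.
rewrite !big_cons; have /andP[pi0 pi1] := p01 i.
by split; [apply/andP; split|]; nra.
Qed.

Lemma cos_dist_le (R : realType) (s x r : R) : 0 <= s -> 0 <= r -> s * r <= pi ->
  `|x| <= r -> cos (s * r) <= cos (s * x).
Proof.
move=> s0 r0 srpi xr.
have -> : cos (s * x) = cos (s * `|x|) by rewrite -[LHS]cos_norm normrM (ger0_norm s0).
have sx : s * `|x| <= s * r by rewrite ler_wpM2l.
rewrite leNgt ltr_cos ?in_itv /= ?mulr_ge0//= ?(le_trans sx)//.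
by rewrite -leNgt.
Qed.

Section boxes.
Context (R : realType) (I : finType)
  (d1 d2 : measure_display) (T1 : measurableType d1) (T2 : measurableType d2)
  (P1 : probability T1 R) (P2 : probability T2 R)
  (X1 : I -> T1 -> R) (X2 : I -> T2 -> R).
Hypothesis mX1 : forall i, measurable_fun setT (X1 i).
Hypothesis mX2 : forall i, measurable_fun setT (X2 i).
Hypothesis same_cos : forall (u : I -> R) (t : R),
  \int[P1]_w cos (\sum_i u i * X1 i w + t) = \int[P2]_w cos (\sum_i u i * X2 i w + t).

(** The gap between [r] and [r'] is where each coordinate's soft step falls from 1 to 0. The product
    of these steps is nearly 1 on the closed box and nearly 0 off the open one, up to distance [M];
    as a cosine polynomial it has the same integral for [X1] and [X2]. Periodic bumps further away
    only help the lower bound for [X1], so a tail bound for [X2] is enough. *)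
Lemma cos_transform_box (c r r' : I -> R) :
  (forall i, 0 <= r i) -> (forall i, r i < r' i) ->
  (P1 [set w | forall i, `|X1 i w - c i| <= r i]%R <=
   P2 [set w | forall i, `|X2 i w - c i| < r' i]%R)%E.
Proof.
move=> r0 rr'.
set A := [set w | _]; set A' := [set w | _].
have mA : measurable A by apply: measurable_forall => i; exact: measurable_dist_le.
have mA' : measurable A' by apply: measurable_forall => i; exact: measurable_dist_lt.
rewrite -(fineK (fin_num_measure P1 _ mA)) -(fineK (fin_num_measure P2 _ mA')) lee_fin.
apply/ler_addgt0Pr => eps eps0.
pose k : R := #|I|%:R.
have k0 : 0 <= k by [].
(* The losses are [e] for each of the [k] coordinates on the box, [e] off the larger box, and [e]
   for the tail. *)
pose e := eps / (k + 2).
have e0 : 0 < e by rewrite divr_gt0//; lra.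
pose Z w := \sum_i `|X2 i w - c i|.
have mZ : measurable_fun setT Z.
  apply: measurable_sum => i; apply: measurableT_comp => //.
  exact: measurable_funB.
have [M0 HM] := finite_measure_tail P2 mZ e0.
pose M := `|M0| + \sum_i r' i + 1.
have r'0 i : 0 <= r' i by rewrite (le_trans (r0 i))// ltW.
have sr' : 0 <= \sum_i r' i by exact: sumr_ge0.
have M_gt0 : 0 < M by rewrite /M; have := normr_ge0 M0; lra.
have {}HM : (P2 [set w | (M < Z w)%R] <= e%:E)%E.
  by apply: HM; rewrite /M; have := ler_norm M0; lra.
set B := [set w | _] in HM.
have mB : measurable B by apply: measurable_predT; exact: measurable_fun_ltr.
have r'M i : r' i <= M.
  apply: (@le_trans _ _ (\sum_i r' i)); last by rewrite /M; have := normr_ge0 M0; lra.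
  by rewrite (bigD1 i)//= lerDl sumr_ge0.
(* Half a period is [M]: up to that distance [cos (s y)] decreases in the absolute value of [y].
   Beyond it the bumps return, and the event [B] takes care of them. *)
pose s : R := pi / M.
have s0 : 0 < s by rewrite divr_gt0// pi_gt0.
have sM y : y <= M -> s * y <= pi.
  by move=> yM; rewrite /s mulrAC ler_pdivrMr// ler_wpM2l// pi_ge0.
pose u i (x : I -> R) := (1 + cos (s * x i + (- (s * c i)))) / 2.
have uE i x : u i x = (1 + cos (s * (x i - c i))) / 2 by rewrite /u mulrBr.
have u01 i x : 0 <= u i x <= 1.
  rewrite /u; have := cos_geN1 (s * x i + (- (s * c i))).
  have := cos_le1 (s * x i + (- (s * c i))); lra.
pose hi i := (1 + cos (s * r i)) / 2; pose lo i := (1 + cos (s * r' i)) / 2.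
have lohi i : lo i < hi i.
  have sp : 0 <= s by exact: ltW.
  have sr0 : 0 <= s * r i by rewrite mulr_ge0.
  have sr0' : 0 <= s * r' i by rewrite mulr_ge0.
  have srpi : s * r i <= pi by rewrite sM// (le_trans (ltW (rr' i))).
  by rewrite /lo /hi ltr_pM2r// ltrD2l ltr_cos ?in_itv/= ?sr0 ?sr0' ?srpi ?sM// ltr_pM2l.
have /choice[nm Hnm] : forall i, exists nm : nat * nat, forall v, 0 <= v <= 1 ->
    (hi i <= v -> 1 - e <= soft_step nm.1 nm.2 v) /\ (v <= lo i -> soft_step nm.1 nm.2 v <= e).
  move=> i; have [||n [m H]] := @soft_step_switch R (lo i) (hi i) e _ (lohi i) _ e0.
  - by rewrite /lo; have := cos_geN1 (s * r' i); lra.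
  - by rewrite /hi; have := cos_le1 (s * r i); lra.
  by exists (n, m).
pose p i x := soft_step (nm i).1 (nm i).2 (u i x).
have p01 i x : 0 <= p i x <= 1 by exact: soft_step_itv.
pose F x := \prod_i p i x.
have sF : cos_span (@affine R I) F.
  apply: cos_span_prod; [exact: affine0|exact: affineD|exact: affineB|] => i.
  apply: cos_span_soft_step; [exact: affine0|exact: affineD|exact: affineB|].
  have Hc := @cos_span_cst _ _ (@affine R I) (@affine0 R I) (1 / 2).
  have Hs := cos_spanZ (1 / 2) (cos_span_cos (affine_coord i s (- (s * c i)))).
  have := cos_spanD Hc Hs.
  by congr cos_span; apply/funext => x; rewrite /u; field.
have F01 x : 0 <= F x <= 1.
  rewrite /F; elim/big_ind: _ => //; first by rewrite ler01 lexx.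
  by move=> y z /andP[y0 y1] /andP[z0 z1]; rewrite mulr_ge0//= mulr_ile1.
have lower w : (1 - k * e) * \1_A w <= F (X1^~ w).
  rewrite indicE; case: (boolP (w \in A)) => [|_]; last by rewrite mulr0; case/andP: (F01 (X1^~ w)).
  rewrite inE /A /= => wA; rewrite mulr1.
  apply: le_trans (prod_ge_union_bound _ (fun i => p01 i _)).
  rewrite lerB// /k mulrC mulr_natr -sumr_const; apply: ler_sum => i _.
  rewrite lerBlDr -lerBlDl; apply: (proj1 (Hnm i _ (u01 i _))).
  rewrite uE /hi ler_pM2r// lerD2l cos_dist_le//; first exact: ltW.
  by rewrite sM// (le_trans (ltW (rr' i))).
have upper w : F (X2^~ w) <= \1_A' w + (\1_B w + e).
  have [F0 F1] := andP (F01 (X2^~ w)).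
  have i0 (D : set T2) : 0 <= \1_D w :> R by rewrite indicE.
  have [wA'|wA'] := boolP (w \in A').
    have -> : \1_A' w = 1 :> R by rewrite indicE wA'.
    by rewrite (le_trans F1)// lerDl addr_ge0 ?i0 ?(ltW e0).
  have [wB|wB] := boolP (w \in B).
    have -> : \1_B w = 1 :> R by rewrite indicE wB.
    by rewrite (le_trans F1)// addrCA lerDl addr_ge0 ?i0 ?(ltW e0).
  suff : F (X2^~ w) <= e by have := i0 A'; have := i0 B; lra.
  have {wB} wB : Z w <= M by move: wB; rewrite notin_setE /B /= => /negP; rewrite -leNgt.
  have [i wi] : exists i, r' i <= `|X2 i w - c i|.
    move: wA'; rewrite notin_setE /A' /= => /existsNP[i /negP]; rewrite -leNgt => wi.
    by exists i.
  have wM : `|X2 i w - c i| <= M.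
    by apply: le_trans wB; rewrite /Z (bigD1 i)//= lerDl sumr_ge0.
  rewrite /F (bigD1 i)//=; apply: (@le_trans _ _ (p i (X2^~ w))).
    have [p0 p1] := andP (p01 i (X2^~ w)).
    rewrite ler_piMr//; elim/big_rec: _ => // j y _ y1.
    by have [q0 q1] := andP (p01 j (X2^~ w)); rewrite -[leRHS](mulr1 1) (le_trans (ler_wpM2l q0 y1))// ler_wpM2r.
  apply: (proj2 (Hnm i _ (u01 i _))).
  rewrite uE /lo ler_pM2r// lerD2l.
  rewrite -[X in X <= _]cos_norm normrM (gtr0_norm s0).
  rewrite cos_dist_le ?(ltW s0)//; first exact: sM.
  by rewrite [leLHS]ger0_norm ?r'0.
have IF1 : P1.-integrable setT (EFin \o (fun w => F (X1^~ w))).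
  by have [mF [C FC]] := cos_span_bounded mX1 sF; exact: bounded_integrable FC.
have IF2 : P2.-integrable setT (EFin \o (fun w => F (X2^~ w))).
  by have [mF [C FC]] := cos_span_bounded mX2 sF; exact: bounded_integrable FC.
have H1 : (1 - k * e) * fine (P1 A) <= \int[P1]_w F (X1^~ w).
  rewrite -(Rintegral_prob_indic P1 mA) -RintegralZl//; last exact: integrable_indic_prob.
  apply: le_Rintegral => //.
  exact: (integrableZl measurableT _ (integrable_indic_prob P1 mA)).
have ce : P2.-integrable setT (EFin \o cst e) by exact: finite_measure_integrable_cst.
have iBe : P2.-integrable setT (EFin \o (fun w => \1_B w + e)).
  exact: (integrableD measurableT (integrable_indic_prob P2 mB) ce).
have H2 : \int[P2]_w F (X2^~ w) <= fine (P2 A') + (e + e).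
  apply: (@le_trans _ _ (\int[P2]_w (\1_A' w + (\1_B w + e)))).
    apply: le_Rintegral => //.
    exact: (integrableD measurableT (integrable_indic_prob P2 mA') iBe).
  rewrite RintegralD//; last exact: integrable_indic_prob.
  rewrite RintegralD//; last exact: integrable_indic_prob.
  rewrite !Rintegral_prob_indic// Rintegral_prob_cst lerD2l lerD2r.
  by rewrite -lee_fin fineK// fin_num_measure.
rewrite (cos_span_same_integral mX1 mX2 same_cos sF) in H1.
have a1 : fine (P1 A) <= 1 by rewrite -lee_fin fineK ?fin_num_measure// probability_le1.
have a0 : 0 <= fine (P1 A) by rewrite fine_ge0.
have eE : eps = k * e + 2 * e by rewrite /e; field; lra.
by have ke : 0 <= k * e; [rewrite mulr_ge0// ltW|nra].
Qed.

End boxes.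

(** * Gaussian spaces *)

Section gaussian_space.
Context (R : realType) (d : measure_display) (Omega : measurableType d)
  (P : probability Omega R).

Record gaussian_space (V : set (Omega -> R)) : Prop := GaussianSpace {
  gspace0 : V (fun=> 0) ;
  gspaceD : forall X Y, V X -> V Y -> V (fun w => X w + Y w) ;
  gspaceZ : forall c X, V X -> V (fun w => c * X w) ;
  gspace_meas : forall X, V X -> measurable_fun setT X ;
  gspace_gauss : forall X, V X -> centered_gaussian P X
}.

Definition ip (X Y : Omega -> R) := \int[P]_w (X w * Y w).

Variable V : set (Omega -> R).
Hypothesis GV : gaussian_space V.

Lemma gspace_sum (I : Type) (s : seq I) (u : I -> R) (g : I -> Omega -> R) :
  (forall i, V (g i)) -> V (fun w => \sum_(i <- s) u i * g i w).
Proof.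
move=> Vg; elim: s => [|i s IH].
  by under eq_fun do rewrite big_nil; exact: gspace0.
under eq_fun do rewrite big_cons.
by apply: (gspaceD GV _ IH); exact: gspaceZ.
Qed.

Lemma gspaceB X Y : V X -> V Y -> V (fun w => X w - Y w).
Proof.
move=> VX VY; have := gspaceD GV VX (gspaceZ GV (-1) VY).
by under eq_fun do rewrite mulN1r.
Qed.

Lemma gspace_integrableM X Y : V X -> V Y ->
  P.-integrable setT (EFin \o (fun w => X w * Y w)).
Proof.
have sq Z : V Z -> P.-integrable setT (EFin \o (fun w => Z w ^+ 2)).
  move=> VZ; have mZ := gspace_meas GV VZ.
  have [s [_ H _ _ _]] := centered_gaussian_std mZ (gspace_gauss GV VZ).
  have mZ2 : measurable_fun setT (EFin \o (fun w => Z w ^+ 2)).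
    by apply/measurable_EFinP; exact: measurable_funX.
  apply/integrableP; split => //; apply/abse_integralP => //.
  by rewrite [X in `|X|%E]H ltry.
move=> VX VY.
have mX := gspace_meas GV VX; have mY := gspace_meas GV VY.
apply: (le_integrable measurableT _ _ (integrableD measurableT (sq _ VX) (sq _ VY))).
  by apply/measurable_EFinP; exact: measurable_funM.
move=> w _ /=; rewrite lee_fin [leRHS]ger0_norm ?addr_ge0 ?sqr_ge0//.
rewrite normrM -(real_normK (num_real (X w))) -(real_normK (num_real (Y w))).
have := normr_ge0 (X w); have := normr_ge0 (Y w).
by move: `|X w| `|Y w| => x y; nra.
Qed.

Lemma ipC X Y : ip X Y = ip Y X.
Proof. by apply: eq_Rintegral => w _; rewrite mulrC. Qed.

Lemma ipDl X Y Z : V X -> V Y -> V Z -> ip (fun w => X w + Y w) Z = ip X Z + ip Y Z.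
Proof.
move=> VX VY VZ; rewrite /ip; under eq_Rintegral do rewrite mulrDl.
by rewrite RintegralD//; exact: gspace_integrableM.
Qed.

Lemma ipZl c X Z : V X -> V Z -> ip (fun w => c * X w) Z = c * ip X Z.
Proof.
move=> VX VZ; rewrite /ip; under eq_Rintegral do rewrite -mulrA.
by rewrite RintegralZl//; exact: gspace_integrableM.
Qed.

Lemma ipDr X Y Z : V X -> V Y -> V Z -> ip Z (fun w => X w + Y w) = ip Z X + ip Z Y.
Proof. by move=> VX VY VZ; rewrite ipC ipDl// ![ip _ Z]ipC. Qed.

Lemma ipZr c X Z : V X -> V Z -> ip Z (fun w => c * X w) = c * ip Z X.
Proof. by move=> VX VZ; rewrite ipC ipZl// ipC. Qed.

Lemma ip_suml (I : Type) (s : seq I) (u : I -> R) (g : I -> Omega -> R) Z :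
  (forall i, V (g i)) -> V Z ->
  ip (fun w => \sum_(i <- s) u i * g i w) Z = \sum_(i <- s) u i * ip (g i) Z.
Proof.
move=> Vg VZ; elim: s => [|i s IH].
  rewrite big_nil /ip; under eq_Rintegral do rewrite big_nil mul0r.
  exact: Rintegral_prob_cst.
rewrite big_cons -IH -ipZl// -ipDl//; [|exact: gspaceZ|exact: gspace_sum].
by congr ip; apply/funext => w; rewrite big_cons.
Qed.

Lemma gspace_std X : V X -> exists2 s, gaussian_std P X s & s ^+ 2 = ip X X.
Proof.
move=> VX; have [s Hs] := centered_gaussian_std (gspace_meas GV VX) (gspace_gauss GV VX).
exists s => //; rewrite /ip /Rintegral; under eq_integral do rewrite -expr2.
by rewrite (gstd_sqr Hs).
Qed.

Lemma gspace_cos X t : V X -> \int[P]_w cos (X w + t) = cos t * expR (- (ip X X / 2)).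
Proof.
move=> VX; have [s Hs sE] := gspace_std VX.
have := gstd_cos Hs t 1; under eq_Rintegral do rewrite mul1r.
by rewrite expr1n mul1r sE.
Qed.

Let cosb (x : R) : `|cos x| <= 1. Proof. by rewrite ler_norml cos_geN1 cos_le1. Qed.

(** The inner integral is a cosine transform of [Y] with phase [X w + t], which leaves one of [X]
    with phase [t]. *)
Lemma gspace_cos_prod X Y t : V X -> V Y ->
  \int[(P \x P)%E]_w cos (X w.1 + Y w.2 + t) =
  cos t * expR (- ((ip X X + ip Y Y) / 2)).
Proof.
move=> VX VY.
have mX := gspace_meas GV VX; have mY := gspace_meas GV VY.
have mF : measurable_fun setT (fun w : Omega * Omega => cos (X w.1 + Y w.2 + t)).
  apply: (measurableT_comp (f := @cos R)); first exact: measurable_cosR.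
  apply: measurable_funD => //; apply: measurable_funD.
    exact: (measurableT_comp mX measurable_fst).
  exact: (measurableT_comp mY measurable_snd).
have iF : (P \x P)%E.-integrable setT (EFin \o (fun w : Omega * Omega => cos (X w.1 + Y w.2 + t))).
  exact: (@bounded_integrable _ _ _ _ _ 1).
rewrite /Rintegral -integral12_prod_meas1//.
transitivity (fine (\int[P]_w (expR (- (ip Y Y / 2)) * cos (X w + t))%:E)%E).
  congr fine; apply: eq_integral => w _.
  have mcY : measurable_fun setT (fun y => cos (Y y + (X w + t))).
    apply: (measurableT_comp (f := @cos R)); first exact: measurable_cosR.
    exact: measurable_funD.
  have icY := @bounded_integrable _ _ _ P _ 1 mcY (fun y => cosb _).
  rewrite /fubini_F mulrC -gspace_cos// /Rintegral fineK.
    by apply: eq_integral => y _ /=; congr (cos _)%:E; ring.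
  exact: integrable_fin_num icY.
rewrite -[LHS]/(\int[P]_w (expR (- (ip Y Y / 2)) * cos (X w + t))) RintegralZl//.
  rewrite gspace_cos// mulrCA -expRD; congr (_ * expR _).
  by field.
apply: (@bounded_integrable _ _ _ _ _ 1) => //.
apply: (measurableT_comp (f := @cos R)); first exact: measurable_cosR.
exact: measurable_funD.
Qed.

(** Orthogonality makes the variances of linear forms add up, so [(g, Y)] has the same cosine
    transforms as [g] and [Y] read on the two factors of [P \x P]. The index [None] stands for [Y].
    Enlarging the radii is the price of comparing boxes. *)
Lemma gspace_indep (I : finType) (g : I -> Omega -> R) Y (r r' : I -> R) (c rho rho' : R) :
  (forall i, V (g i)) -> V Y -> (forall i, ip (g i) Y = 0) ->
  (forall i, 0 <= r i) -> (forall i, r i < r' i) -> 0 <= rho -> rho < rho' ->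
  (P [set w | forall i, `|g i w| <= r i]%R * P [set w | `|Y w - c| <= rho]%R <=
   P [set w | (forall i, `|g i w| < r' i)%R /\ (`|Y w - c| < rho')%R])%E.
Proof.
move=> Vg VY gY r0 rr' rho0 rhorho'.
have mg i := gspace_meas GV (Vg i); have mY := gspace_meas GV VY.
pose X1 (k : option I) (w : Omega * Omega) := if k is Some i then g i w.1 else Y w.2.
pose X2 (k : option I) (w : Omega) := if k is Some i then g i w else Y w.
pose ce (k : option I) := if k is Some i then 0 else c.
pose q (k : option I) := if k is Some i then r i else rho.
pose q' (k : option I) := if k is Some i then r' i else rho'.
have mX1 k : measurable_fun setT (X1 k).
  case: k => [i|] /=; first exact: (measurableT_comp (mg i) measurable_fst).
  exact: (measurableT_comp mY measurable_snd).
have mX2 k : measurable_fun setT (X2 k) by case: k => [i|]; [exact: mg|exact: mY].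
have sc (u : option I -> R) t :
  \int[(P \x P)%E]_w cos (\sum_k u k * X1 k w + t) = \int[P]_w cos (\sum_k u k * X2 k w + t).
  pose G w := \sum_i u (Some i) * g i w.
  have VG : V G by exact: gspace_sum.
  have VaY : V (fun w => u None * Y w) by exact: gspaceZ.
  transitivity (\int[(P \x P)%E]_w cos (G w.1 + u None * Y w.2 + t)).
    apply: eq_Rintegral => w _; congr (cos (_ + _)).
    rewrite (bigD1 None)//= addrC; congr (_ + _); rewrite /G.
    rewrite (reindex_omap Some id)//=; last by case.
    by apply: eq_bigl => i; rewrite eqxx.
  transitivity (\int[P]_w cos (G w + u None * Y w + t)); last first.
    apply: eq_Rintegral => w _; congr (cos (_ + _)).
    rewrite [RHS](bigD1 None)//= [RHS]addrC; congr (_ + _); rewrite /G.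
    rewrite [RHS](reindex_omap Some id)//=; last by case.
    by apply: eq_bigl => i; rewrite eqxx.
  pose Z w := G w + u None * Y w.
  have VZ : V Z by exact: gspaceD.
  transitivity (cos t * expR (- (ip Z Z / 2))); last exact/esym/gspace_cos.
  have GY0 : ip G (fun w => u None * Y w) = 0.
    by rewrite (ipZr _ VY VG) (ip_suml _ _ Vg VY) big1 ?mulr0// => i _; rewrite gY mulr0.
  have -> : ip Z Z = ip G G + ip (fun w => u None * Y w) (fun w => u None * Y w).
    rewrite (ipDl VG VaY VZ) (ipDr VG VaY VG) (ipDr VG VaY VaY).
    by rewrite [ip (fun w => _ * Y w) G]ipC GY0 addr0 add0r.
  exact: gspace_cos_prod.
have := @cos_transform_box R (option I) _ _ _ _ _ P X1 X2 mX1 mX2 sc ce q q' _ _.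
move=> /(_ (ltac:(by case)) (ltac:(by case))).
have -> : [set w | forall k, `|X1 k w - ce k| <= q k] =
  [set w | forall i, `|g i w| <= r i] `*` [set w | `|Y w - c| <= rho].
  apply/seteqP; split => -[w w'] /= H.
    split; last by exact: (H None).
    by move=> i; have := H (Some i); rewrite /= subr0.
  by case: H => H1 H2 [i|] /=; [rewrite subr0|].
move=> H; rewrite -product_measure1E; last 2 first.
- apply: measurable_forall => i.
  by have := measurable_dist_le 0 (r i) (mg i); under eq_set do rewrite subr0.
- exact: measurable_dist_le.
apply: (le_trans H); apply: le_measure; rewrite ?inE.
- by apply: measurable_forall => k; exact: measurable_dist_lt.
- apply: measurableI; last exact: measurable_dist_lt.
  apply: measurable_forall => i.
  by have := measurable_dist_lt 0 (r' i) (mg i); under eq_set do rewrite subr0.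
- move=> w /= wH; split; last exact: (wH None).
  by move=> i; have := wH (Some i); rewrite /= subr0.
Qed.

(** The difference of two independent copies has the cosine transforms of [sqrt 2 * g]. Comparing
    radius [r] with radius [sqrt 2 * r] provides the strict enlargement that the box comparison
    needs. *)
Lemma gspace_rotation (I : finType) (g : I -> Omega -> R) (r : I -> R) :
  (forall i, V (g i)) -> (forall i, 0 < r i) ->
  ((P \x P) [set w | forall i, `|g i w.1 - g i w.2| <= r i]%R <=
   P [set w | forall i, `|g i w| < r i]%R)%E.
Proof.
move=> Vg r0.
have mg i := gspace_meas GV (Vg i).
have r20 : 0 < Num.sqrt 2 :> R by rewrite sqrtr_gt0.
have r21 : 1 < Num.sqrt 2 :> R by rewrite -[ltLHS]sqrtr1 ltr_sqrt// ltr1n.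
pose X1 i (w : Omega * Omega) := g i w.1 - g i w.2.
pose X2 i w := Num.sqrt 2 * g i w.
have mX1 i : measurable_fun setT (X1 i).
  apply: measurable_funB; first exact: (measurableT_comp (mg i) measurable_fst).
  exact: (measurableT_comp (mg i) measurable_snd).
have mX2 i : measurable_fun setT (X2 i) by exact: measurable_funM.
have sc (u : I -> R) t :
  \int[(P \x P)%E]_w cos (\sum_k u k * X1 k w + t) = \int[P]_w cos (\sum_k u k * X2 k w + t).
  pose G w := \sum_i u i * g i w.
  have VG : V G by exact: gspace_sum.
  transitivity (\int[(P \x P)%E]_w cos (G w.1 + (-1) * G w.2 + t)).
    apply: eq_Rintegral => w _; congr (cos (_ + _)).
    by rewrite mulN1r -sumrB; apply: eq_bigr => i _; rewrite mulrBr.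
  pose Z w := Num.sqrt 2 * G w.
  have VZ : V Z by exact: gspaceZ.
  have VN : V (fun w => -1 * G w) by exact: gspaceZ.
  transitivity (cos t * expR (- (ip Z Z / 2))); last first.
    rewrite -gspace_cos//.
    apply: eq_Rintegral => w _; congr (cos (_ + _)).
    by rewrite /Z mulr_sumr; apply: eq_bigr => i _; rewrite mulrCA.
  have -> : ip Z Z = ip G G + ip (fun w => -1 * G w) (fun w => -1 * G w).
    rewrite /Z (ipZl _ VG VZ) (ipZr _ VG VG) (ipZl _ VG VN) (ipZr _ VG VG).
    by rewrite [LHS]mulrA -expr2 sqr_sqrtr//; ring.
  exact: (gspace_cos_prod _ VG VN).
have := @cos_transform_box R I _ _ _ _ _ P X1 X2 mX1 mX2 sc (fun=> 0) r (fun i => Num.sqrt 2 * r i) _ _.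
have H1 i : 0 <= r i by exact: ltW.
have H2 i : r i < Num.sqrt 2 * r i by rewrite ltr_pMl.
move=> /(_ H1 H2).
under eq_set do under eq_forall do rewrite subr0.
move=> /le_trans; apply.
rewrite (_ : [set w | forall i, `|X2 i w - 0| < Num.sqrt 2 * r i] = [set w | forall i, `|g i w| < r i])//.
apply/seteqP; split => w /= H i; have := H i;
  by rewrite /X2 subr0 normrM (gtr0_norm r20) ltr_pM2l.
Qed.

End gaussian_space.

(** * Small ball probabilities *)

Lemma Rintegral_sum_indic (R : realType) d (T : measurableType d) (P : probability T R)
    (I : Type) (s : seq I) (A : I -> set T) : (forall i, measurable (A i)) ->
  P.-integrable setT (EFin \o (fun w => \sum_(i <- s) \1_(A i) w)) /\
  \int[P]_w (\sum_(i <- s) \1_(A i) w) = \sum_(i <- s) fine (P (A i)).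
Proof.
move=> mA; elim: s => [|i s [IH1 IH2]].
  rewrite big_nil; under eq_fun do rewrite big_nil.
  split; first exact: finite_measure_integrable_cst.
  exact: Rintegral_prob_cst.
have E : (fun w => \sum_(j <- i :: s) \1_(A j) w) =
    (fun w => \1_(A i) w + \sum_(j <- s) \1_(A j) w : R).
  by apply/funext => w; rewrite big_cons.
rewrite E big_cons -IH2 -Rintegral_prob_indic//; split.
  exact: (integrableD measurableT (integrable_indic_prob P (mA i)) IH1).
by rewrite RintegralD//; exact: integrable_indic_prob.
Qed.

(** A two-sided geometric series: [k - B] runs over the integers of [[- B, B]]. *)
Lemma sum_pow_dist (R : realType) (q : R) (B : nat) : 0 <= q -> q < 1 ->
  \sum_(k < B.*2.+1) q ^+ `|k%:Z - B%:Z|%N <= (1 + q) / (1 - q).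
Proof.
move=> q0 q1.
have -> : \sum_(k < B.*2.+1) q ^+ `|k%:Z - B%:Z|%N = 1 + 2 * \sum_(j < B) q ^+ j.+1.
  elim: B => [|B IH]; first by rewrite big_ord_recl !big_ord0 mulr0 /= expr0.
  rewrite doubleS big_ord_recr big_ord_recl /=.
  under eq_bigr => i _.
    rewrite (_ : `|_|%N = `|i%:Z - B%:Z|%N); last by congr absz; rewrite /bump /=; lia.
    over.
  rewrite IH [in RHS]big_ord_recr /=.
  rewrite subn0.
  rewrite (_ : `|B.*2.+2%:Z - B.+1%:Z|%N = B.+1); last by lia.
  by ring.
suff H : (1 - q) * \sum_(j < B) q ^+ j.+1 <= q.
  rewrite ler_pdivlMr ?subr_gt0// mulrDl mul1r -mulrA [_ * (1 - q)]mulrC.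
  lra.
have -> : (1 - q) * \sum_(j < B) q ^+ j.+1 = q - q ^+ B.+1.
  elim: B => [|B IH]; first by rewrite big_ord0 mulr0 expr1 subrr.
  by rewrite big_ord_recr /= mulrDr IH [q ^+ B.+2]exprS; ring.
by rewrite gerBl exprn_ge0.
Qed.

Section counting.
Context (R : realType) (d : measure_display) (Omega : measurableType d)
  (P : probability Omega R) (V : set (Omega -> R)).
Hypothesis GV : gaussian_space P V.
Context (I : finType) (g : I -> Omega -> R) (w a : I -> R).
Hypothesis Vg : forall i, V (g i).
Hypothesis w0 : forall i, 0 < w i.
Hypothesis a0 : forall i, 0 < a i.

(** Rounding of [g i / w i] to a nearest integer: values with the same index differ by at most
    [w i], the radius of the small ball. *)
Definition cell_index i om : int := Num.floor (g i om / w i + 1 / 2).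

Lemma cell_indexP i om : `|g i om - (cell_index i om)%:~R * w i| <= w i / 2.
Proof.
have /andP[] := floor_itv (g i om / w i + 1 / 2).
rewrite -/(cell_index i om) intrD; set z : R := (cell_index i om)%:~R => h1 h2.
have -> : g i om = (g i om / w i) * w i by rewrite divfK// gt_eqF.
move: h1 h2; set y := g i om / w i => h1 h2.
rewrite -mulrBl normrM (gtr0_norm (w0 i)) mulrC ler_pM2l//.
by rewrite ler_norml; apply/andP; split; lra.
Qed.

Lemma measurable_cell i (z : int) : measurable [set om | cell_index i om == z].
Proof.
have mg := gspace_meas GV (Vg i).
pose h om := g i om / w i + 1 / 2.
have mh : measurable_fun setT h by apply: measurable_funD => //; exact: measurable_funM.
rewrite (_ : [set om | _] = [set om | z%:~R <= h om] `&` [set om | h om < (z + 1)%:~R]).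
  apply: measurableI; apply: measurable_predT; [exact: measurable_fun_ler|exact: measurable_fun_ltr].
apply/seteqP; split => om /=.
  by move=> /eqP <-; split; [exact: floor_le|exact: floorD1_gt].
by move=> [h1 h2]; apply/eqP/floor_def; rewrite h1 h2.
Qed.

(* Pigeonhole: the cells of bounded weight carry half of the mass, so two
   independent copies fall in a common cell with probability at least
   (4 #cells)^-1; by rotation invariance this bounds a small ball probability. *)
Lemma small_ball_counting (E : set Omega) (D : R) : measurable E -> 0 <= D ->
  (1 / 2 <= fine (P E)) ->
  (forall om, E om -> \sum_i a i * `|cell_index i om|%N%:R <= D) ->
  ((expR (- D) / (4 * \prod_i ((1 + expR (- a i)) / (1 - expR (- a i)))))%:E <=
    P [set om | forall i, `|g i om| < w i]%R)%E.
Proof.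
move=> mE D0 PE HE.
pose q i := expR (- a i).
have q0 i : 0 < q i by exact: expR_gt0.
have q1 i : q i < 1 by rewrite /q expR_lt1 oppr_lt0.
(* [B] exceeds every index allowed by a total weight at most [D], so the relevant cells, shifted by
   [B], fit in a finite type. *)
have [B HB] : exists B : nat, forall i, D < a i * B%:R.
  pose b := \sum_i (a i)^-1.
  exists (Num.truncn `|D * b|).+1 => i; rewrite mulrC -ltr_pdivrMr//.
  apply: le_lt_trans (truncnS_gt _); apply: le_trans (ler_norm _).
  rewrite ler_wpM2l// /b (bigD1 i)//= lerDl sumr_ge0// => j _.
  by rewrite invr_ge0 ltW.
pose K := {ffun I -> 'I_(B.*2.+1)}.
pose wt (x : K) : R := \sum_i a i * `|(x i)%:Z - B%:Z|%N%:R.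
pose cell (x : K) : set Omega := [set om | forall i, cell_index i om == (x i)%:Z - B%:Z].
have mcell x : measurable (cell x) by apply: measurable_forall => i; exact: measurable_cell.
pose K' := [pred x : K | wt x <= D].
have cell_inj x y om : cell x om -> cell y om -> x = y.
  move=> cx cy; apply/ffunP => i; apply/val_inj => /=.
  have /eqP := cx i; have /eqP := cy i; move=> ->; lia.
have cover om : E om -> exists2 x : K, x \in K' & cell x om.
  move=> Eom; have HD := HE _ Eom.
  have small i : (`|cell_index i om| < B)%N.
    rewrite -(ltr_nat R) -(ltr_pM2l (a0 i)); apply: le_lt_trans (HB i).
    apply: le_trans HD; rewrite (bigD1 i)//= lerDl sumr_ge0// => j _.
    by rewrite mulr_ge0// ltW.
  have lt_x i : (absz (cell_index i om + B%:Z)%R < B.*2.+1)%N by have := small i; lia.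
  pose x : K := [ffun i => Ordinal (lt_x i)].
  have xE i : (x i)%:Z - B%:Z = cell_index i om.
    by rewrite ffunE /=; have := small i; lia.
  exists x; last by move=> i; rewrite xE.
  by rewrite inE /wt; apply: le_trans HD; apply: ler_sum => i _; rewrite xE.
pose p x := fine (P (cell x)).
have p0 x : 0 <= p x by rewrite fine_ge0.
have sum_p : 1 / 2 <= \sum_(x <- enum K') p x.
  apply: (le_trans PE); rewrite -Rintegral_prob_indic//.
  have [i1 <-] := Rintegral_sum_indic P (enum K') mcell.
  apply: le_Rintegral => //; first exact: integrable_indic_prob.
  move=> om _; rewrite indicE; have [|_] := boolP (om \in E); last first.
    by rewrite sumr_ge0// => x _; rewrite indicE.
  rewrite inE => /cover[x xK cx].
  rewrite (bigD1_seq x) ?mem_enum ?enum_uniq//= indicE mem_set// lerDl.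
  by rewrite sumr_ge0// => y _; rewrite indicE.
(* Exponential counting: [1 <= exp (D - wt x)] for each counted cell, and the sum over all of [K]
   factorizes into two-sided geometric series. *)
have card_K' : (size (enum K'))%:R <= expR D * \prod_i ((1 + q i) / (1 - q i)).
  rewrite -cardE -sum1_card natr_sum.
  apply: (@le_trans _ _ (\sum_(x : K) expR D * \prod_i q i ^+ `|(x i)%:Z - B%:Z|%N)).
    have wt_ge0 x : 0 <= expR D * \prod_i q i ^+ `|((x : K) i)%:Z - B%:Z|%N.
      by rewrite mulr_ge0 ?expR_ge0// prodr_ge0// => i _; rewrite exprn_ge0// ltW.
    rewrite big_mkcond /=; apply: ler_sum => x _; case: ifPn => // xK.
    have -> : \prod_i q i ^+ `|(x i)%:Z - B%:Z|%N = expR (- wt x).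
      rewrite /wt -sumrN expR_sum; apply: eq_bigr => i _.
      by rewrite /q -mulNr expRM_natr.
    by rewrite -expRD -expR0 ler_expR subr_ge0; move: xK; rewrite inE.
  rewrite -big_distrr /= ler_wpM2l ?expR_ge0//.
  rewrite -(bigA_distr_bigA (fun i (k : 'I_(B.*2.+1)) => q i ^+ `|k%:Z - B%:Z|%N)) /=.
  apply: ler_prod => i _; apply/andP; split.
    by apply: sumr_ge0 => k _; rewrite exprn_ge0// ltW.
  by apply: sum_pow_dist => //; exact: ltW.
pose S := [set om : Omega * Omega | forall i, `|g i om.1 - g i om.2| <= w i].
have mS : measurable S.
  apply: measurable_forall => i.
  have mg := gspace_meas GV (Vg i).
  have m1 : measurable_fun setT (fun om : Omega * Omega => g i om.1 - g i om.2).
    apply: measurable_funB; first exact: (measurableT_comp mg measurable_fst).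
    exact: (measurableT_comp mg measurable_snd).
  by have := measurable_dist_le 0 (w i) m1; under eq_set do rewrite subr0.
have mc2 x : measurable (cell x `*` cell x) by exact: measurableX.
(* The products of a cell with itself are disjoint and lie in [S]. *)
have sum_p2 : \sum_(x <- enum K') p x ^+ 2 <= fine ((P \x P)%E S).
  have [i1 i2] := Rintegral_sum_indic (P \x P)%E (enum K') mc2.
  have -> : \sum_(x <- enum K') p x ^+ 2 = \sum_(x <- enum K') fine ((P \x P)%E (cell x `*` cell x)).
    apply: eq_bigr => x _; rewrite product_measure1E// fineM ?fin_num_measure//.
  rewrite -i2 -Rintegral_prob_indic//.
  apply: le_Rintegral => //; first exact: integrable_indic_prob.
  move=> om _.
  have [[x xc]|H] := pselect (exists x, (cell x `*` cell x) om); last first.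
    rewrite big1 ?indicE// => x _; rewrite indicE memNset// => xc.
    by apply: H; exists x.
  have -> : \1_S om = 1 :> R.
    rewrite indicE mem_set// => i; case: xc => c1 c2.
    have := cell_indexP i om.1; have := cell_indexP i om.2.
    rewrite (eqP (c1 i)) (eqP (c2 i)); set z := _ * w i.
    rewrite !ler_norml => /andP[h1 h2] /andP[h3 h4]; apply/andP; split; lra.
  have one y : y != x -> \1_(cell y `*` cell y) om = 0 :> R.
    move=> /eqP yx; rewrite indicE memNset// => -[yc _].
    by apply: yx; case: xc => xc _; exact: cell_inj yc xc.
  have [xK|xK] := boolP (x \in K').
    rewrite (bigD1_seq x) ?mem_enum ?enum_uniq//= big1 ?addr0; last by move=> y; exact: one.
    by rewrite indicE; case: (_ \in _).
  rewrite big1_seq// => y; rewrite mem_enum => /andP[_ yK]; apply: one.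
  by apply: contraNneq xK => <-.
set N : R := (size (enum K'))%:R in card_K'.
have N0 : 0 < N.
  rewrite ltr0n lt0n; apply: contraTneq sum_p => /size0nil ->.
  by rewrite big_nil -ltNge.
(* Cauchy-Schwarz in the form [(p x - 1 / (2 N))^2 >= 0]; as the total mass is at least one half,
   the sum is at least [1 / (2 N) - 1 / (4 N)]. *)
have key : (4 * N)^-1 <= \sum_(x <- enum K') p x ^+ 2.
  apply: (@le_trans _ _ (\sum_(x <- enum K') (N^-1 * p x - (2 * N)^-1 ^+ 2))).
    rewrite sumrB -big_distrr /= big_const_seq count_predT iter_addr_0 -[X in _ - X]mulr_natr -/N.
    have -> : (2 * N)^-1 ^+ 2 * N = (4 * N)^-1 by field; rewrite gt_eqF.
    have : N^-1 * (1 / 2) <= N^-1 * \sum_(x <- enum K') p x by rewrite ler_pM2l ?invr_gt0.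
    have -> : N^-1 * (1 / 2) = 2 * (4 * N)^-1 by field; rewrite gt_eqF.
    lra.
  apply: ler_sum => x _; rewrite -subr_ge0.
  have -> : p x ^+ 2 - (N^-1 * p x - (2 * N)^-1 ^+ 2) = (p x - (2 * N)^-1) ^+ 2.
    by field; rewrite gt_eqF.
  exact: sqr_ge0.
apply: le_trans (gspace_rotation GV Vg w0).
have fS : ((P \x P)%E S) \is a fin_num.
  rewrite ge0_fin_numE ?measure_ge0//; apply: le_lt_trans (ltry 1).
  exact: (@probability_le1 _ _ _ (P \x P)%E S mS).
rewrite -/S -(fineK fS).
rewrite lee_fin; apply: le_trans (le_trans key sum_p2).
rewrite expRN -invfM lef_pV2 ?posrE ?mulr_gt0 ?expR_gt0//; last first.
  apply: prodr_gt0 => i _; rewrite divr_gt0// -/(q i).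
  by rewrite subr_gt0 q1.
by rewrite mulrCA ler_pM2l.
Qed.

End counting.

Section small_ball.
Context (R : realType) (d : measure_display) (Omega : measurableType d)
  (P : probability Omega R) (V : set (Omega -> R)).
Hypothesis GV : gaussian_space P V.
Context (I : finType) (g : I -> Omega -> R) (w a : I -> R).
Hypothesis Vg : forall i, V (g i).
Hypothesis w0 : forall i, 0 < w i.
Hypothesis a0 : forall i, 0 < a i.
Local Notation weight := (\prod_i ((1 + expR (- a i)) / (1 - expR (- a i)))).

(** The index is an integer at most [(y + 1) / 2]: it vanishes for [y < 1], and otherwise it is at
    most [y <= y^2]. *)
Let cell_index_bound i om :
  let y := 2 * `|g i om| / w i in
  `|cell_index g w i om|%N%:R <= y ^+ 2 /\ (y < 1 -> `|cell_index g w i om|%N = 0%N).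
Proof.
move=> y.
have := cell_indexP g w0 i om.
set k := cell_index g w i om => Hk.
have kE : (`|k|%N%:R : R) = `|k%:~R| by rewrite -intr_norm -abszE.
have gE : `|g i om| = y / 2 * w i by rewrite /y; field; rewrite gt_eqF.
have Hk' : `|k|%N%:R * w i <= (y / 2 + 1 / 2) * w i.
  rewrite kE -{1}(gtr0_norm (w0 i)) -normrM mulrDl -gE.
  have := ler_normB (g i om) (g i om - k%:~R * w i).
  by rewrite subKr; lra.
have y0 : 0 <= y by rewrite /y divr_ge0 ?mulr_ge0// ltW.
rewrite ler_pM2r// in Hk'.
have yk : y < 1 -> `|k|%N = 0%N.
  move=> y1; case: (absz k) Hk' => // n; rewrite -natr1.
  have n0 : (0 : R) <= n%:R by exact: ler0n.
  by move=> h; exfalso; lra.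
split => //; have [/yk -> //|y1] := ltP y 1; first by rewrite sqr_ge0.
by nra.
Qed.

(** By Markov's inequality the total weight is at most [2 D] with probability at least one half.
    Only means of the majorants [b i] enter, hence no information on the dependence of the [g i]. *)
Lemma small_ball_mean (b : I -> Omega -> R) (m : I -> R) (D : R) : 0 < D ->
  (forall i, measurable_fun setT (b i)) ->
  (forall i om, `|cell_index g w i om|%N%:R <= b i om) ->
  (forall i, \int[P]_om (b i om)%:E <= (m i)%:E)%E ->
  \sum_i a i * m i <= D ->
  ((expR (- (2 * D)) / (4 * weight))%:E <=
    P [set om | forall i, `|g i om| < w i]%R)%E.
Proof.
move=> D0 mb kb bm Dm.
have b0 i om : 0 <= b i om by apply: le_trans (kb i om).
pose Z om := \sum_i a i * b i om.
have mZ : measurable_fun setT Z.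
  by apply: measurable_sum => i; exact: measurable_funM.
have Z0 om : 0 <= Z om by apply: sumr_ge0 => i _; rewrite mulr_ge0// ltW.
pose E := [set om | Z om <= 2 * D].
have mE : measurable E by apply: measurable_predT; exact: measurable_fun_ler.
have intZ : (\int[P]_om (Z om)%:E <= D%:E)%E.
  rewrite (_ : \int[P]_om _ = \sum_i (a i)%:E * \int[P]_om (b i om)%:E)%E.
    apply: (@le_trans _ _ (\sum_i (a i * m i)%:E)%E); last by rewrite sumEFin lee_fin.
    apply: lee_sum => i _; rewrite EFinM; apply: lee_wpmul2l; [by rewrite lee_fin ltW|exact: bm].
  rewrite /Z; under eq_integral do rewrite -sumEFin.
  rewrite ge0_integral_sum//.
  - apply: eq_bigr => i _; under eq_integral do rewrite EFinM.
    rewrite ge0_integralZl//; first exact/measurable_EFinP.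
    - by move=> om _; rewrite lee_fin.
    - by rewrite lee_fin ltW.
  - by move=> i; apply/measurable_EFinP; exact: measurable_funM.
  - by move=> i om _; rewrite lee_fin mulr_ge0// ltW.
have PE : 1 / 2 <= fine (P E).
  have mEC : measurable (~` E) by exact: measurableC.
  have H : ((2 * D)%:E * P (~` E) <= D%:E)%E.
    apply: le_trans intZ.
    have -> : P (~` E) = (\int[P]_om (\1_(~` E) om)%:E)%E by rewrite integral_indic// setIT.
    have D20 : 0 <= 2 * D by lra.
    rewrite -ge0_integralZl//; last by apply/measurable_EFinP; exact: measurable_indic.
    apply: ge0_le_integral => //.
    - by move=> om _; rewrite mule_ge0// lee_fin; lra.
    - by apply/measurable_EFinP/measurable_funM => //; exact: measurable_indic.
    - exact/measurable_EFinP.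
    - move=> om _; rewrite -EFinM lee_fin indicE.
      have [|_] := boolP (om \in ~` E); last by rewrite mulr0.
      rewrite inE /E /= mulr1 => /negP; rewrite -ltNge; exact: ltW.
  rewrite -(fineK (fin_num_measure P _ mEC)) -EFinM lee_fin in H.
  have PEC : fine (P (~` E)) = 1 - fine (P E).
    rewrite probability_setC// -(fineK (fin_num_measure P _ mE)) -EFinB.
    by [].
  have : fine (P (~` E)) <= 1 / 2 by rewrite -(ler_pM2l D0); lra.
  by rewrite PEC; lra.
apply: (small_ball_counting GV Vg w0 a0 mE _ PE); first lra.
move=> om; apply: le_trans; apply: ler_sum => i _.
by rewrite ler_pM2l.
Qed.

(** For cells wide compared with the deviation: the index is then nonzero so rarely that its mean is
    exponentially small. *)
Lemma small_ball_fine (S : I -> R) (D : R) : 0 < D ->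
  (forall i, 0 < S i) -> (forall i, ip P (g i) (g i) <= S i ^+ 2) ->
  (forall i, 16 * S i ^+ 2 <= w i ^+ 2) ->
  \sum_i a i * (2 * expR (- (w i ^+ 2 / (16 * S i ^+ 2)))) <= D ->
  ((expR (- (2 * D)) / (4 * weight))%:E <=
    P [set om | forall i, `|g i om| < w i]%R)%E.
Proof.
move=> D0 S0 gS Sw HD.
pose beta i := w i ^+ 2 / (16 * S i ^+ 2).
(* With [y = 2 |g i| / w i] this is [exp (beta (y^2 - 1))], which exceeds [y^2] for [y >= 1] because
   [beta >= 1]. The second factor is the one whose mean [gstd_exp] bounds by 2. *)
pose b i om := expR (- beta i) * expR (g i om ^+ 2 / (4 * S i ^+ 2)).
have mexp i : measurable_fun setT (fun om => expR (g i om ^+ 2 / (4 * S i ^+ 2))).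
  apply: measurableT_comp => //; apply: measurable_funM => //.
  apply: measurable_funX; exact: (gspace_meas GV (Vg i)).
apply: (small_ball_mean (b := b) (m := fun i => 2 * expR (- beta i)) D0) => //.
- by move=> i; exact: measurable_funM.
- move=> i om; have [H1 H2] := cell_index_bound i om.
  move: H1 H2; set y := 2 * _ / _ => H1 H2.
  have [/H2 ->|y1] := ltP y 1; first by rewrite mulr_ge0 ?expR_ge0.
  apply: (le_trans H1).
  have beta1 : 1 <= beta i by rewrite /beta ler_pdivlMr ?mul1r// mulr_gt0 ?exprn_gt0.
  have -> : b i om = expR (beta i * (y ^+ 2 - 1)).
    rewrite /b -expRD; congr expR; rewrite /beta /y -[g i om ^+ 2]real_normK ?num_real//.
    by field; rewrite !gt_eqF.
  apply: (@le_trans _ _ (expR (y ^+ 2 - 1))); first by have := expR_ge1Dx (y ^+ 2 - 1); lra.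
  by rewrite ler_expR ler_peMl// subr_ge0 expr_ge1//; lra.
- move=> i; rewrite /b; under eq_integral do rewrite EFinM.
  rewrite ge0_integralZl//; last exact/measurable_EFinP.
  rewrite [(2 * expR _)%R]mulrC EFinM; apply: lee_wpmul2l; first by rewrite lee_fin expR_ge0.
  have [s Hs sE] := gspace_std GV (Vg i).
  apply: (gstd_exp Hs (S0 i)).
  rewrite -(@ler_pXn2r _ 2)// ?nnegrE ?(gstd_ge0 Hs) ?(ltW (S0 i))//.
  by rewrite sE.
Qed.

(** For narrow cells: the majorant [y^2] needs only the second moment. *)
Lemma small_ball_coarse (D : R) : 0 < D ->
  (forall i, ip P (g i) (g i) <= 1) ->
  \sum_i a i * (4 / w i ^+ 2) <= D ->
  ((expR (- (2 * D)) / (4 * weight))%:E <=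
    P [set om | forall i, `|g i om| < w i]%R)%E.
Proof.
move=> D0 g1 HD.
pose b i om := 4 / w i ^+ 2 * g i om ^+ 2.
have c0 i : 0 < 4 / w i ^+ 2 by rewrite divr_gt0// exprn_gt0.
have mg2 i : measurable_fun setT (fun om => g i om ^+ 2).
  by apply: measurable_funX; exact: (gspace_meas GV (Vg i)).
apply: (small_ball_mean (b := b) (m := fun i => 4 / w i ^+ 2) D0) => //.
- by move=> i; exact: measurable_funM.
- move=> i om; have [H _] := cell_index_bound i om; apply: le_trans H _.
  rewrite le_eqVlt; apply/orP; left; apply/eqP.
  by rewrite /b -[g i om ^+ 2]real_normK ?num_real//; field; rewrite gt_eqF.
- move=> i; rewrite /b; under eq_integral do rewrite EFinM.
  rewrite ge0_integralZl//; last 3 first.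
  - exact/measurable_EFinP.
  - by move=> om _; rewrite lee_fin sqr_ge0.
  - by rewrite lee_fin ltW.
  have [s Hs sE] := gspace_std GV (Vg i).
  rewrite (gstd_sqr Hs) -EFinM lee_fin ler_piMr ?(ltW (c0 i))//.
  by rewrite sE.
Qed.

End small_ball.

Lemma sum_geom_le (R : realType) (q : R) n : 0 <= q -> q < 1 ->
  \sum_(m < n) q ^+ m <= (1 - q)^-1.
Proof.
move=> q0 q1; have q1' : 0 < 1 - q by rewrite subr_gt0.
rewrite -(ler_pM2l q1') mulfV ?gt_eqF//.
have -> : (1 - q) * \sum_(m < n) q ^+ m = 1 - q ^+ n.
  elim: n => [|n IH]; first by rewrite big_ord0 mulr0 expr0 subrr.
  by rewrite big_ord_recr /= mulrDr IH exprS; ring.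
by rewrite gerBl exprn_ge0.
Qed.

(** A single term of the exponential series at [y / 2]. *)
Lemma pow_expR_le (R : realType) (p : nat) (y : R) : 0 < y ->
  y ^+ p.+1 * expR (- (y / 2)) <= 2 ^+ p.+1 * p.+1`!%:R.
Proof.
move=> y0; have := @expR_ge1Dxn R (y / 2) p (ltW _).
rewrite divr_gt0// => /(_ isT); rewrite expr_div_n => H.
rewrite expRN ler_pdivrMr ?expR_gt0// -ler_pdivrMl ?mulr_gt0 ?exprn_gt0// ?ltr0n ?fact_gt0//.
apply: le_trans H; apply: ler_wpDl => //.
by rewrite le_eqVlt; apply/orP; left; apply/eqP; field; rewrite ?expf_neq0//= pnatr_eq0 -lt0n fact_gt0.
Qed.

(** * Dyadic chaining *)

Section dyadic.
Variables (R : realType) (sigma th : R).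
Hypothesis sigma0 : 0 < sigma.
Hypothesis th0 : 0 < th.
Hypothesis th1 : th < 1.

(** With width [w_m = (1 - th) L th^m] and deviation bound [S_m = sigma th^(2m)], the exponent
    [w_m^2 / (16 S_m^2)] equals [c L^2 / th^(2m)]. *)
Let c := (1 - th) ^+ 2 / (16 * sigma ^+ 2).

(** Weighted mean of all cell indices, per unit of time. The exponent grows geometrically in [m], so
    it absorbs the number of points and the weights uniformly in [n], with half of the first
    exponent, [eta / 2], to spare. *)
Let dyadic_mean : exists2 C : R, 0 < C & forall (n : nat) (eta : R), 1 <= eta ->
  \sum_(m < n.+1) 2 ^+ m * ((eta / 2 + 2 * m.+1%:R) * (2 * expR (- (eta / th ^+ (2 * m)))))
  <= C * expR (- (eta / 2)).
Proof.
(* For this [p], [y^p >= 8^m] as soon as [y >= th^(- 2m)]. The factor [8^m] pays for the [2^m]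
   points and for [m + 1 <= 2^m] in the weight, and leaves the summable [2^-m]. *)
have [p Hp] : exists p : nat, th ^+ (2 * p) <= 1 / 8.
  have t1 : `|th ^+ 2| < 1 by rewrite ger0_norm ?sqr_ge0// exprn_ilt1// ltW.
  have e0 : (0 : R) < 1 / 8 by lra.
  have /cvgr0Pnorm_le /(_ _ e0) [p _ H] := cvg_expr t1.
  by exists p; rewrite exprM; apply: le_trans (ler_norm _) (H p _) => /=.
pose Cp : R := 2 ^+ p.+1 * p.+1`!%:R.
have Cp0 : 0 < Cp by rewrite mulr_gt0 ?exprn_gt0// ltr0n fact_gt0.
exists (16 * Cp); first by rewrite mulr_gt0.
move=> n eta eta1.
apply: (@le_trans _ _ (\sum_(m < n.+1) (8 * Cp * expR (- (eta / 2))) * (1 / 2) ^+ m)).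
  apply: ler_sum => m _; set y := eta / th ^+ (2 * m).
  have tm0 : 0 < th ^+ (2 * m) by rewrite exprn_gt0.
  have tm1 : th ^+ (2 * m) <= 1 by rewrite exprn_ile1 ?ltW.
  have yeta : eta <= y by rewrite /y ler_pdivlMr// ler_piMr//; lra.
  have y0 : 0 < y by lra.
  have m1 : m.+1%:R <= 2 ^+ m :> R by rewrite -natrX ler_nat ltn_expl.
  have m0 : 1 <= m.+1%:R :> R by rewrite ler1n.
  have E1 : expR (- y) <= expR (- (eta / 2)) * expR (- (y / 2)).
    by rewrite -expRD ler_expR; lra.
  have E2 : eta / 2 + 2 * m.+1%:R <= 4 * 2 ^+ m * y.
    by move: m1 m0 yeta eta1; move: (m.+1%:R) (2 ^+ m) => s t; nra.
  have E3 : y * expR (- (y / 2)) * 8 ^+ m <= Cp.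
    apply: le_trans (pow_expR_le p y0).
    rewrite exprS [leLHS]mulrAC ler_wpM2r ?expR_ge0// ler_pM2l//.
    have yV : (th ^+ (2 * m))^-1 <= y by rewrite /y ler_peMl ?invr_ge0 ?(ltW tm0).
    apply: (@le_trans _ _ ((th ^+ (2 * m))^-1 ^+ p)); last first.
      by rewrite lerXn2r ?nnegrE ?invr_ge0 ?(ltW tm0) ?(ltW y0).
    rewrite exprVn -exprM mulnAC exprM -exprVn lerXn2r ?nnegrE ?invr_ge0 ?exprn_ge0 ?(ltW th0)//.
    by rewrite -[leLHS]invrK lef_pV2 ?posrE ?invr_gt0 ?exprn_gt0//; lra.
  have e1 := expR_ge0 (- (eta / 2)); have e2 := expR_ge0 (- (y / 2)).
  have t0 : 0 <= 2 ^+ m :> R by rewrite exprn_ge0.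
  apply: (@le_trans _ _ (2 ^+ m * ((4 * 2 ^+ m * y) * (2 * (expR (- (eta / 2)) * expR (- (y / 2))))))).
    rewrite ler_wpM2l// ler_pM ?mulr_ge0 ?expR_ge0//; last by rewrite ler_wpM2l.
    by lra.
  have -> : 2 ^+ m * (4 * 2 ^+ m * y * (2 * (expR (- (eta / 2)) * expR (- (y / 2))))) =
     (8 * expR (- (eta / 2)) * (1 / 2) ^+ m) * (y * expR (- (y / 2)) * 8 ^+ m).
    rewrite (_ : 8 = 2 * 2 * 2 :> R); last by ring.
    rewrite !exprMn expr1n exprVn; field.
    by rewrite expf_neq0.
  rewrite [leRHS](_ : _ = (8 * expR (- (eta / 2)) * (1 / 2) ^+ m) * Cp); last by ring.
  by rewrite ler_wpM2l// !mulr_ge0// exprn_ge0.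
rewrite -mulr_sumr.
rewrite [leRHS](_ : _ = (8 * Cp * expR (- (eta / 2))) * 2); last by ring.
rewrite ler_wpM2l//; first by rewrite !mulr_ge0 ?expR_ge0 ?(ltW Cp0).
have h0 : 0 <= 1 / 2 :> R by lra.
have h1 : 1 / 2 < 1 :> R by lra.
have h2 : (1 - 1 / 2)^-1 = 2 :> R by field.
by rewrite -[leRHS]h2; exact: sum_geom_le.
Qed.

Section chaining.
Context (d : measure_display) (Omega : measurableType d)
  (P : probability Omega R) (V : set (Omega -> R)).
Hypothesis GV : gaussian_space P V.
Variables (N n : nat) (g : R -> Omega -> R).
Local Notation dyad m j := ((j : nat)%:R / 2 ^+ (m : nat) : R).
Hypothesis Vg : forall m j, (m <= n)%N -> V (g (dyad m j)).
Hypothesis g_std : forall k, ip P (g k%:R) (g k%:R) <= sigma ^+ 2.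
Hypothesis g_incr : forall m j, (m <= n)%N ->
  let X om := g (dyad m j.+1) om - g (dyad m j) om in
  ip P X X <= (sigma * th ^+ (2 * m)) ^+ 2.

Let J := {m : 'I_n.+1 & 'I_(N.+1 * 2 ^ m)}.

(** Level 0 carries values instead of increments, to start the chain. *)
Let X (i : J) : Omega -> R := let m : nat := tag i in let j : nat := tagged i in
  if m == 0%N then g j%:R else fun om => g (dyad m j.+1) om - g (dyad m j) om.

(** A point of level [m + 1] with even index belongs to level [m]; with odd index it is one
    increment to the right of such a point. *)
Let chain (w : nat -> R) om : (forall i : J, `|X i om| < w (tag i)) ->
  forall m j, (m <= n)%N -> (j < N.+1 * 2 ^ m)%N ->
  `|g (dyad m j) om| < \sum_(l < m.+1) w l.
Proof.
move=> Xw; elim => [|m IH] j mn jm.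
  rewrite big_ord1 expr0 divr1.
  have := Xw (@Tagged _ (Ordinal (mn : 0 < n.+1)%N) (fun m : 'I_n.+1 => 'I_(N.+1 * 2 ^ m)) (Ordinal jm)).
  by rewrite /X /=.
have jE : j = (j./2.*2 + odd j)%N by rewrite addnC odd_double_half.
have half_lt : (j./2 < N.+1 * 2 ^ m)%N.
  by move: jm; rewrite expnS; lia.
have gE : g (dyad m j./2) om = g (dyad m.+1 j./2.*2) om.
  congr (g _ om); rewrite -mul2n natrM exprS; field.
  by rewrite expf_neq0.
have Hm := IH _ (ltnW mn) half_lt.
have mn1 : (m.+1 < n.+1)%N by [].
have lt2 : (j./2.*2 < N.+1 * 2 ^ m.+1)%N by apply: leq_ltn_trans jm; rewrite [leqRHS]jE leq_addr.
have Hi := Xw (@Tagged _ (Ordinal mn1) (fun m : 'I_n.+1 => 'I_(N.+1 * 2 ^ m)) (Ordinal lt2)).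
rewrite /X /= in Hi.
have w_gt0 : 0 < w m.+1 by apply: le_lt_trans Hi.
rewrite big_ord_recr /= jE; case: (odd j); last first.
  by rewrite addn0 -gE (lt_trans Hm)// ltrDl.
rewrite addn1 -[g _ om](subrK (g (dyad m.+1 j./2.*2) om)).
by rewrite (le_lt_trans (ler_normD _ _))// addrC ltrD// -gE.
Qed.

Let sumJ (F : nat -> R) : \sum_(i : J) F (tag i) = \sum_(m < n.+1) (N.+1 * 2 ^ m)%:R * F m.
Proof.
transitivity (\sum_(m < n.+1) \sum_(j < N.+1 * 2 ^ m) F m).
  by rewrite sig_big_dep.
by apply: eq_bigr => m _; rewrite big_const_ord iter_addr_0 mulr_natl.
Qed.

Let VX i : V (X i).
Proof.
rewrite /X; case: i => m j /=; case: ifPn => [m0|m0].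
  have := Vg j (leq0n n); rewrite expr0.
  by rewrite (_ : j%:R / 1 = j%:R :> R)// divr1.
by apply: (gspaceB GV); apply: Vg; rewrite -ltnS.
Qed.

Lemma chaining_bound (C L : R) : 0 < C ->
  (forall (eta : R), 1 <= eta ->
    \sum_(m < n.+1) 2 ^+ m * ((eta / 2 + 2 * m.+1%:R) * (2 * expR (- (eta / th ^+ (2 * m)))))
    <= C * expR (- (eta / 2))) ->
  0 < L -> 1 <= c * L ^+ 2 ->
  ((expR (- ((2 * C + 2) * N.+1%:R * expR (- (c * L ^+ 2 / 2)))) / 4)%:E <=
  P [set om | forall j, (j < N.+1 * 2 ^ n)%N -> `|g (dyad n j) om| < L]%R)%E.
Proof.
move=> C0 HC L0; set eta := c * L ^+ 2 => eta1.
have th1' : 0 < 1 - th by rewrite subr_gt0.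
(* The factor [1 - th] makes the widths sum to at most [L]. *)
pose w m := (1 - th) * L * th ^+ m.
(* Both parts serve the weight product: [eta / 2] makes its logarithm of order [N exp (- eta / 2)],
   like the mean, and [2 (m + 1)] gives a factor at most [4^-(m + 1)] against the [2^m] points. *)
pose a m : R := eta / 2 + 2 * m.+1%:R.
pose S m := sigma * th ^+ (2 * m).
have w0 m : 0 < w m by rewrite /w !mulr_gt0// exprn_gt0.
have a0 m : 0 < a m.
  have : (0 : R) < m.+1%:R by []. by rewrite /a; lra.
have S0 m : 0 < S m by rewrite /S mulr_gt0// exprn_gt0.
have wSE m : w m ^+ 2 / (16 * S m ^+ 2) = eta / th ^+ (2 * m).
  have sn0 : sigma != 0 by rewrite gt_eqF.
  have tn0 : th ^+ m != 0 by rewrite expf_neq0// gt_eqF.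
  rewrite /w /S /eta /c (mulnC 2) exprM; field.
  by rewrite sn0 tn0.
pose e := expR (- (eta / 2)).
have e0 : 0 < e by exact: expR_gt0.
have NR : (0 : R) < N.+1%:R by [].
pose D := N.+1%:R * (C * e).
have D0 : 0 < D by rewrite /D !mulr_gt0.
have Xstd i : ip P (X i) (X i) <= S (tag i) ^+ 2.
  case: i => m j; rewrite /X /=; case: ifPn => [/eqP m0|m0].
    have -> : S m = sigma by rewrite /S m0 muln0 expr0 mulr1.
    exact: g_std.
  by apply: g_incr; rewrite -ltnS.
have wS (i : J) : 16 * S (tag i) ^+ 2 <= w (tag i) ^+ 2.
  have S20 : 0 < 16 * S (tag i) ^+ 2 by rewrite mulr_gt0// exprn_gt0.
  have t0 : 0 < th ^+ (2 * tag i) by rewrite exprn_gt0.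
  rewrite -[leLHS]mul1r -ler_pdivlMr// wSE ler_pdivlMr// mul1r (le_trans _ eta1)//.
  by rewrite exprn_ile1 ?ltW.
have HD : \sum_(i : J) a (tag i) * (2 * expR (- (w (tag i) ^+ 2 / (16 * S (tag i) ^+ 2)))) <= D.
  rewrite (sumJ (fun m => a m * (2 * expR (- (w m ^+ 2 / (16 * S m ^+ 2)))))).
  rewrite /D; apply: le_trans (ler_wpM2l (ltW NR) (HC _ eta1)); rewrite mulr_sumr.
  by apply: ler_sum => m _; rewrite wSE natrM natrX -mulrA /a.
have := @small_ball_fine R d Omega P V GV J X (fun i => w (tag i)) (fun i => a (tag i)) VX
  (fun i => w0 _) (fun i => a0 _) (fun i => S (tag i)) D D0 (fun i => S0 _) Xstd wS HD.
set W := \prod_i _ => HW.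
have Wle : W <= expR (2 * N.+1%:R * e).
  pose q m := expR (- a m).
  have q_le m : q m <= e * (1 / 4) ^+ m.+1.
    rewrite /q /a opprD expRD ler_wpM2l ?expR_ge0// -mulNr expRM_natr.
    have q14 : 0 <= 1 / 4 :> R by lra.
    have e1 : 2 <= expR (1 : R) by have := @expR_ge1Dx R 1; lra.
    have e2 : expR (- 2) <= 1 / 4 :> R.
      have -> : - 2 = - (1 + 1) :> R by lra.
      rewrite expRN expRD -[leRHS]invrK lef_pV2 ?posrE ?mulr_gt0 ?expR_gt0 ?invr_gt0//.
      by rewrite div1r invrK; nra.
    by rewrite lerXn2r ?nnegrE ?expR_ge0.
  have e1 : e <= 1 by rewrite /e expR_le1; lra.
  have q4 m : q m <= 1 / 4.
    have q14 : 0 <= 1 / 4 :> R by lra.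
    have q14' : 1 / 4 <= 1 :> R by lra.
    have p0 := exprn_ge0 m q14.
    have p1 := exprn_ile1 m q14 q14'.
    apply: (le_trans (q_le m)); rewrite exprS mulrCA ler_piMr// mulr_ile1//.
    exact: ltW.
  (* For [0 <= x <= 1 / 4], [(1 + x) / (1 - x) <= 1 + 4 x <= exp (4 x)]. *)
  apply: (@le_trans _ _ (\prod_(i : J) expR (4 * q (tag i)))).
    apply: ler_prod => i _; rewrite -/(q (tag i)).
    have q0 : 0 < q (tag i) by exact: expR_gt0.
    have q1 := q4 (tag i).
    rewrite divr_ge0/=; [|lra|lra].
    rewrite ler_pdivrMr; last lra.
    have := @expR_ge1Dx R (4 * q (tag i)).
    by move: q0 q1; move: (q _) (expR _) => x y; nra.
  rewrite -expR_sum ler_expR (sumJ (fun m => 4 * q m)).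
  apply: (@le_trans _ _ (\sum_(m < n.+1) (N.+1%:R * e) * (1 / 2) ^+ m)).
    apply: ler_sum => m _; rewrite natrM natrX.
    apply: (@le_trans _ _ (N.+1%:R * 2 ^+ m * (4 * (e * (1 / 4) ^+ m.+1)))).
      by rewrite ler_wpM2l ?mulr_ge0 ?exprn_ge0 ?(ltW NR)// ler_wpM2l.
    rewrite le_eqVlt; apply/orP; left; apply/eqP.
    rewrite (_ : 1 / 4 = 1 / 2 * (1 / 2)); last by field.
    rewrite exprS !exprMn expr1n exprVn; field.
    by rewrite expf_neq0.
  rewrite -mulr_sumr [leRHS](_ : _ = (N.+1%:R * e) * 2); last by ring.
  rewrite ler_wpM2l ?mulr_ge0 ?(ltW NR) ?(ltW e0)//.
  have h2 : (1 - 1 / 2)^-1 = 2 :> R by field.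
  by rewrite -[leRHS]h2; apply: sum_geom_le; lra.
apply: (@le_trans _ _ (expR (- (2 * D)) / (4 * W))%:E); last first.
  apply: (le_trans HW); apply: le_measure; rewrite ?inE.
  - apply: measurable_forall => i.
    by have := measurable_dist_lt 0 (w (tag i)) (gspace_meas GV (VX i)); under eq_set do rewrite subr0.
  - rewrite (_ : [set om | _] = [set om | forall j : 'I_(N.+1 * 2 ^ n), `|g (dyad n j) om| < L]).
      apply: measurable_forall => j.
      by have := measurable_dist_lt 0 L (gspace_meas GV (Vg j (leqnn n))); under eq_set do rewrite subr0.
    apply/seteqP; split => om /= H j; first exact: H.
    by move=> jn; exact: (H (Ordinal jn)).
  - move=> om /= H j jn; apply: lt_le_trans (chain H (leqnn n) jn) _.
    rewrite -mulr_sumr; have := sum_geom_le n.+1 (ltW th0) th1.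
    rewrite -(ler_pM2l th1') mulfV ?gt_eqF// => Hs.
    by rewrite mulrAC ler_piMl// ltW.
have W0 : 0 < W.
  by apply: prodr_gt0 => i _; rewrite divr_gt0 ?subr_gt0 ?expR_lt1 ?oppr_lt0.
have -> : - ((2 * C + 2) * N.+1%:R * e) = - (2 * D) + - (2 * N.+1%:R * e) by rewrite /D; ring.
rewrite lee_fin expRD -mulrA ler_wpM2l ?expR_ge0// invfM mulrC ler_wpM2l ?invr_ge0//.
by rewrite expRN lef_pV2 ?posrE ?expR_gt0.
Qed.

End chaining.

(** [C] and [kappa] are fixed before the probability space, the time [N] and the level [n]: this is
    where the uniformity of the final constants comes from. *)
Lemma dyadic_small_ball : exists C kappa : R, [/\ 0 < C, 0 < kappa &
  forall (d : measure_display) (Omega : measurableType d)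
    (P : probability Omega R) (V : set (Omega -> R)) (N n : nat) (g : R -> Omega -> R),
  gaussian_space P V ->
  (forall m j : nat, (m <= n)%N -> V (g (j%:R / 2 ^+ m))) ->
  (forall k : nat, ip P (g k%:R) (g k%:R) <= sigma ^+ 2) ->
  (forall m j : nat, (m <= n)%N ->
    let X om := g (j.+1%:R / 2 ^+ m) om - g (j%:R / 2 ^+ m) om in
    ip P X X <= (sigma * th ^+ (2 * m)) ^+ 2) ->
  forall L, 0 < L -> 1 <= kappa * L ^+ 2 ->
  ((expR (- (C * N.+1%:R * expR (- (kappa * L ^+ 2 / 2)))) / 4)%:E <=
  P [set om | forall j : nat, (j < N.+1 * 2 ^ n)%N -> `|g (j%:R / 2 ^+ n) om| < L]%R)%E].
Proof.
have [C C0 HC] := dyadic_mean.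
exists (2 * C + 2), c; split.
- by rewrite addr_gt0// mulr_gt0.
- by rewrite /c divr_gt0 ?mulr_gt0 ?exprn_gt0// subr_gt0.
move=> d Omega P V N n g GV Vg g1 g2 L L0 L1.
exact: (chaining_bound GV N Vg g1 g2 C0 (HC n) L0 L1).
Qed.

End dyadic.

(** * Spectral measure *)

Lemma norm_sin_le (R : realType) (x : R) : `|sin x| <= `|x|.
Proof.
wlog x0 : x / 0 <= x.
  move=> H; have [|x0] := leP 0 x; first exact: H.
  by have := H (- x); rewrite sinN !normrN; apply; rewrite oppr_ge0 ltW.
move: x0; rewrite le_eqVlt => /predU1P[<-|x0]; first by rewrite sin0.
have ds (y : R) : y \in `]0, x[ -> is_derive y 1 (@sin R) (cos y) by move=> _; exact: is_derive_sin.
have cs : {within `[0, x], continuous (@sin R)}.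
  by apply: continuous_subspaceT; exact: continuous_sin.
have [z _] := MVT x0 ds cs.
rewrite sin0 !subr0 => ->; rewrite normrM ler_piMl//.
by rewrite ler_norml cos_geN1 cos_le1.
Qed.

Lemma one_sub_cos_le (R : realType) (x : R) : 1 - cos x <= x ^+ 2 / 2.
Proof.
have -> : cos x = 1 - 2 * sin (x / 2) ^+ 2.
  have xE : x = x / 2 *+ 2 by rewrite mulr2n; lra.
  by rewrite {1}xE cos_mulr2n; have := cos2Dsin2 (x / 2); rewrite mulr2n; lra.
have := norm_sin_le (x / 2); rewrite -(ler_pXn2r (ltn0Sn 1)) ?nnegrE//.
by rewrite !real_normK ?num_real//; lra.
Qed.

(** Interpolates between the bounds [x^2 / 2], used up to 1, and 2, used beyond. *)
Lemma one_sub_cos_powR_le (R : realType) (x a : R) : 0 < a -> a <= 1 ->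
  1 - cos x <= 2 * (`|x| `^ a).
Proof.
move=> a0 a1; have [x1|x1] := leP `|x| 1; last first.
  have : 1 <= `|x| `^ a by rewrite -[leLHS](powRr0 `|x|) ler_powR// ltW.
  by have := cos_geN1 x; lra.
have := one_sub_cos_le x; rewrite -real_normK ?num_real// => H.
have := normr_ge0 x; set y := `|x| in x1 H *.
rewrite le_eqVlt => /predU1P[y0|y0].
  by rewrite -y0 expr0n/= in H; have := powR_ge0 y a; lra.
have : y <= y `^ a by apply: ger1_powR => //; rewrite y0.
by nra.
Qed.

Section spectral_window.
Context (R : realType) (T : time).
Variable rho : {finite_measure set (measurableTypeR R) -> \bar R}.
Local Notation D := (@dual_set R T).

Lemma measurable_dual_set : measurable D.
Proof. by case: T => /=; [exact: measurable_itv|exact: measurableT]. Qed.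

Lemma time_set0 : @time_set R T 0.
Proof. by case: T => //=; exists 0. Qed.

Lemma time_setD (s t : R) : time_set T s -> time_set T t -> time_set T (s + t).
Proof.
case: T => //= -[a _ <-] [b _ <-]; exists (a + b) => //; exact: intrD.
Qed.

Lemma time_setN (s : R) : time_set T s -> time_set T (- s).
Proof. case: T => //= -[a _ <-]; exists (- a) => //; exact: intrN. Qed.

Definition frequency : set (R -> R) :=
  [set th | exists2 s : R, time_set T s & th = fun l => l * s].

Lemma frequency0 : frequency (fun=> 0).
Proof. by exists 0; [exact: time_set0|apply/funext => l; rewrite mulr0]. Qed.

Lemma frequencyD s t : frequency s -> frequency t -> frequency (fun x => s x + t x).
Proof.
move=> [a Ta ->] [b Tb ->]; exists (a + b); first exact: time_setD.
by apply/funext => l; rewrite mulrDr.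
Qed.

Lemma frequencyB s t : frequency s -> frequency t -> frequency (fun x => s x - t x).
Proof.
move=> [a Ta ->] [b Tb ->]; exists (a - b).
  by apply: time_setD => //; exact: time_setN.
by apply/funext => l; rewrite mulrBr.
Qed.

(** A soft step of [(1 + cos (l * s)) / 2] with half period [M]. The factor [5 / 4] leaves room for
    the switch after [1 / N] and stays below [pi / 2], so [cos (l * t)] is still bounded away from 0
    on the window when [|t| <= N]. *)
Lemma spectral_window (N eps : R) : 1 <= N -> 0 < eps -> (rho (~` D) = 0)%E ->
  exists w : R -> R, exists M : R, [/\ cos_span frequency w,
    forall l, 0 <= w l <= 1,
    (rho [set l | (M < `|l|)%R] <= eps%:E)%E,
    forall l, `|l| <= N^-1 -> 1 - eps <= w l &
    forall l, 5 / 4 / N < `|l| -> `|l| <= M -> w l <= eps].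
Proof.
move=> N1 e0 rhoD.
have N0 : 0 < N by lra.
have [M [s [NM sM Ts tail]]] : exists M s : R, [/\ 5 / 4 / N <= M, s * M = pi,
    time_set T s & (rho [set l | (M < `|l|)%R] <= eps%:E)%E].
  have N54 : 5 / 4 / N <= 5 / 4 by rewrite ler_pdivrMr//; lra.
  move: rhoD; case: T => /= rhoD.
    (* Over the integers the period [2 pi] is the length of the dual set, and [rho] puts no mass
       beyond [M = pi]. *)
    exists pi, 1; split; [|by rewrite mul1r|by exists 1|].
      by have := @pi_ge2 R; lra.
    have mD : measurable [set l : measurableTypeR R | (pi < `|l|)%R].
      by apply: measurable_predT; apply: measurable_fun_ltr => //; exact: normr_measurable.
    rewrite (_ : rho _ = 0%E) ?lee_fin ?(ltW e0)//.
    apply: (subset_measure0 _ _ _ rhoD) => //.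
      by apply: measurableC; exact: measurable_itv.
    move=> l /= pil; rewrite in_itv /= -ler_norml; apply/negP; by rewrite -ltNge.
  (* Over the reals the period is adapted to the measure, so as to leave mass at most [eps]
     outside. *)
  have [M0 HM] := finite_measure_tail rho (@normr_measurable R setT) e0.
  pose M := Num.max M0 (5 / 4 / N).
  have MN : 5 / 4 / N <= M by rewrite /M le_max lexx orbT.
  have M_gt0 : 0 < M by apply: lt_le_trans MN; rewrite divr_gt0.
  exists M, (pi / M); split => //; first by rewrite divfK// gt_eqF.
  by apply: HM; rewrite /M le_max lexx.
have NM0 : 0 < 5 / 4 / N by rewrite divr_gt0.
have M0 : 0 < M by exact: lt_le_trans NM.
have s0 : 0 < s by rewrite -(pmulr_lgt0 _ M0) sM pi_gt0.
have sle y : y <= M -> s * y <= pi by move=> yM; rewrite -sM ler_wpM2l// ltW.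
pose u l := (1 + cos (l * s)) / 2.
have u01 l : 0 <= u l <= 1.
  by rewrite /u; have := cos_geN1 (l * s); have := cos_le1 (l * s); lra.
pose lo := u (5 / 4 / N); pose hi := u N^-1.
have N54 : N^-1 < 5 / 4 / N by rewrite ltr_pMl ?invr_gt0//; lra.
have NV0 : 0 < N^-1 by rewrite invr_gt0.
have lohi : lo < hi.
  have a1 : 0 <= 5 / 4 / N * s <= pi by rewrite mulr_ge0 ?(ltW s0) ?(ltW NM0)//= mulrC sle.
  have a2 : 0 <= N^-1 * s <= pi.
    by rewrite mulr_ge0 ?(ltW s0) ?(ltW NV0)//= mulrC sle// (le_trans (ltW N54)).
  by rewrite /lo /hi /u ltr_pM2r// ltrD2l ltr_cos ?in_itv//= ltr_pM2r.
have [lo0 _] := andP (u01 (5 / 4 / N)); have [_ hi1] := andP (u01 N^-1).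
have [n [m H]] := soft_step_switch lo0 lohi hi1 e0.
exists (fun l => soft_step n m (u l)), M; split => //.
- apply: cos_span_soft_step; [exact: frequency0|exact: frequencyD|exact: frequencyB|].
  have Hc := @cos_span_cst _ _ frequency frequency0 (1 / 2).
  have fs : frequency (fun l => l * s) by exists s.
  have := cos_spanD Hc (cos_spanZ (1 / 2) (cos_span_cos fs)).
  by congr cos_span; apply/funext => x; rewrite /u; field.
- by move=> l; exact: soft_step_itv.
- move=> l lN; apply: (proj1 (H _ (u01 l))).
  rewrite /hi /u ler_pM2r// lerD2l ![_ * s]mulrC.
  rewrite cos_dist_le ?(ltW s0) ?(ltW NV0)// sle// (le_trans _ NM)// ltW//.
- move=> l Nl lM; apply: (proj2 (H _ (u01 l))).
  rewrite /lo /u ler_pM2r// lerD2l ![_ * s]mulrC.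
  rewrite -[X in X <= _]cos_norm normrM (gtr0_norm s0).
  rewrite cos_dist_le ?(ltW s0)//; first exact: sle.
  by rewrite [leLHS]gtr0_norm ?(ltW Nl).
Qed.

End spectral_window.

Section process.
Context (R : realType) (T : time) (d : measure_display) (Omega : measurableType d)
  (P : probability Omega R) (f : R -> {RV P >-> R})
  (rho : {finite_measure set (measurableTypeR R) -> \bar R}).
Hypothesis Gf : gsp T f.
Hypothesis Sf : spectral_measure T f rho.
Hypothesis m0 : moment T rho 0 = 1%E.
Local Notation D := (@dual_set R T).

Definition time_span : set (Omega -> R) :=
  [set X | exists n (t a : 'I_n -> R), (forall i, time_set T (t i)) /\
     X = fun w => \sum_(i < n) a i * f (t i) w].

Lemma time_span_gaussian : gaussian_space P time_span.
Proof.
have [gm _ _ _] := Gf; split.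
- exists 0%N, (fun=> 0), (fun=> 0); split; first by case.
  by apply/funext => w; rewrite big_ord0.
- move=> X Y [n [t [a [Tt ->]]]] [n' [t' [a' [Tt' ->]]]].
  exists (n + n')%N, (fun i => match fintype.split i with inl j => t j | inr j => t' j end),
    (fun i => match fintype.split i with inl j => a j | inr j => a' j end); split.
    by move=> i; case: (fintype.split i).
  apply/funext => w; rewrite big_split_ord /=; congr (_ + _); apply: eq_bigr => i _.
    by rewrite (unsplitK (inl i)).
  by rewrite (unsplitK (inr i)).
- move=> c X [n [t [a [Tt ->]]]]; exists n, t, (fun i => c * a i); split => //.
  by apply/funext => w; rewrite mulr_sumr; apply: eq_bigr => i _; rewrite mulrA.
- move=> X [n [t [a [Tt ->]]]]; apply: measurable_sum => i.
  by apply: measurable_funM => //; exact: measurable_funP.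
- by move=> X [n [t [a [Tt ->]]]]; exact: gm.
Qed.
Let GV := time_span_gaussian.

Lemma time_span_f t : time_set T t -> time_span (f t).
Proof.
move=> Tt; exists 1%N, (fun=> t), (fun=> 1); split => //.
by apply/funext => w; rewrite big_ord1 mul1r.
Qed.
Let Vf := time_span_f.

Let rhoD : rho D = 1%E.
Proof.
rewrite -m0 /moment; under eq_integral do rewrite powRr0.
by rewrite integral_cst ?mul1e//; exact: measurable_dual_set.
Qed.

Let rho0 : rho (~` D) = 0%E. Proof. by case: Sf. Qed.

Let mD := @measurable_dual_set R T.

Lemma spectral_integrable (h : R -> R) (C : R) : measurable_fun setT h ->
  (forall l, `|h l| <= C) -> rho.-integrable D (EFin \o h).
Proof.
move=> mh hC; apply: (@le_integrable _ _ _ rho D mD _ (EFin \o cst C)).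
- by apply/measurable_EFinP; exact: measurable_funTS.
- by move=> w _ /=; rewrite lee_fin (le_trans (hC w)) ?ler_norm.
- exact: finite_measure_integrable_cst.
Qed.

Let mcos t : measurable_fun setT (fun l : R => cos (l * t)).
Proof.
apply: (measurableT_comp (f := @cos R)); first exact: measurable_cosR.
exact: measurable_funM.
Qed.

Let icos t : rho.-integrable D (EFin \o (fun l => cos (l * t))).
Proof.
apply: (@spectral_integrable _ 1) => // l.
by rewrite ler_norml cos_geN1 cos_le1.
Qed.

Let r t := \int[rho]_(l in D) cos (l * t).

Let ip_cov t : time_set T t -> ip P (f 0) (f t) = r t.
Proof.
move=> Tt; have [_ _ /(_ _ Tt)[H _]] := Sf.
by rewrite /ip /r /Rintegral -H /cov_kernel unlock.
Qed.

(* Only the law of [f a + c f b] is shifted by stationarity; the covariance is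
   recovered by polarization. *)
Let stationary_norm a b c : time_set T a -> time_set T b ->
  ip P (fun w => f a w + c * f b w) (fun w => f a w + c * f b w) =
  ip P (fun w => f 0 w + c * f (b - a) w) (fun w => f 0 w + c * f (b - a) w).
Proof.
move=> Ta Tb; have [_ st _ _] := Gf.
have Tba : time_set T (b - a) by apply: time_setD => //; exact: time_setN.
pose X w := f a w + c * f b w; pose Y w := f 0 w + c * f (b - a) w.
have mX : measurable_fun setT X by apply: measurable_funD => //; exact: measurable_funM.
have mY : measurable_fun setT Y by apply: measurable_funD => //; exact: measurable_funM.
have law B : measurable B -> P (X @^-1` B) = P (Y @^-1` B).
  move=> mB.
  pose TT := g_sigma_algebraType (@cylinders R T).
  have mev t : time_set T t -> measurable_fun setT (fun x : TT => (x : R -> R) t).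
    move=> Tt _ B' mB'; rewrite setTI; apply: sub_sigma_algebra.
    by exists t; exists B'.
  have mE : measurable_fun setT (fun x : TT => (x : R -> R) 0 + c * (x : R -> R) (b - a)).
    apply: measurable_funD; first by apply: mev; exact: time_set0.
    by apply: measurable_funM => //; exact: mev.
  have := mE measurableT B mB; rewrite setTI => mB'.
  have := st a _ Ta mB'; rewrite /preimage /= add0r subrK.
  by [].
pose sq (y : R) := y ^+ 2.
have ms : measurable_fun setT (EFin \o sq).
  by apply/measurable_EFinP; exact: measurable_funX.
have s0 : {in setT, forall y : R, 0 <= (EFin \o sq) y}%E.
  by move=> y _; rewrite /= lee_fin sqr_ge0.
have HX := @ge0_integral_pushforward _ _ Omega (measurableTypeR R) R X mX P setT _ measurableT ms s0.
have HY := @ge0_integral_pushforward _ _ Omega (measurableTypeR R) R Y mY P setT _ measurableT ms s0.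
rewrite preimage_setT in HX; rewrite preimage_setT in HY.
have E : (\int[P]_w ((EFin \o sq) \o X) w = \int[P]_w ((EFin \o sq) \o Y) w)%E.
  by rewrite -HX -HY; apply: eq_measure_integral => B mB _; exact: law.
exact: (congr1 fine E).
Qed.

Lemma ip_process a b : time_set T a -> time_set T b -> ip P (f a) (f b) = r (b - a).
Proof.
move=> Ta Tb.
have T0 := @time_set0 R T.
have Tba : time_set T (b - a) by apply: time_setD => //; exact: time_setN.
rewrite -ip_cov//.
have expand X Y c : time_span X -> time_span Y ->
    ip P (fun w => X w + c * Y w) (fun w => X w + c * Y w) =
    ip P X X + 2 * c * ip P X Y + c ^+ 2 * ip P Y Y.
  move=> VX VY; have VcY := gspaceZ GV c VY; have VS := gspaceD GV VX VcY.
  rewrite (ipDl GV VX VcY VS) !(ipDr GV)// (ipZl GV _ VY VX) (ipZr GV _ VY VX) (ipZl GV _ VY VcY) (ipZr GV _ VY VY).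
  by rewrite (ipC _ Y X); ring.
have same (t t' : R) : time_set T t -> time_set T t' -> ip P (f t) (f t) = ip P (f 0) (f 0).
  move=> Tt Tt'; have := stationary_norm 0 Tt Tt'.
  rewrite !expand//; try exact: Vf.
    by rewrite !expr0n /= !mulr0 !mul0r !addr0.
  by apply: Vf; apply: time_setD => //; exact: time_setN.
have := stationary_norm 1 Ta Tb; rewrite !expand; try exact: Vf.
rewrite !expr1n !mulr1 !mul1r (same a b)// (same b a)// (same (b - a) b)//.
lra.
Qed.

(** The spectral isometry on cosine polynomials, [cos (l * s)] being the density of
    [(f s + f (- s)) / 2]. As a relation, it lets the polynomial and the variable be built by one
    induction. *)
Inductive spectral_pair : (R -> R) -> (Omega -> R) -> Prop :=
| spectral_pair0 : spectral_pair (fun=> 0) (fun=> 0)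
| spectral_pairS c s w Y : time_set T s -> spectral_pair w Y ->
    spectral_pair (fun l => c * cos (l * s) + w l)
      (fun om => c / 2 * (f s om + f (- s) om) + Y om).

Lemma cos_span_spectral_pair w : cos_span (frequency T) w -> exists Y, spectral_pair w Y.
Proof.
elim => [|c th F [s Ts ->] _ [Y HY]]; first by exists (fun=> 0); exact: spectral_pair0.
by exists (fun om => c / 2 * (f s om + f (- s) om) + Y om); exact: (spectral_pairS c Ts HY).
Qed.

Lemma spectral_pair_span w Y : spectral_pair w Y -> time_span Y.
Proof.
elim => [|c s {}w {}Y Ts _ VY]; first exact: (gspace0 GV).
exact: (gspaceD GV (gspaceZ GV _ (gspaceD GV (Vf Ts) (Vf (time_setN Ts)))) VY).
Qed.

Lemma spectral_pair_bounded w Y : spectral_pair w Y ->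
  measurable_fun setT w /\ exists C, forall l, `|w l| <= C.
Proof.
elim => [|c s {}w {}Y Ts _ [mw [C wC]]].
  by split; [exact: measurable_cst|exists 0 => l; rewrite normr0].
split; first by apply: measurable_funD => //; exact: measurable_funM.
exists (`|c| + C) => l; rewrite (le_trans (ler_normD _ _))// lerD// normrM.
by rewrite ler_piMr// ler_norml cos_geN1 cos_le1.
Qed.

Let integrable_mul (w1 w2 : R -> R) (C1 C2 : R) : measurable_fun setT w1 -> measurable_fun setT w2 ->
  (forall l, `|w1 l| <= C1) -> (forall l, `|w2 l| <= C2) ->
  rho.-integrable D (EFin \o (fun l => w1 l * w2 l)).
Proof.
move=> m1 m2 b1 b2; apply: (@spectral_integrable _ (C1 * C2)).
  exact: measurable_funM.
by move=> l; rewrite normrM ler_pM.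
Qed.

Let cosb (x : R) : `|cos x| <= 1. Proof. by rewrite ler_norml cos_geN1 cos_le1. Qed.

(** Symmetrizing in [s] produces [cos (l (s - t)) + cos (l (s + t)) = 2 cos (l s) cos (l t)], which
    keeps everything real. *)
Lemma ip_spectral_pair w Y t : spectral_pair w Y -> time_set T t ->
  ip P (f t) Y = \int[rho]_(l in D) (w l * cos (l * t)).
Proof.
move=> H Tt; elim: H => [|c s {}w {}Y Ts H IH].
  rewrite /ip; under eq_Rintegral do rewrite mulr0.
  rewrite Rintegral_prob_cst; under eq_Rintegral do rewrite mul0r.
  by rewrite Rintegral_cst// mul0r.
have [mw [C wC]] := spectral_pair_bounded H.
have VY := spectral_pair_span H.
have TNs := time_setN Ts.
have Vs := Vf Ts; have VNs := Vf TNs; have Vt := Vf Tt.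
have Vss := gspaceD GV Vs VNs.
rewrite (ipDr GV (gspaceZ GV _ Vss) VY Vt) (ipZr GV _ Vss Vt) (ipDr GV Vs VNs Vt).
rewrite !ip_process// IH /r.
under [RHS]eq_Rintegral do rewrite mulrDl.
rewrite [RHS]RintegralD//; last 2 first.
- apply: (@spectral_integrable _ (`|c| * 1 * 1)).
    by apply: measurable_funM => //; exact: measurable_funM.
  by move=> l; rewrite !normrM !ler_pM// mulr_ge0.
- exact: (integrable_mul mw (mcos t) wC (fun l => cosb _)).
congr (_ + _); rewrite -(@RintegralD _ _ _ rho D _ _ mD (icos (s - t)) (icos (- s - t))).
have iS : rho.-integrable D (EFin \o (fun l => cos (l * (s - t)) + cos (l * (- s - t)))).
  exact: (@integrableD _ _ _ rho D mD _ _ (icos (s - t)) (icos (- s - t))).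
rewrite -(@RintegralZl _ _ _ rho D _ _ mD iS); apply: eq_Rintegral => l _.
rewrite (_ : l * (s - t) = l * s - l * t); last by ring.
rewrite (_ : l * (- s - t) = - (l * s + l * t)); last by ring.
by rewrite cosN cosB cosD; field.
Qed.

Lemma ip_spectral_pairs w Y w' Y' : spectral_pair w Y -> spectral_pair w' Y' ->
  ip P Y' Y = \int[rho]_(l in D) (w' l * w l).
Proof.
move=> H H'; have VY := spectral_pair_span H.
have [mw [C wC]] := spectral_pair_bounded H.
elim: H' => [|c s {}w' {}Y' Ts H' IH].
  rewrite /ip; under eq_Rintegral do rewrite mul0r.
  rewrite Rintegral_prob_cst; under eq_Rintegral do rewrite mul0r.
  by rewrite Rintegral_cst// mul0r.
have [mw' [C' wC']] := spectral_pair_bounded H'.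
have VY' := spectral_pair_span H'.
have TNs := time_setN Ts.
have Vs := Vf Ts; have VNs := Vf TNs.
have Vss := gspaceD GV Vs VNs.
rewrite (ipDl GV (gspaceZ GV _ Vss) VY' VY) (ipZl GV _ Vss VY) (ipDl GV Vs VNs VY).
rewrite !(ip_spectral_pair H)// IH.
under [RHS]eq_Rintegral do rewrite mulrDl.
rewrite [RHS]RintegralD//; last 2 first.
- apply: (@spectral_integrable _ (`|c| * 1 * C)).
    by apply: measurable_funM => //; exact: measurable_funM.
  by move=> l; rewrite !normrM !ler_pM// mulr_ge0.
- exact: (integrable_mul mw' mw wC' wC).
have iwc u : rho.-integrable D (EFin \o (fun l => w l * cos (l * u))).
  exact: (integrable_mul mw (mcos u) wC (fun l => cosb _)).
congr (_ + _); rewrite -(@RintegralD _ _ _ rho D _ _ mD (iwc s) (iwc (- s))).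
have iS : rho.-integrable D (EFin \o (fun l => w l * cos (l * s) + w l * cos (l * - s))).
  exact: (@integrableD _ _ _ rho D mD _ _ (iwc s) (iwc (- s))).
rewrite -(@RintegralZl _ _ _ rho D _ _ mD iS); apply: eq_Rintegral => l _.
by rewrite mulrN cosN; field.
Qed.

End process.

(** * Shifting along one Gaussian direction *)

Section gaussian_shift.
Context (R : realType) (d : measure_display) (Omega : measurableType d)
  (P : probability Omega R) (V : set (Omega -> R)).
Hypothesis GV : gaussian_space P V.
Variable Y : Omega -> R.
Hypothesis VY : V Y.
Hypothesis v_gt0 : 0 < ip P Y Y.
Local Notation v := (ip P Y Y).

Definition residual (X : Omega -> R) om := X om - ip P X Y / v * Y om.

Lemma residual_span X : V X -> V (residual X).
Proof. by move=> VX; apply: (gspaceB GV VX); exact: (gspaceZ GV). Qed.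

Lemma residualE X : residual X = fun om => X om + (- (ip P X Y / v)) * Y om.
Proof. by apply/funext => om; rewrite /residual mulNr. Qed.

Lemma ip_residual X : V X -> ip P (residual X) Y = 0.
Proof.
move=> VX; rewrite residualE (ipDl GV VX (gspaceZ GV _ VY) VY) (ipZl GV _ VY VY).
by field; rewrite gt_eqF.
Qed.

(** Pythagoras; thanks to it the variance bounds for values and increments of the process carry over
    to residuals. *)
Lemma ip_residual_le X : V X -> ip P (residual X) (residual X) <= ip P X X.
Proof.
move=> VX; have VR := residual_span VX; have VcY c := gspaceZ GV c VY.
rewrite {2}residualE (ipDr GV VX (VcY _) VR) (ipZr GV _ VY VR) (ip_residual VX) mulr0 addr0.
rewrite residualE (ipDl GV VX (VcY _) VX) (ipZl GV _ VY VX) (ipC _ Y X).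
rewrite gerDl mulNr oppr_le0 mulrAC -expr2.
by rewrite divr_ge0 ?sqr_ge0// ltW.
Qed.

Lemma residualB X X' : V X -> V X' ->
  residual (fun om => X om - X' om) = fun om => residual X om - residual X' om.
Proof.
move=> VX VX'; apply/funext => om; rewrite /residual.
have -> : ip P (fun om => X om - X' om) Y = ip P X Y - ip P X' Y.
  have := ipDl GV VX (gspaceZ GV (-1) VX') VY.
  rewrite (ipZl GV _ VX' VY) mulN1r => <-.
  by congr ip; apply/funext => o; rewrite mulN1r.
by field; rewrite gt_eqF.
Qed.

(* On the event [v / 2 < Y], with all residuals below [2 L], each [F i] exceeds
   [- 2 L + 6 L / 2]; the residuals are independent of [Y]. *)
Lemma gaussian_shift (I : finType) (F : I -> Omega -> R) (L : R) : 0 < L ->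
  (forall i, V (F i)) -> (forall i, 6 * L <= ip P (F i) Y) ->
  (P [set om | forall i, `|residual (F i) om| < L]%R * (expR (- v - 3))%:E <=
   P [set om | forall i, L <= F i om]%R)%E.
Proof.
move=> L0 VF FL.
have Vg i : V (residual (F i)) by exact: residual_span.
have [s Hs sE] := gspace_std GV VY.
have s0 : 0 < s.
  rewrite lt_def (gstd_ge0 Hs) andbT; apply: contraTneq v_gt0 => s0.
  by rewrite -sE s0 expr0n /= ltxx.
have mg i := gspace_meas GV (Vg i); have mY := gspace_meas GV VY.
have mF i := gspace_meas GV (VF i).
have h2 : L < 2 * L by lra.
have h3 : 0 <= s / 2 by lra.
have h4 : s / 2 < s / 2 + v / 2 by rewrite ltrDl divr_gt0.
(* The closed interval of centre [v + s / 2] and radius [s / 2] contains the window of [gstd_tail];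
   enlarging the radius by [v / 2] still keeps [Y] above [v / 2]. *)
have H := @gspace_indep R d Omega P V GV I (fun i => residual (F i)) Y (fun=> L) (fun=> 2 * L)
  (v + s / 2) (s / 2) (s / 2 + v / 2) Vg VY (fun i => ip_residual (VF i))
  (fun=> ltW L0) (fun=> h2) h3 h4.
have ml i : measurable [set om | `|residual (F i) om| < L].
  by have := measurable_dist_lt 0 L (mg i); under eq_set do rewrite subr0.
have mle i : measurable [set om | `|residual (F i) om| <= L].
  by have := measurable_dist_le 0 L (mg i); under eq_set do rewrite subr0.
have ml2 i : measurable [set om | `|residual (F i) om| < 2 * L].
  by have := measurable_dist_lt 0 (2 * L) (mg i); under eq_set do rewrite subr0.
apply: (le_trans _ (le_trans H _)).
  apply: lee_pmul => //.
  - apply: le_measure; rewrite ?inE; [exact: measurable_forall|exact: measurable_forall|].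
    by move=> om /= Ho i; exact: ltW.
  - rewrite -sE; apply: (le_trans (gstd_tail Hs s0)).
    apply: le_measure; rewrite ?inE; last first.
    + move=> om /= /andP[ho1 ho2]; rewrite ler_norml; apply/andP; split; lra.
    + exact: measurable_dist_le.
    + rewrite (_ : [set om | _] = [set om | s ^+ 2 < Y om] `&` [set om | Y om < s ^+ 2 + s]).
        by apply: measurableI; apply: measurable_predT; exact: measurable_fun_ltr.
      by apply/seteqP; split => om /=; [move=> /andP|move=> [-> ->]].
apply: le_measure; rewrite ?inE.
- by apply: measurableI; [exact: measurable_forall|exact: measurable_dist_lt].
- by apply: measurable_forall => i; apply: measurable_predT; exact: measurable_fun_ler.
move=> om /= [Hg HY] i.
have := Hg i; have := FL i; rewrite /residual ltr_norml => Fi /andP[gi _].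
have Yv : v / 2 < Y om by move: HY; rewrite ltr_norml => /andP[]; lra.
have : ip P (F i) Y / v * (v / 2) <= ip P (F i) Y / v * Y om.
  by rewrite ler_wpM2l ?(ltW Yv)// divr_ge0 ?(ltW v_gt0)//; lra.
have -> : ip P (F i) Y / v * (v / 2) = ip P (F i) Y / 2 by field; rewrite gt_eqF.
lra.
Qed.

End gaussian_shift.

(** * A direction positively correlated with the whole time interval *)

Section direction.
Context (R : realType) (T : time) (d : measure_display) (Omega : measurableType d)
  (P : probability Omega R) (f : R -> {RV P >-> R})
  (rho : {finite_measure set (measurableTypeR R) -> \bar R}).
Hypothesis Gf : gsp T f.
Hypothesis Sf : spectral_measure T f rho.
Hypothesis m0 : moment T rho 0 = 1%E.
Local Notation D := (@dual_set R T).
Let mD := @measurable_dual_set R T.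

Lemma spectral_mass : rho D = 1%E.
Proof.
rewrite -m0 /moment; under eq_integral do rewrite powRr0.
by rewrite integral_cst ?mul1e.
Qed.

Lemma spectral_null : rho (~` D) = 0%E. Proof. by case: Sf. Qed.

Let Rintegral_D_indic (A : set R) : measurable A ->
  \int[rho]_(l in D) (\1_A l) = fine (rho (A `&` D)).
Proof. by move=> mA; rewrite /Rintegral integral_indic. Qed.

Let int01 (h : R -> R) C : measurable_fun setT h -> (forall l, `|h l| <= C) ->
  rho.-integrable D (EFin \o h).
Proof. by move=> mh hC; exact: spectral_integrable hC. Qed.

(** The window lets in an uncontrolled amount of mass between [1 / N] and [5 / (4 N)], so variance
    and covariances are both compared with the same number [S], the integral of the window over
    [|l| <= 5 / (4 N)]. Only a lower bound of [S] by [sigma_N^2] is needed. *)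
Lemma spectral_direction (N : R) : 1 <= N -> (0 < sigma2 rho N)%E ->
  exists Y : Omega -> R, exists S : R,
  [/\ time_span T f Y, 2 * S >= fine (sigma2 rho N),
   forall t, time_set T t -> `|t| <= N -> S / 8 <= ip P (f t) Y,
   ip P Y Y <= 2 * S & 0 < ip P Y Y].
Proof.
move=> N1 sg0.
have N0 : 0 < N by lra.
have NV0 : 0 < N^-1 by rewrite invr_gt0.
set sg := fine _.
pose A : set R := [set l | `|l| <= N^-1].
pose C : set R := [set l | `|l| <= 5 / 4 / N].
have mnorm : measurable_fun setT (fun l : R => `|l|) by exact: normr_measurable.
have mA : measurable A by apply: measurable_predT; exact: measurable_fun_ler.
have mC : measurable C by apply: measurable_predT; exact: measurable_fun_ler.
have fin (B : set R) : measurable B -> rho B \is a fin_num by move=> mB; exact: fin_num_measure.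
have mono (B B' : set R) : measurable B -> measurable B' -> B `<=` B' -> fine (rho B) <= fine (rho B').
  by move=> mB mB' BB'; rewrite fine_le ?fin// le_measure// inE.
have sgE : sigma2 rho N = sg%:E by rewrite fineK// /sigma2 fin.
have sgA : sg <= fine (rho (A `&` D)).
  apply: mono; [exact: measurable_itv|exact: measurableI|].
  move=> l /=; rewrite in_itv /= => /andP[l0 lN]; split.
    by rewrite /A /= ger0_norm.
  have : N^-1 <= 1 by rewrite invf_le1.
  by case: (T) => //= h; rewrite in_itv /=; have := @pi_ge2 R; lra.
have sg1 : sg <= 1.
  apply: (le_trans sgA); have <- : fine (rho D) = 1 by rewrite spectral_mass.
  by apply: mono => //; exact: measurableI.
have sg_gt0 : 0 < sg by rewrite -lte_fin -sgE.
(* The total error is at most [2 e = sg / 32], and [S >= (1 - e) sg]; hence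
   [7 / 32 * S - sg / 32 >= S / 8] and [S + sg / 32 <= 2 S]. *)
pose e := sg / 64.
have e0 : 0 < e by rewrite /e; lra.
have e1 : e <= 1 / 64 by rewrite /e; lra.
have [w [M [sw w01 tail wA wC]]] := spectral_window N1 e0 spectral_null.
have [Y HY] := cos_span_spectral_pair f sw.
have [mw _] := spectral_pair_bounded HY.
have VY := spectral_pair_span Gf HY.
pose B : set R := [set l | M < `|l|].
have mB : measurable B by apply: measurable_predT; exact: measurable_fun_ltr.
have i0 (E : set R) l : 0 <= (\1_E l : R) <= 1 by rewrite indicE; case: (_ \in _); rewrite ?lexx ler01.
have mi (E : set R) : measurable E -> measurable_fun setT (\1_E : R -> R) by exact: measurable_indic.
pose wC' l := w l * \1_C l.
have mwC : measurable_fun setT wC' by apply: measurable_funM => //; exact: mi.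
have iwC : rho.-integrable D (EFin \o wC').
  apply: (int01 (C := 1)) => // l; rewrite /wC'; have /andP[? ?] := w01 l; have /andP[? ?] := i0 C l.
  by rewrite ger0_norm ?mulr_ge0// mulr_ile1.
pose err l := \1_B l + e.
have merr : measurable_fun setT err by apply: measurable_funD => //; exact: mi.
have iB : rho.-integrable D (EFin \o (\1_B : R -> R)).
  by apply: (int01 (C := 1)) => [|l]; [exact: mi|have /andP[? ?] := i0 B l; rewrite ger0_norm].
have ie : rho.-integrable D (EFin \o cst e) by exact: finite_measure_integrable_cst.
have ierr : rho.-integrable D (EFin \o err) by exact: (@integrableD _ _ _ rho D mD _ _ iB ie).
have rD : fine (rho D) = 1 by rewrite spectral_mass.
have Ie : \int[rho]_(l in D) (cst e l) = e.
  by rewrite Rintegral_cst// -[RHS]mulr1; congr (_ * _); exact: rD.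
have int_err : \int[rho]_(l in D) err l <= 2 * e.
  rewrite /err (@RintegralD _ _ _ rho D _ _ mD iB ie) Rintegral_D_indic//.
  rewrite Ie mulr2n mulrDl mul1r lerD2r.
  apply: (@le_trans _ _ (fine (rho B))); first by apply: mono => //; exact: measurableI.
  by rewrite -lee_fin fineK// fin.
pose S := \int[rho]_(l in D) wC' l.
have iA : rho.-integrable D (EFin \o (\1_A : R -> R)).
  by apply: (int01 (C := 1)) => [|l]; [exact: mi|have /andP[? ?] := i0 A l; rewrite ger0_norm].
have SA : (1 - e) * sg <= S.
  apply: (@le_trans _ _ (\int[rho]_(l in D) ((1 - e) * \1_A l))).
    rewrite RintegralZl// Rintegral_D_indic// ler_wpM2l//; lra.
  apply: le_Rintegral => //; first exact: (@integrableZl _ _ _ rho D mD (1 - e) _ iA).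
  move=> l _; rewrite /wC' indicE; case: (boolP (l \in A)) => [|_]; last first.
    by rewrite mulr0; have /andP[? ?] := w01 l; have /andP[? ?] := i0 C l; rewrite mulr_ge0.
  rewrite inE /A /= => lA; rewrite mulr1 indicE mem_set; first by rewrite mulr1; exact: wA.
  by rewrite /C /= (le_trans lA)// ler_peMl ?(ltW NV0)//; lra.
have S0 : 0 < S by apply: lt_le_trans SA; rewrite mulr_gt0//; lra.
have w_le l : w l <= wC' l + err l.
  have /andP[w0 w1] := w01 l; have /andP[iB0 iB1] := i0 B l.
  rewrite /wC' /err; have [lC|lC] := boolP (l \in C).
    have -> : \1_C l = 1 :> R by rewrite indicE lC.
    by rewrite mulr1; lra.
  have -> : \1_C l = 0 :> R by rewrite indicE (negbTE lC).
  rewrite mulr0 add0r; move: lC; rewrite notin_setE /C /= => /negP; rewrite -ltNge => lC.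
  have [lM|lM] := leP `|l| M; first by have := wC l lC lM; lra.
  have -> : \1_B l = 1 :> R by rewrite indicE mem_set.
  by lra.
have iww : rho.-integrable D (EFin \o (fun l => w l * w l)).
  apply: (int01 (C := 1)); first exact: measurable_funM.
  by move=> l; have /andP[? ?] := w01 l; rewrite ger0_norm ?mulr_ge0// mulr_ile1.
exists Y, S; split => //.
- by apply: le_trans (_ : 2 * ((1 - e) * sg) <= _); [nra|lra].
- move=> t Tt tN; rewrite (ip_spectral_pair Gf Sf HY Tt).
  apply: (@le_trans _ _ (\int[rho]_(l in D) (7 / 32 * wC' l - err l))).
    have i7 : rho.-integrable D (EFin \o (fun l => 7 / 32 * wC' l)).
      exact: (@integrableZl _ _ _ rho D mD (7 / 32) _ iwC).
    rewrite (@RintegralB _ _ _ rho D _ _ mD i7 ierr) (@RintegralZl _ _ _ rho D _ _ mD iwC) -/S.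
    by move: int_err SA; rewrite /e; nra.
  apply: le_Rintegral => //.
  + rewrite (_ : _ \o _ = (fun l => (7 / 32)%:E * (EFin \o wC') l) \- (EFin \o err))%E; last first.
      by apply/funext => l /=; rewrite EFinB EFinM.
    apply: (@integrableB _ _ _ rho D mD) => //.
    exact: (@integrableZl _ _ _ rho D mD (7 / 32) _ iwC).
  + apply: (int01 (C := 1)).
      apply: measurable_funM => //.
      apply: (measurableT_comp (f := @cos R)); first exact: measurable_cosR.
      exact: measurable_funM.
    move=> l; rewrite normrM mulr_ile1//.
      by have /andP[? ?] := w01 l; rewrite ger0_norm.
    by rewrite ler_norml cos_geN1 cos_le1.
  + move=> l _; have /andP[w0 w1] := w01 l; have := w_le l.
    have c1 := cos_geN1 (l * t).
    have c3 := cos_le1 (l * t).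
    rewrite /wC'; have [lC|lC] := boolP (l \in C); last first.
      have -> : \1_C l = 0 :> R by rewrite indicE (negbTE lC).
      by rewrite !mulr0 add0r sub0r => H; nra.
    have -> : \1_C l = 1 :> R by rewrite indicE lC.
    move: lC; rewrite inE /C /= mulr1 => lC _.
    have lt1 : `|l * t| <= 5 / 4.
      rewrite normrM (le_trans (ler_pM _ _ lC tN))// divfK// gt_eqF//.
    (* [7 / 32] is [1 - (5 / 4)^2 / 2]. *)
    have c2 : 7 / 32 <= cos (l * t).
      have := one_sub_cos_le (l * t); rewrite -real_normK ?num_real//.
      have := normr_ge0 (l * t); move: lt1; move: (`|_|) => y; nra.
    have err0 : 0 <= err l by rewrite /err; have /andP[? ?] := i0 B l; lra.
    by nra.
- rewrite (ip_spectral_pairs Gf Sf HY HY).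
  apply: (@le_trans _ _ (\int[rho]_(l in D) (wC' l + err l))).
    apply: le_Rintegral => //; first exact: (@integrableD _ _ _ rho D mD _ _ iwC ierr).
    by move=> l _; have := w_le l; have /andP[? ?] := w01 l; nra.
  rewrite (@RintegralD _ _ _ rho D _ _ mD iwC ierr) -/S.
  by move: int_err SA; rewrite /e; nra.
- rewrite (ip_spectral_pairs Gf Sf HY HY).
  apply: (@lt_le_trans _ _ ((1 - e) ^+ 2 * sg)); first by rewrite mulr_gt0// exprn_gt0//; lra.
  apply: (@le_trans _ _ (\int[rho]_(l in D) ((1 - e) ^+ 2 * \1_A l))).
    by rewrite RintegralZl// Rintegral_D_indic// ler_wpM2l// sqr_ge0.
  apply: le_Rintegral => //; first exact: (@integrableZl _ _ _ rho D mD ((1 - e) ^+ 2) _ iA).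
  move=> l _; have /andP[w0 w1] := w01 l; have [lA|lA] := boolP (l \in A); last first.
    have -> : \1_A l = 0 :> R by rewrite indicE (negbTE lA).
    by rewrite mulr0 mulr_ge0.
  have -> : \1_A l = 1 :> R by rewrite indicE lA.
  by move: lA; rewrite inE /A /= mulr1 expr2 => /wA H; nra.
Qed.

End direction.

(** * Variance of increments under the moment condition *)

Section increments.
Context (R : realType) (T : time) (d : measure_display) (Omega : measurableType d)
  (P : probability Omega R) (f : R -> {RV P >-> R})
  (rho : {finite_measure set (measurableTypeR R) -> \bar R}).
Hypothesis Gf : gsp T f.
Hypothesis Sf : spectral_measure T f rho.
Hypothesis m0 : moment T rho 0 = 1%E.
Local Notation D := (@dual_set R T).
Let mD := @measurable_dual_set R T.
Let GV := time_span_gaussian Gf.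

Let mcos t : measurable_fun setT (fun l : R => cos (l * t)).
Proof.
apply: (measurableT_comp (f := @cos R)); first exact: measurable_cosR.
exact: measurable_funM.
Qed.

Let icos t : rho.-integrable D (EFin \o (fun l => cos (l * t))).
Proof.
apply: (@spectral_integrable _ _ _ _ 1) => // l.
by rewrite ler_norml cos_geN1 cos_le1.
Qed.

Let i1 : rho.-integrable D (EFin \o cst 1).
Proof. exact: finite_measure_integrable_cst. Qed.

Let int1 : \int[rho]_(l in D) (cst 1 l) = 1.
Proof.
rewrite Rintegral_cst// mul1r.
exact: (congr1 fine (spectral_mass m0)).
Qed.

Lemma ip_process_id t : time_set T t -> ip P (f t) (f t) = 1.
Proof.
move=> Tt; rewrite (ip_process Gf Sf Tt Tt) subrr -[RHS]int1.
by apply: eq_Rintegral => l _; rewrite mulr0 cos0.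
Qed.

(** The variance is twice the integral of [1 - cos (l * h)], at most [2 |h|^delta' |l|^delta'], and
    [|l|^delta' <= 1 + |l|^delta]. *)
Lemma ip_increment (delta delta' m a b : R) : 0 < delta -> 0 < delta' -> delta' <= delta ->
  delta' <= 1 -> moment T rho delta = m%:E -> time_set T a -> time_set T b ->
  ip P (fun om => f b om - f a om) (fun om => f b om - f a om) <=
  4 * (1 + m) * `|b - a| `^ delta'.
Proof.
move=> d0 d0' dd d1 mm Ta Tb.
have Va := time_span_f f Ta; have Vb := time_span_f f Tb.
pose h := b - a.
have -> : (fun om => f b om - f a om) = (fun om => f b om + (-1) * f a om).
  by apply/funext => om; rewrite mulN1r.
have VN := gspaceZ GV (-1) Va; have VS := gspaceD GV Vb VN.
rewrite (ipDl GV Vb VN VS) !(ipDr GV)// (ipZl GV _ Va Vb) (ipZr GV _ Va Vb) (ipZl GV _ Va VN) (ipZr GV _ Va Va).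
rewrite (ipC _ (f b) (f a)) !ip_process_id// (ip_process Gf Sf Ta Tb) -/h.
pose q (l : R) := `|l| `^ delta.
have mq : measurable_fun setT q.
  exact: (measurableT_comp (measurable_powR delta) (@normr_measurable R setT)).
have iq : rho.-integrable D (EFin \o q).
  apply/integrableP; split; first by apply/measurable_EFinP; exact: measurable_funTS.
  under eq_integral do rewrite /= (ger0_norm (powR_ge0 _ _)).
  by rewrite -/(moment T rho delta) mm ltry.
have intq : \int[rho]_(l in D) q l = m by rewrite /Rintegral -/(moment T rho delta) mm.
have i1q : rho.-integrable D (EFin \o (fun l => cst 1 l + q l)).
  exact: (@integrableD _ _ _ rho D mD _ _ i1 iq).
have i1c : rho.-integrable D (EFin \o (fun l => cst 1 l - cos (l * h))).
  exact: (@integrableB _ _ _ rho D mD _ _ i1 (icos h)).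
have H : \int[rho]_(l in D) (cst 1 l - cos (l * h)) <=
    \int[rho]_(l in D) (2 * `|h| `^ delta' * (cst 1 l + q l)).
  apply: le_Rintegral => //.
    exact: (@integrableZl _ _ _ rho D mD (2 * `|h| `^ delta') _ i1q).
  move=> l _ /=; apply: (le_trans (one_sub_cos_powR_le _ d0' d1)).
  have -> : `|l * h| `^ delta' = `|h| `^ delta' * `|l| `^ delta' by rewrite normrM powRM// mulrC.
  rewrite mulrA ler_wpM2l ?mulr_ge0 ?powR_ge0//.
  rewrite /q; have [l1|l1] := leP `|l| 1.
    apply: (@le_trans _ _ 1); last by rewrite lerDl powR_ge0.
    apply: (@le_trans _ _ (1 `^ delta')); last by rewrite powR1.
    by apply: ge0_ler_powR; rewrite ?nnegrE// ltW.
  by rewrite ler_wpDl// ler_powR// ltW.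
move: H; rewrite (@RintegralB _ _ _ rho D _ _ mD i1 (icos h)) int1.
rewrite (@RintegralZl _ _ _ rho D _ _ mD i1q) (@RintegralD _ _ _ rho D _ _ mD i1 iq) int1 intq.
lra.
Qed.

End increments.

(** * From dyadic grids to the persistence event *)

Section persistence_lower.
Context (R : realType) (T : time) (d : measure_display) (Omega : measurableType d)
  (P : probability Omega R) (f : R -> {RV P >-> R}).
Hypothesis Gf : gsp T f.

(** Over the integers, level 0 is the only one whose grid stays in the time set, and it already
    fills it; over the reals every level is allowed. *)
Definition admissible_level (n : nat) := T = IntegerTime -> n = 0%N.

Lemma admissible_time n (m j : nat) : admissible_level n -> (m <= n)%N ->
  time_set T (j%:R / 2 ^+ m : R).
Proof.
rewrite /admissible_level; case: T => //= /(_ erefl) ->; rewrite leqn0 => /eqP ->.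
by exists j%:Z => //; rewrite expr0 divr1.
Qed.

Let mf t c : measurable [set om | c <= f t om].
Proof. by apply: measurable_predT; apply: measurable_fun_ler. Qed.

(** The persistence event need not be measurable, but [persistence] is an outer measure, hence
    monotone on arbitrary sets. *)
Let outer_le (E : set Omega) (N : R) : measurable E -> E `<=` persistence_event T f N ->
  (P E <= persistence T f N)%E.
Proof.
move=> mE EN; rewrite /persistence /completed_measure_extension.
by rewrite -(measurable_mu_extE P mE); exact: le_outer_measure.
Qed.

(** A level [L > 0] is kept instead of mere positivity because [L <= f] is a closed condition: it
    passes from the dyadic points to their limits along continuous paths. As the grids are nested, a
    bound uniform in [n] passes to the intersection. *)
Lemma persistence_ge_grid (N : nat) (L p : R) : 0 < L ->
  (forall n, admissible_level n ->
    (p%:E <= P [set om | forall j : 'I_(N * 2 ^ n).+1, L <= f (j%:R / 2 ^+ n) om]%R)%E) ->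
  (p%:E <= persistence T f N%:R)%E.
Proof.
move=> L0 H.
pose E n := [set om | forall j : 'I_(N * 2 ^ n).+1, L <= f (j%:R / 2 ^+ n) om].
have mE n : measurable (E n) by apply: measurable_forall => j; exact: mf.
case TE : T.
  have ok : admissible_level 0 by [].
  apply: (le_trans (H 0%N ok)); rewrite -TE; apply: outer_le; first exact: (mE 0%N).
  move=> om /= Hom t; rewrite TE => -[k _ <-] /andP[k0 kN].
  move: k0 kN; case: k => // k; rewrite ?ltr0z // => _.
  rewrite -pmulrn ler_nat => kN.
  have jN : (k < (N * 2 ^ 0).+1)%N by rewrite expn0 muln1.
  have := Hom (Ordinal jN); rewrite expr0 divr1 /=; exact: lt_le_trans.
have ok n : admissible_level n by move=> /=; rewrite TE.
have Edecr : nonincreasing_seq E.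
  apply/nonincreasing_seqP => n; apply/subsetPset => om /= Hom j.
  have jn : (j.*2 < (N * 2 ^ n.+1).+1)%N.
    by have := ltn_ord j; rewrite !ltnS expnS; lia.
  have := Hom (Ordinal jn); rewrite /= -mul2n natrM exprS -mulf_div divff ?mul1r//.
have : P \o E @ \oo --> P (\bigcap_n E n).
  apply: nonincreasing_cvg_mu => //.
  - by rewrite (le_lt_trans (probability_le1 _ (mE 0%N))) ?ltry.
  - exact: bigcapT_measurable.
move=> cvgE.
have pE : (p%:E <= P (\bigcap_n E n))%E.
  rewrite -(cvg_lim _ cvgE)//; apply: lime_ge; first by apply/cvg_ex; eexists; exact: cvgE.
  by apply: nearW => n; exact: H.
have [_ _ [A [mA PA0 Acont]] _] := Gf.
have mI : measurable (\bigcap_n E n) by exact: bigcapT_measurable.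
apply: (le_trans pE).
have -> : P (\bigcap_n E n) = P ((\bigcap_n E n) `\` A).
  rewrite (measureDI P mI mA) [X in (_ + X)%E](_ : _ = 0%E) ?adde0//.
  by apply: (subset_measure0 _ _ _ PA0) => //; exact: measurableI.
rewrite -TE; apply: outer_le; first exact: measurableD.
move=> om [Eom Aom] t _ /andP[t0 tN].
have tle (x : R) : 0 <= x -> (Num.truncn x)%:R <= x by rewrite truncn_le.
have cf : continuous (fun t => f t om).
  have : {within @time_set R T, continuous (fun t => f t om)}.
    by apply: contrapT => nc; apply: Aom; apply: Acont.
  by rewrite TE => h x; have := h x; rewrite /prop_for /continuous_at nbhs_subspaceT.
apply: (lt_le_trans L0).
pose u (n : nat) : R := (Num.truncn (t * 2 ^+ n))%:R / 2 ^+ n.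
have u_cvg : u n @[n --> \oo] --> t.
  have ut n : t - (1 / 2) ^+ n <= u n <= t.
    have p0 : 0 < 2 ^+ n :> R by rewrite exprn_gt0.
    have x0 : 0 <= t * 2 ^+ n by rewrite mulr_ge0 ?(ltW t0) ?(ltW p0).
    have := tle _ x0; have := truncnS_gt (t * 2 ^+ n); rewrite -natr1 => h1 h2.
    rewrite /u ler_pdivrMr// h2 andbT ler_pdivlMr// mulrBl expr_div_n expr1n divfK ?gt_eqF//.
    lra.
  apply: (@squeeze_cvgr _ _ _ _ (fun n => t - (1 / 2) ^+ n) (cst t)).
  - exact: nearW.
  - rewrite -[X in _ --> X]subr0; apply: cvgB; first exact: cvg_cst.
    by apply: cvg_expr; rewrite ger0_norm; lra.
  - exact: cvg_cst.
have fu : f (u n) om @[n --> \oo] --> f t om by exact: (cvg_comp _ _ u_cvg (cf t)).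
rewrite -(cvg_lim _ fu)//; apply: limr_ge; first by apply/cvg_ex; eexists; exact: fu.
apply: nearW => n.
have kn : (Num.truncn (t * 2 ^+ n) < (N * 2 ^ n).+1)%N.
  rewrite ltnS -(ler_nat R) natrM natrX.
  have p0 : 0 < 2 ^+ n :> R by rewrite exprn_gt0.
  have x0 : 0 <= t * 2 ^+ n by rewrite mulr_ge0 ?(ltW t0) ?(ltW p0).
  by apply: (le_trans (tle _ x0)); rewrite ler_pM2r.
exact: (Eom n I (Ordinal kn)).
Qed.

End persistence_lower.

(** * Persistence bounds *)

Lemma powR_exprnV (R : realType) (x a : R) (p : nat) : 0 <= x ->
  (x ^+ p)^-1 `^ a = (x `^ (- a)) ^+ p.
Proof.
move=> x0; rewrite -powR_invn// -(powR_mulrn p (powR_ge0 x (- a))).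
by rewrite -powRrM -powRrM mulNr mulNr mulrC.
Qed.

Section lower_bounds.
Context (R : realType) (T : time) (d : measure_display) (Omega : measurableType d)
  (P : probability Omega R) (f : R -> {RV P >-> R})
  (rho : {finite_measure set (measurableTypeR R) -> \bar R}).
Hypothesis Gf : gsp T f.
Hypothesis Sf : spectral_measure T f rho.
Hypothesis m0 : moment T rho 0 = 1%E.
Let GV := time_span_gaussian Gf.

(** The ball bound is assumed for every direction, since the one used depends on [rho], [N] and
    [L]. *)
Lemma persistence_small_ball (N : nat) (L q : R) : (0 < N)%N -> 0 < L -> 0 <= q ->
  (0 < sigma2 rho N%:R)%E ->
  (forall n Y, admissible_level T n -> time_span T f Y -> 0 < ip P Y Y ->
    (q%:E <= P [set om | forall j : nat, (j < N.+1 * 2 ^ n)%N ->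
      `|residual P Y (f (j%:R / 2 ^+ n)) om| < L]%R)%E) ->
  ((q * expR (- ((96 * L) ^+ 2 / fine (sigma2 rho N%:R)) - 3))%:E <= persistence T f N%:R)%E.
Proof.
move=> N0 L0 q0 sg0 Hq.
have N1 : 1 <= N%:R :> R by rewrite ler1n.
have [Y0 [S [VY0 Ssg hY0 vY0 Y0_gt0]]] := spectral_direction Gf Sf m0 N1 sg0.
set sg := fine _ in Ssg *.
have sg_gt0 : 0 < sg by rewrite fine_gt0// sg0 /= ltey_eq fin_num_measure.
have S0 : 0 < S by lra.
(* Scaled so that the covariances, at least [k S / 8], reach the [6 L] required by the shift. The
   variance is then at most [2 (48 L)^2 / S], and [S >= sg / 2] turns this into [(96 L)^2 / sg]. *)
pose k := 48 * L / S.
have k0 : 0 < k by rewrite /k divr_gt0// mulr_gt0.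
pose Y om := k * Y0 om.
have VY : time_span T f Y by exact: (gspaceZ GV k VY0).
have vE : ip P Y Y = k ^+ 2 * ip P Y0 Y0.
  by rewrite /Y (ipZl GV _ VY0 VY) (ipZr GV _ VY0 VY0) mulrA -expr2.
have v0 : 0 < ip P Y Y by rewrite vE mulr_gt0// exprn_gt0.
have v_le : ip P Y Y <= (96 * L) ^+ 2 / sg.
  have -> : 96 * L = 2 * (48 * L) by ring.
  rewrite vE /k; set u := 48 * L.
  apply: (@le_trans _ _ ((u / S) ^+ 2 * (2 * S))); first by rewrite ler_wpM2l ?sqr_ge0.
  have -> : (u / S) ^+ 2 * (2 * S) = 2 * u ^+ 2 * S^-1 by field; rewrite gt_eqF.
  have -> : (2 * u) ^+ 2 / sg = 2 * u ^+ 2 * (sg / 2)^-1 by field; rewrite gt_eqF.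
  have sgS : sg / 2 <= S by lra.
  have u0 : 0 <= 2 * u ^+ 2 by rewrite mulr_ge0 ?sqr_ge0.
  by apply: ler_wpM2l => //; rewrite lef_pV2 ?posrE// divr_gt0.
apply: (persistence_ge_grid Gf L0) => n ok.
pose F (j : 'I_(N * 2 ^ n).+1) := f (j%:R / 2 ^+ n) : Omega -> R.
have Tj (j : nat) : time_set T (j%:R / 2 ^+ n : R) by exact: (@admissible_time R T n n j ok (leqnn n)).
have VF j : time_span T f (F j) by exact: time_span_f.
have FL j : 6 * L <= ip P (F j) Y.
  rewrite /Y (ipZr GV _ VY0 (VF j)).
  have -> : 6 * L = k * (S / 8) by rewrite /k; field; rewrite gt_eqF.
  rewrite ler_pM2l//; apply: hY0; first exact: Tj.
  rewrite ger0_norm; last by rewrite divr_ge0 ?exprn_ge0.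
  rewrite ler_pdivrMr ?exprn_gt0// -natrX -natrM ler_nat.
  by have := ltn_ord j; rewrite ltnS.
apply: le_trans (gaussian_shift GV VY v0 L0 VF FL).
rewrite EFinM; apply: lee_pmul.
- by rewrite lee_fin.
- by rewrite lee_fin expR_ge0.
- apply: (le_trans (Hq n Y ok VY v0)).
  have mr t : time_set T t -> measurable [set om | `|residual P Y (f t) om| < L].
    move=> Tt; have := gspace_meas GV (residual_span GV VY (time_span_f f Tt)).
    by move/(measurable_dist_lt 0 L); under eq_set do rewrite subr0.
  apply: le_measure; rewrite ?inE.
  + rewrite (_ : [set om | _] = [set om | forall j : 'I_(N.+1 * 2 ^ n),
        `|residual P Y (f (j%:R / 2 ^+ n)) om| < L]).
      by apply: measurable_forall => j; apply: mr; exact: Tj.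
    apply/seteqP; split => om /= H j; first exact: H.
    by move=> jn; exact: (H (Ordinal jn)).
  + by apply: measurable_forall => j; apply: mr; exact: Tj.
  + move=> om /= H j; apply: H; apply: leq_trans (ltn_ord j) _.
    by rewrite mulSn -add1n leq_add2r expn_gt0.
- by rewrite lee_fin ler_expR lerD2r lerN2.
Qed.

Lemma coarse_small_ball (N : nat) (L : R) n Y : T = IntegerTime ->
  admissible_level T n -> time_span T f Y -> 0 < ip P Y Y -> 0 < L -> L <= 1 ->
  ((expR (- (8 * N.+1%:R)) / (4 * (4 / L ^+ 2) ^+ N.+1))%:E <=
    P [set om | forall j : nat, (j < N.+1 * 2 ^ n)%N ->
      `|residual P Y (f (j%:R / 2 ^+ n)) om| < L]%R)%E.
Proof.
move=> TE ok VY v0 L0 L1; have n0 := ok TE; rewrite n0.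
pose g (i : 'I_(N.+1)) := residual P Y (f i%:R).
have Tk (k : nat) : time_set T (k%:R : R).
  by have := admissible_time R k ok (leq0n n); rewrite expr0 divr1.
have Vg i : time_span T f (g i) by apply: (residual_span GV VY); exact: time_span_f.
have g1 i : ip P (g i) (g i) <= 1.
  rewrite -(ip_process_id Gf Sf m0 (Tk i)).
  by apply: (ip_residual_le GV VY v0); exact: time_span_f.
have L20 : 0 < L ^+ 2 by rewrite exprn_gt0.
have D0 : 0 < 4 * N.+1%:R :> R by rewrite mulr_gt0.
(* Weights [L^2] cancel the mean bound [4 / L^2] of the index, so the exponential cost is linear in
   [N]. *)
have HD : \sum_(i < N.+1) L ^+ 2 * (4 / L ^+ 2) <= 4 * N.+1%:R.
  rewrite big_const_ord iter_addr_0 mulrCA divff ?gt_eqF// mulr1 mulr_natr.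
  exact: lexx.
have H := @small_ball_coarse _ _ _ P _ GV _ g (fun=> L) (fun=> L ^+ 2) Vg (fun=> L0) (fun=> L20) _ D0 g1 HD.
apply: (@le_trans _ _ _ _ _ _ (le_trans H _)).
  rewrite mulrA (_ : 2 * 4 = 8); last by lra.
  rewrite lee_fin ler_wpM2l ?expR_ge0//.
  set W := \prod_i _.
  have W0 : 0 < W.
    by apply: prodr_gt0 => i _; rewrite divr_gt0 ?subr_gt0 ?expR_lt1 ?oppr_lt0.
  (* Each factor is at most 2 over [1 - exp (- L^2)], itself at least [L^2 / 2] because [L <= 1]. *)
  have WL : W <= (4 / L ^+ 2) ^+ N.+1.
    rewrite /W prodr_const card_ord lerXn2r ?nnegrE//.
    + by rewrite divr_ge0 ?subr_ge0 ?expR_le1 ?oppr_le0 ?(ltW L20)// addr_ge0 ?expR_ge0.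
    + by rewrite divr_ge0// ltW.
    have L21 : L ^+ 2 <= 1 by rewrite exprn_ile1// ltW.
    have e1 : expR (- L ^+ 2) <= (1 + L ^+ 2)^-1.
      by rewrite expRN lef_pV2 ?posrE ?expR_gt0 ?addr_gt0// expR_ge1Dx.
    have e2 : 1 - expR (- L ^+ 2) >= L ^+ 2 / 2.
      apply: (@le_trans _ _ (1 - (1 + L ^+ 2)^-1)); last by lra.
      have -> : 1 - (1 + L ^+ 2)^-1 = L ^+ 2 / (1 + L ^+ 2) by field; rewrite gt_eqF// addr_gt0.
      by rewrite ler_pM2l// lef_pV2 ?posrE ?addr_gt0//; lra.
    have e3 : expR (- L ^+ 2) <= 1 by rewrite expR_le1 oppr_le0 ltW.
    rewrite ler_pdivrMr; last by lra.
    apply: (@le_trans _ _ (4 / L ^+ 2 * (L ^+ 2 / 2))); last by rewrite ler_wpM2l// divr_ge0// ltW.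
    have -> : 4 / L ^+ 2 * (L ^+ 2 / 2) = 2 by field; rewrite gt_eqF.
    by lra.
  by rewrite lef_pV2 ?posrE ?mulr_gt0 ?exprn_gt0 ?divr_gt0// ler_pM2l.
have mr i : measurable [set om | `|g i om| < L].
  by have := measurable_dist_lt 0 L (gspace_meas GV (Vg i)); under eq_set do rewrite subr0.
rewrite le_eqVlt; apply/orP; left; apply/eqP; congr (P _).
apply/seteqP; split => om /= Ho.
  move=> j; rewrite expn0 muln1 => jN; rewrite expr0 divr1; exact: (Ho (Ordinal jN)).
by move=> i; have := Ho i; rewrite expn0 muln1 ltn_ord expr0 divr1 => /(_ isT).
Qed.

(** A step [2^-p] has increments of variance at most [4 (1 + m) 2^(- p delta') <= sigma^2 th^(4p)],
    whence the condition on [th^4]. *)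
Lemma fine_small_ball (delta delta' m sigma th C kappa : R) :
  0 < delta -> 0 < delta' -> delta' <= delta -> delta' <= 1 ->
  moment T rho delta = m%:E -> 0 <= m ->
  4 * (1 + m) <= sigma ^+ 2 -> th ^+ 4 = 2 `^ (- delta') ->
  (forall (N n : nat) (g : R -> Omega -> R),
  (forall m j : nat, (m <= n)%N -> time_span T f (g (j%:R / 2 ^+ m))) ->
  (forall k : nat, ip P (g k%:R) (g k%:R) <= sigma ^+ 2) ->
  (forall m j : nat, (m <= n)%N ->
    let X om := g (j.+1%:R / 2 ^+ m) om - g (j%:R / 2 ^+ m) om in
    ip P X X <= (sigma * th ^+ (2 * m)) ^+ 2) ->
  forall L, 0 < L -> 1 <= kappa * L ^+ 2 ->
  ((expR (- (C * N.+1%:R * expR (- (kappa * L ^+ 2 / 2)))) / 4)%:E <=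
  P [set om | forall j : nat, (j < N.+1 * 2 ^ n)%N -> `|g (j%:R / 2 ^+ n) om| < L]%R)%E) ->
  forall (N : nat) (L : R) n Y,
  admissible_level T n -> time_span T f Y -> 0 < ip P Y Y -> 0 < L -> 1 <= kappa * L ^+ 2 ->
  ((expR (- (C * N.+1%:R * expR (- (kappa * L ^+ 2 / 2)))) / 4)%:E <=
    P [set om | forall j : nat, (j < N.+1 * 2 ^ n)%N ->
      `|residual P Y (f (j%:R / 2 ^+ n)) om| < L]%R)%E.
Proof.
move=> d0 d0' dd d1 mm m_ge0 sm thE H N L n Y ok VY v0 L0 kL.
apply: (H N n (fun t => residual P Y (f t))) => //.
- move=> p j pn; apply: (residual_span GV VY); apply: time_span_f.
  exact: (admissible_time R j ok pn).
- move=> k.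
  have Tk : time_set T (k%:R : R).
    by have := admissible_time R k ok (leq0n n); rewrite expr0 divr1.
  apply: (le_trans (ip_residual_le GV VY v0 (time_span_f f Tk))).
  by rewrite (ip_process_id Gf Sf m0 Tk); lra.
- move=> p j pn /=.
  have Ta := admissible_time R j ok pn.
  have Tb := admissible_time R j.+1 ok pn.
  have Va := time_span_f f Ta; have Vb := time_span_f f Tb.
  have E := residualB GV VY v0 Vb Va.
  rewrite /= in E; rewrite -E.
  apply: (le_trans (ip_residual_le GV VY v0 (gspaceB GV Vb Va))).
  apply: (le_trans (ip_increment Gf Sf m0 d0 d0' dd d1 mm Ta Tb)).
  have -> : j.+1%:R / 2 ^+ p - j%:R / 2 ^+ p = (2 ^+ p)^-1 :> R.
    by rewrite -mulrBl -natr1 addrAC subrr add0r mul1r.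
  rewrite exprMn -exprM (_ : (2 * p * 2)%N = (4 * p)%N); last by lia.
  rewrite exprM thE.
  have -> : `|(2 ^+ p)^-1| `^ delta' = (2 `^ (- delta')) ^+ p :> R.
    by rewrite ger0_norm ?invr_ge0 ?exprn_ge0// powR_exprnV.
  by rewrite ler_wpM2r// exprn_ge0// powR_ge0.
Qed.

End lower_bounds.

Lemma lne_ge_expR (R : realType) (x : R) (p : \bar R) :
  ((expR (- x))%:E <= p)%E -> ((- x)%:E <= lne p)%E.
Proof.
move=> xp; rewrite -[x in (- x)%:E]opprK -[X in (X%:E <= _)%E]expRK opprK.
rewrite -lne_EFin ?expR_gt0// lee_lne// in_itv /= ?lee_fin ?expR_ge0 ?leey//.
by rewrite andbT (le_trans _ xp)// lee_fin expR_ge0.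
Qed.

Lemma quarter_expR (R : realType) (x : R) : expR (- (x + 2)) <= expR (- x) / 4.
Proof.
rewrite opprD expRD ler_wpM2l ?expR_ge0// expRN lef_pV2 ?posrE ?expR_gt0//.
have -> : 2 = 1 + 1 :> R by lra.
by rewrite expRD; have := @expR_ge1Dx R 1; nra.
Qed.

Section persistence_bounds.
Variables (R : realType) (b gamma : R).
Hypothesis b_gt0 : 0 < b.
Hypothesis gamma_gt0 : 0 < gamma.
Variables (C kappa : R).
Hypothesis C0 : 0 < C.
Hypothesis kappa0 : 0 < kappa.

Let K : R := 96 ^+ 2.
Let K0 : 0 < K. Proof. by rewrite /K exprn_gt0. Qed.

(** One constant for the three regimes: [4 K / (kappa b)] covers the shift for [gamma <= 1] and
    [K / b] for [gamma > 1]; [2 C] covers the chaining; [2 gamma] comes from the logarithm of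
    [L^-2], and 25 collects the numerical terms. *)
Definition persistence_constant := 2 * C + 25 + 2 * gamma + K / b + 4 * K / (kappa * b).

Let terms : [/\ 0 < K / b, 0 < K / (kappa * b) &
  persistence_constant = 2 * C + 25 + 2 * gamma + K / b + 4 * (K / (kappa * b))].
Proof. by split; rewrite ?divr_gt0 ?mulr_gt0// /persistence_constant mulrA. Qed.

Lemma persistence_constant_gt0 : 0 < persistence_constant.
Proof.
have [k1 k2 ->] := terms; move: k1 k2 C0 gamma_gt0.
by set k1 := K / b; set k2 := K / _; lra.
Qed.

Variables (T : time) (d : measure_display) (Omega : measurableType d)
  (P : probability Omega R) (f : R -> {RV P >-> R})
  (rho : {finite_measure set (measurableTypeR R) -> \bar R}).
Hypothesis Gf : gsp T f.
Hypothesis Sf : spectral_measure T f rho.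
Hypothesis m0 : moment T rho 0 = 1%E.
Hypothesis fine_ball : forall (N : nat) (L : R) n Y,
  admissible_level T n -> time_span T f Y -> 0 < ip P Y Y -> 0 < L -> 1 <= kappa * L ^+ 2 ->
  ((expR (- (C * N.+1%:R * expR (- (kappa * L ^+ 2 / 2)))) / 4)%:E <=
    P [set om | forall j : nat, (j < N.+1 * 2 ^ n)%N ->
      `|residual P Y (f (j%:R / 2 ^+ n)) om| < L]%R)%E.
Variable N : nat.
Hypothesis N_large : expR 1 < N%:R :> R.
Hypothesis sgN : ((b * N%:R `^ (- gamma))%:E <= sigma2 rho N%:R)%E.

Let sg := fine (sigma2 rho N%:R).
Let l := ln (N%:R : R).

Let N0 : (0 < N)%N.
Proof. by rewrite -(ltr_nat R); apply: lt_trans N_large; exact: expR_gt0. Qed.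
Let NR0 : (0 : R) < N%:R. Proof. by rewrite ltr0n. Qed.
Let N2 : (2 : R) <= N%:R.
Proof. by apply: ltW; apply: le_lt_trans N_large; have := @expR_ge1Dx R 1; lra. Qed.
Let l1 : 1 <= l.
Proof. by rewrite /l -[leLHS](expRK 1) ler_ln ?posrE ?expR_gt0//; exact: ltW. Qed.
Let Ng1 : 1 <= N%:R `^ gamma :> R.
Proof. by rewrite -[leLHS](powRr0 (N%:R : R)) ler_powR ?ler1n// ltW. Qed.

Let sg_pos : (0 < sigma2 rho N%:R)%E.
Proof. by apply: lt_le_trans sgN; rewrite lte_fin mulr_gt0// powR_gt0. Qed.
Let sg0 : 0 < sg.
Proof. by rewrite fine_gt0// sg_pos /= ltey_eq fin_num_measure. Qed.
Let sg_inv : sg^-1 <= N%:R `^ gamma / b.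
Proof.
have H : b * N%:R `^ (- gamma) <= sg by rewrite -lee_fin fineK// fin_num_measure.
rewrite -[leRHS]invrK lef_pV2 ?posrE ?invr_gt0 ?divr_gt0 ?powR_gt0//.
by rewrite invf_div -powRN.
Qed.

Let cost_le (L : R) : (96 * L) ^+ 2 / sg <= K * L ^+ 2 * (N%:R `^ gamma / b).
Proof.
by rewrite exprMn -/K ler_wpM2l// mulr_ge0 ?sqr_ge0// ltW.
Qed.

Let assemble (L u x : R) : 0 < L ->
  (forall n Y, admissible_level T n -> time_span T f Y -> 0 < ip P Y Y ->
    ((expR (- u))%:E <= P [set om | forall j : nat, (j < N.+1 * 2 ^ n)%N ->
      `|residual P Y (f (j%:R / 2 ^+ n)) om| < L]%R)%E) ->
  u + K * L ^+ 2 * (N%:R `^ gamma / b) + 3 <= x ->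
  ((- x)%:E <= lne (persistence T f N%:R))%E.
Proof.
move=> L0 H ux; apply: lne_ge_expR.
apply: le_trans (persistence_small_ball Gf Sf m0 N0 L0 (expR_ge0 _) sg_pos H).
rewrite lee_fin -expRD ler_expR.
by have := cost_le L; rewrite -/sg; lra.
Qed.

Let fine_ball' (L : R) n Y : 0 < L -> 1 <= kappa * L ^+ 2 ->
  admissible_level T n -> time_span T f Y -> 0 < ip P Y Y ->
  ((expR (- (C * N.+1%:R * expR (- (kappa * L ^+ 2 / 2)) + 2)))%:E <=
    P [set om | forall j : nat, (j < N.+1 * 2 ^ n)%N ->
      `|residual P Y (f (j%:R / 2 ^+ n)) om| < L]%R)%E.
Proof.
move=> L0 kL ok VY v0; apply: le_trans (fine_ball N ok VY v0 L0 kL).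
by rewrite lee_fin quarter_expR.
Qed.

Lemma persistence_subcritical : gamma < 1 ->
  ((- persistence_constant * N%:R `^ gamma * l)%:E <= lne (persistence T f N%:R))%E.
Proof.
move=> _.
(* Then [exp (- kappa L^2 / 2) = 1 / (N + 1)], and the chaining cost reduces to [C]. *)
pose L2 := 2 * ln N.+1%:R / kappa.
have lnS : ln (N.+1%:R : R) <= 2 * l.
  rewrite /l -[2]/(2%:R) mulr_natl -lnXn// ler_ln ?posrE ?exprn_gt0//.
  by rewrite -natr1; move: N2; nra.
have lnS1 : 1 <= ln (N.+1%:R : R).
  by apply: (le_trans l1); rewrite ler_ln ?posrE// ler_nat.
have L20 : 0 < L2 by rewrite /L2 divr_gt0// mulr_gt0//; lra.
have L2E : Num.sqrt L2 ^+ 2 = L2 by rewrite sqr_sqrtr// ltW.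
have kE : kappa * L2 = 2 * ln N.+1%:R by rewrite /L2; field; rewrite gt_eqF.
have sL0 : 0 < Num.sqrt L2 by rewrite sqrtr_gt0.
have kL : 1 <= kappa * Num.sqrt L2 ^+ 2 by rewrite L2E kE; lra.
have := assemble (x := persistence_constant * N%:R `^ gamma * l) sL0 (fun n Y => fine_ball' sL0 kL).
rewrite !mulNr; apply.
rewrite L2E kE.
have -> : C * N.+1%:R * expR (- (2 * ln N.+1%:R / 2)) = C.
  have -> : 2 * ln N.+1%:R / 2 = ln N.+1%:R :> R by field.
  by rewrite expRN lnK ?posrE// -mulrA divff ?mulr1// gt_eqF.
have [k1 k2 ->] := terms.
have E1 : K * L2 * (N%:R `^ gamma / b) <= 4 * (K / (kappa * b)) * (N%:R `^ gamma * l).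
  have -> : K * L2 * (N%:R `^ gamma / b) = 2 * (K / (kappa * b)) * (N%:R `^ gamma * ln N.+1%:R).
    by rewrite /L2; field; rewrite !gt_eqF.
  apply: (@le_trans _ _ (2 * (K / (kappa * b)) * (N%:R `^ gamma * (2 * l)))); last by lra.
  rewrite ler_wpM2l//; first by rewrite mulr_ge0// ltW.
  by rewrite ler_wpM2l// powR_ge0.
have Nl : 1 <= N%:R `^ gamma * l by rewrite -[leLHS](mulr1 1) ler_pM.
rewrite -[X in _ <= X]mulrA; move: E1 Nl; set z := N%:R `^ gamma * l => E1 Nl.
move: k1 k2 E1 C0 gamma_gt0; set k1 := K / b; set k2 := K / _ => k1p k2p E1 C0' g0'.
have : 1 * (2 * C + 25 + 2 * gamma + k1) <= z * (2 * C + 25 + 2 * gamma + k1).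
  by rewrite ler_wpM2r//; lra.
by lra.
Qed.

Lemma persistence_critical : gamma = 1 ->
  ((- persistence_constant * N%:R)%:E <= lne (persistence T f N%:R))%E.
Proof.
move=> g1.
(* The least level that chaining admits; both costs are then linear in [N]. *)
pose L2 := kappa^-1.
have L20 : 0 < L2 by rewrite invr_gt0.
have L2E : Num.sqrt L2 ^+ 2 = L2 by rewrite sqr_sqrtr// ltW.
have kE : kappa * L2 = 1 by rewrite /L2 divff// gt_eqF.
have sL0 : 0 < Num.sqrt L2 by rewrite sqrtr_gt0.
have kL : 1 <= kappa * Num.sqrt L2 ^+ 2 by rewrite L2E kE.
have := assemble (x := persistence_constant * N%:R) sL0 (fun n Y => fine_ball' sL0 kL).
rewrite !mulNr; apply.
rewrite L2E kE.
have [k1 k2 ->] := terms.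
have E1 : C * N.+1%:R * expR (- (1 / 2)) <= 2 * C * N%:R.
  apply: (@le_trans _ _ (C * N.+1%:R)).
    by rewrite ler_piMr ?mulr_ge0 ?(ltW C0)// expR_le1; lra.
  by rewrite -natr1; move: N2 C0; nra.
have -> : K * L2 * (N%:R `^ gamma / b) = K / (kappa * b) * N%:R.
  by rewrite g1 powRr1 ?(ltW NR0)// /L2; field; rewrite !gt_eqF.
move: k1 k2 E1 C0 gamma_gt0; set k1 := K / b; set k2 := K / _ => k1p k2p E1 C0' g0'.
have : 2 * (25 + 2 * gamma + k1 + 3 * k2) <= N%:R * (25 + 2 * gamma + k1 + 3 * k2).
  by rewrite ler_wpM2r//; move: gamma_gt0; lra.
by move: gamma_gt0; lra.
Qed.

Lemma persistence_supercritical : 1 < gamma -> T = IntegerTime ->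
  ((- persistence_constant * N%:R * l)%:E <= lne (persistence T f N%:R))%E.
Proof.
move=> g1 TE.
(* Chosen so that [L^2 N^gamma = 1]: the shift costs [K / b], and the ball [(4 / L^2)^(N + 1)] costs
   of order [N log N]. *)
pose L := N%:R `^ (- (gamma / 2)) : R.
have L0 : 0 < L by rewrite powR_gt0.
have L2E : L ^+ 2 = (N%:R `^ gamma)^-1.
  rewrite /L -powRN -powR_mulrn ?powR_ge0// -powRrM; congr (_ `^ _).
  by field.
have L1 : L <= 1.
  rewrite /L powRN invf_le1 ?powR_gt0// -[leLHS](powRr0 (N%:R : R)) ler_powR ?ler1n//.
  by rewrite divr_ge0// ltW.
have ball n Y : admissible_level T n -> time_span T f Y -> 0 < ip P Y Y ->
    ((expR (- (8 * N.+1%:R + (2 + gamma * l) * N.+1%:R + 2)))%:E <=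
    P [set om | forall j : nat, (j < N.+1 * 2 ^ n)%N ->
      `|residual P Y (f (j%:R / 2 ^+ n)) om| < L]%R)%E.
  move=> ok VY v0; apply: le_trans (coarse_small_ball Gf Sf m0 N TE ok VY v0 L0 L1).
  rewrite lee_fin; apply: (le_trans (quarter_expR _)).
  rewrite opprD expRD -mulrA ler_wpM2l ?expR_ge0// invfM mulrC ler_wpM2l ?invr_ge0//.
  rewrite expRN lef_pV2 ?posrE ?expR_gt0 ?exprn_gt0 ?divr_gt0 ?exprn_gt0//.
  rewrite expRM_natr lerXn2r ?nnegrE ?expR_ge0 ?divr_ge0 ?sqr_ge0//.
  rewrite L2E invrK expRD ler_pM ?powR_ge0//.
    have -> : 2 = 1 + 1 :> R by lra.
    by rewrite expRD; have := @expR_ge1Dx R 1; nra.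
  by rewrite /powR gt_eqF// mulrC.
have := assemble (x := persistence_constant * N%:R * l) L0 ball.
rewrite !mulNr; apply.
have -> : K * L ^+ 2 * (N%:R `^ gamma / b) = K / b.
  by rewrite L2E; field; rewrite !gt_eqF// powR_gt0.
have [k1 k2 ->] := terms.
move: k1 k2 C0 gamma_gt0; set k1 := K / b; set k2 := K / _ => k1p k2p C0' g0'.
have Nl : 1 <= N%:R * l by move: N2 l1; nra.
have NlN : N%:R <= N%:R * l by rewrite ler_peMr// ltW.
have lNl : l <= N%:R * l by move: N2 l1; nra.
rewrite -[X in _ <= X]mulrA -(natr1 N); move: Nl NlN lNl; set z := N%:R * l => Nl NlN lNl.
have e1 : (2 + gamma * l) * (N%:R + 1) = 2 * N%:R + 2 + gamma * z + gamma * l by rewrite /z; ring.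
have e2 : gamma * l <= gamma * z by rewrite ler_pM2l.
have e3 : 1 * (k1 + 4 * k2 + 2 * C) <= z * (k1 + 4 * k2 + 2 * C).
  by rewrite ler_wpM2r//; lra.
rewrite e1; move: e2 e3 N2; lra.
Qed.

End persistence_bounds.

Theorem proposition1 (R : realType) (b gamma delta m : R)
    (b_gt0 : 0 < b) (gamma_gt0 : 0 < gamma) (delta_gt0 : 0 < delta) :
  exists C N0 : R, [/\ 0 < C, 0 < N0 &
    forall (T : time) (d : measure_display) (Omega : measurableType d)
      (P : probability Omega R) (f : R -> {RV P >-> R})
      (rho : {finite_measure set (measurableTypeR R) -> \bar R})
      (N_ : nat -> nat),
    gsp T f -> spectral_measure T f rho ->
    moment T rho 0 = 1%E -> moment T rho delta = m%:E ->
    (forall k, (0 < N_ k)%N) -> {homo N_ : j k / (j < k)%N} ->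
    (forall k, ((b * (N_ k)%:R `^ (- gamma))%:E <= sigma2 rho (N_ k)%:R)%E) ->
    forall k, let N : R := (N_ k)%:R in N0 < N ->
    [/\ gamma < 1 ->
          ((- C * N `^ gamma * ln N)%:E <= lne (persistence T f N))%E,
        gamma = 1 ->
          ((- C * N)%:E <= lne (persistence T f N))%E &
        1 < gamma -> T = IntegerTime ->
          ((- C * N * ln N)%:E <= lne (persistence T f N))%E]].
Proof.
(* [1 - cos] is bounded by powers of exponent at most 1, and a smaller exponent only costs the mass
   of [rho]. *)
pose delta' := Num.min delta 1.
have d0' : 0 < delta' by rewrite /delta' lt_min delta_gt0 ltr01.
have dd : delta' <= delta by rewrite /delta' ge_min lexx.
have d1 : delta' <= 1 by rewrite /delta' ge_min lexx orbT.
(* A fourth root: two factors 2 because variances become deviations and because the cell widths use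
   half of the decay. *)
pose th : R := 2 `^ (- (delta' / 4)).
(* The constants are fixed before any measure is given, when the sign of [m] is not yet known. *)
pose sigma := 2 * Num.sqrt (1 + `|m|).
have m1 : 0 < 1 + `|m| by have := normr_ge0 m; lra.
have sigma0 : 0 < sigma by rewrite mulr_gt0// sqrtr_gt0.
have sigmaE : sigma ^+ 2 = 4 * (1 + `|m|).
  by rewrite exprMn sqr_sqrtr ?(ltW m1)//; ring.
have th0 : 0 < th by rewrite powR_gt0.
have th1 : th < 1.
  rewrite /th powRN invf_lt1 ?powR_gt0// /powR gt_eqF// -[ltLHS]expR0 ltr_expR mulr_gt0 ?divr_gt0//.
  by rewrite ln_gt0// ltr1n.
have thE : th ^+ 4 = 2 `^ (- delta').
  rewrite /th -powR_mulrn ?powR_ge0// -powRrM; congr (_ `^ _).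
  by field.
have [C [kappa [C0 kappa0 ball]]] := dyadic_small_ball sigma0 th0 th1.
(* [N > exp 1] gives [log N >= 1], so that additive constants are absorbed. *)
exists (persistence_constant b gamma C kappa), (expR 1); split.
- exact: persistence_constant_gt0.
- exact: expR_gt0.
move=> T d Omega P f rho N_ Gf Sf m0 mm _ _ HN k N NN.
have m_ge0 : 0 <= m.
  rewrite -lee_fin -mm /moment; apply: integral_ge0 => l _.
  by rewrite lee_fin powR_ge0.
have sm : 4 * (1 + m) <= sigma ^+ 2 by rewrite sigmaE (ger0_norm m_ge0).
have fb := fine_small_ball Gf Sf m0 delta_gt0 d0' dd d1 mm m_ge0 sm thE
  (fun N n g => ball d Omega P (time_span T f) N n g (time_span_gaussian Gf)).
split.
- exact: (persistence_subcritical b_gt0 gamma_gt0 C0 kappa0 Gf Sf m0 fb NN (HN k)).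
- exact: (persistence_critical b_gt0 gamma_gt0 C0 kappa0 Gf Sf m0 fb NN (HN k)).
- exact: (persistence_supercritical b_gt0 gamma_gt0 C0 kappa0 Gf Sf m0 NN (HN k)).
Qed.
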